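(* Let $0<\theta<1$ be fixed. Consider the estimate $$(\ast)\qquad \sum_{m\le Q}\max_{2\le y\le x}\left|\pi(y;m,1)-\frac{\mathrm{li}(y)}{\phi(m)}\right|\ll R,$$ where $Q=Q(x)$, $R=R(x)$. (a) If $(\ast)$ holds with $Q=x^{\theta}$ and $R=o(x/\log x)$ (as $x\to\infty$), then for any $c<\frac{1}{e^{-1}-\log\theta}$, we have $H(p)>c\log_2 p$ for almost all primes $p$. (b) If $(\ast)$ holds with $Q=x^{\theta}$ and $R=x(\log x)^{-A}$ for every $A>1$ (implied constant depending on $A$), then for every $c<\frac{1}{-\log\theta}$ there is a $K$ so that $H(p)>c\log_2 p$ for $\gg x/(\log x)^K$ primes $p\le x$. Consequently, $$\Lambda:=\limsup_{p\to\infty}\frac{H(p)}{\log_2 p}\ge\frac{1}{-\log\theta}.$$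
   Context: For positive integers $a,b$ write $a\prec b$ if $b\equiv 1\pmod a$. A prime chain (of length $k\ge 1$) is a sequence of primes $p_1\prec p_2\prec\cdots\prec p_k$. For a prime $p$, $H(p)$ is the length $k$ of the longest prime chain with $p_k=p$. $\pi(x;q,a)=|\{p\le x: p\text{ prime},\ p\equiv a\pmod q\}|$, $\mathrm{li}(x)=\int_2^x dt/\log t$, $\phi$ is Euler's function, $\log_2 x=\log\log x$. A property holds for almost all primes if the number of primes $p\le x$ failing it is $o(x/\log x)$ as $x\to\infty$. *)

(* Defs.v *)
From HB Require Import structures.
From mathcomp Require Import all_boot all_order all_algebra.
From mathcomp Require Import all_classical all_reals all_analysis.

Set Implicit Arguments.
Unset Strict Implicit.
Unset Printing Implicit Defensive.

Import Order.TTheory GRing.Theory Num.Theory.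
Import numFieldNormedType.Exports.

Local Open Scope classical_set_scope.
Local Open Scope ring_scope.

Definition prec (a b : nat) : bool := (b == 1 %[mod a])%N.

Definition prime_chain (s : seq nat) (p : nat) : bool :=
  [&& s != [::], last 0%N s == p, all prime s & sorted prec s].

(* Primes along a chain strictly increase, so no chain ending at p has length
   above p and the bound on k loses nothing; see maxchain_attained and
   leq_maxchain. For p not prime there is no chain, and maxchain p = 0. *)
Definition maxchain (p : nat) : nat :=
  (\max_(k < p.+1 | `[< exists2 s, prime_chain s p & size s = k >]) k)%N.

Lemma prime_chain_size (s : seq nat) (p : nat) :
  prime_chain s p -> (size s <= p)%N.
Proof.
case: s => [|x s] // /and4P[_ /eqP<- /= /andP[px ps]].
have : (1 <= x)%N by apply: prime_gt0.
rewrite -[(size s).+1]add1n; elim: s x px ps 1%N => [|y s IHs] x px ps m mx /=.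
  by rewrite addn0.
move: ps => /= /andP[py ps] /andP[xy pys]; rewrite -addSnnS.
apply: IHs => //; apply: leq_ltn_trans mx _; rewrite ltnNge; apply/negP => yx.
move: xy; rewrite /prec (modn_small (prime_gt1 px)).
move: yx; rewrite leq_eqVlt => /orP[/eqP->|yx]; first by rewrite modnn.
by rewrite modn_small // => /eqP y1; move: py; rewrite y1.
Qed.

Lemma leq_maxchain (s : seq nat) (p : nat) :
  prime_chain s p -> (size s <= maxchain p)%N.
Proof.
move=> sp; have sz : (size s < p.+1)%N by rewrite ltnS prime_chain_size.
by apply: (leq_bigmax_cond (Ordinal sz)); apply/asboolP; exists s.
Qed.

Lemma maxchain_attained (p : nat) :
  prime p -> exists2 s, prime_chain s p & size s = maxchain p.
Proof.
move=> pp; have p1 : (1 < p.+1)%N by rewrite ltnS prime_gt0.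
have P1 : `[< exists2 s, prime_chain s p & size s = Ordinal p1 >].
  by apply/asboolP; exists [:: p] => //; rewrite /prime_chain /= eqxx pp.
rewrite /maxchain (bigop.bigmax_eq_arg (Ordinal p1)) //.
by case: arg_maxnP => //= i /asboolP.
Qed.

Canonical infty (R : realType) : filter_on R :=
  FilterType (pinfty_nbhs R) (@proper_pinfty_nbhs R).
Arguments infty {R}.

Section PrimeChains.
Context {R : realType}.
Implicit Types (x y theta c : R) (P : pred nat).

Definition prime_count P x : nat :=
  (\sum_(0 <= p < (Num.truncn x).+1 | prime p && P p) 1)%N.

Definition primepi_mod x (q a : nat) : nat :=
  prime_count (fun p => (p == a %[mod q])%N) x.

Definition li x : R :=
  \int[@lebesgue_measure R]_(t in `[2, x]) (ln t)^-1.

(* The maximum over real y is taken as a supremum: the counting function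
   jumps at primes, so a maximum need not be attained. *)
Definition max_discrepancy (m : nat) x : R :=
  sup [set `|(primepi_mod y m 1)%:R - li y / (totient m)%:R| | y in `[2, x]].

Definition discrepancy_sum (Q : R -> R) x : R :=
  \sum_(1 <= m < (Num.truncn (Q x)).+1) max_discrepancy m x.

Definition discrepancy_estimate (Q B : R -> R) : Prop :=
  discrepancy_sum Q =O_infty B.

Definition almost_all_primes P : Prop :=
  (fun x => (prime_count (fun p => ~~ P p) x)%:R : R)
    =o_infty (fun x => x / ln x).

Definition loglog x : R := ln (ln x).

Definition long_chain c : pred nat :=
  fun p => c * loglog p%:R < (maxchain p)%:R.

Definition Lambda : \bar R :=
  limf_esup (fun p : nat => ((maxchain p)%:R / loglog p%:R)%:E)
            (within [set p | prime p] \oo).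

End PrimeChains.
Arguments Lambda : clear implicits.

(* Main.v *)
(* Let d_h(i) be the proportion of primes p in the block (b^i, b^(i+1)] with
   H(p) >= h.  If a prime q with H(q) >= h divides p - 1 then H(p) >= h + 1, and
   the estimate ( * ) counts the p below x with q | p - 1 on average over
   q <= x^theta.

   Part (b).  Each p has boundedly many prime factors q >= x^(1/lambda), so
   counting pairs (q, p) gives d_{h+1}(i) >= 2 gamma d - O(error) whenever
   d_h >= d on the blocks j >= i/lambda, for a fixed gamma > 0 and any
   lambda > 1/theta.  Hence d_{h+1}(i) >= gamma^h / 2 as soon as
   i >= X0 lambda^h, and gamma^h is a fixed power of 1/i.

   Part (a).  Losing a constant factor at each step is not affordable.  When the
   mass m of the available q is small, a second moment gives
   d_{h+1}(i) >= (1 - eta) m - C m^2.  The pairs q q' beyond the range of ( * )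
   are bounded by Selberg's sieve as long as q q' <= x^(1 - eps); Turan's
   method shows that most p with q | p - 1 have a further prime factor in
   (x^eps, x^eps'), which rules out larger pairs.  The linearized recursion
   turns the constant delta at scales >= X, after n steps, into
   delta * log(theta^n i / X)^n / n!, which at i = X e^(n/c) exceeds delta for
   some n exactly when e (1/c + log theta) > 1.  So a positive proportion of
   primes has H(p) >= c log log p - O(1), and Turan's method once more shows
   that almost every p has such a prime q = p^(u), u bounded below, dividing
   p - 1. *)
Require Import Defs.
From HB Require Import structures.
From mathcomp Require Import all_boot all_order all_algebra.
From mathcomp Require Import all_classical all_reals all_analysis.
From mathcomp Require Import ring lra zify.

Set Implicit Arguments.
Unset Strict Implicit.
Unset Printing Implicit Defensive.

Import Order.TTheory GRing.Theory Num.Theory.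
Import numFieldNormedType.Exports.

Local Open Scope classical_set_scope.
Local Open Scope ring_scope.

(** The estimate has no rate in part (a), so only boundedly many steps can be made with a controlled
    error. Hence [n] is fixed first: the recursion runs for [n] steps across the scale factor
    e^(n/c), where it returns the density [delta] it started from, and the next round begins with no
    accumulated loss. The number e in the condition on [c] is the growth rate of n^n / n!. The
    quadratic loss [C * m ^ 2] is harmless once [delta] is small, because [C] depends on neither
    [delta] nor the final error [tau]. Losses proportional to the mass recur at every step and would
    change the constant; among them is the factor [b] lost by treating all primes of a block alike,
    so part (a) takes [b] close to 1. In part (b) such losses only alter [gamma]; but there the
    error must stay below [gamma ^ h], a power of 1/i, which is where arbitrary powers of the
    logarithm enter.

    The auxiliary prime factor is forced by the sieve, which saves a full logarithm only if the
    cofactor of q q' in p - 1 can be as large as a fixed power of x. *)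

Section PeriodicSums.
Context {R : realType}.
Implicit Types (g A B : nat -> R).

Lemma periodic_mul g M (per : forall t, g (t + M)%N = g t) r u :
  g (r + u * M)%N = g r.
Proof.
elim: u => [|u IHu]; first by rewrite mul0n addn0.
by rewrite mulSn (addnC M) addnA per.
Qed.

Lemma sum_residues_mul g l M :
  \sum_(0 <= t < l * M) g t =
  \sum_(0 <= r < M) \sum_(0 <= u < l) g (r + u * M)%N.
Proof.
rewrite big_nat_mul exchange_big_nat /=; apply: eq_big_nat => u _.
by rewrite mulSn -{1}[(u * M)%N]add0n big_addn addnK.
Qed.

(** As [a] is invertible mod [l], the values [c + u * a] with [u < l] represent every residue once,
    so exactly one of the [l] terms is [x]. *)
Lemma sum_progression_dvd (a c l : nat) (x y : R) (pl : prime l)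
    (al : coprime a l) :
  \sum_(0 <= u < l) (if (l %| c + u * a)%N then x else y) = x + (l%:R - 1) * y.
Proof.
case: l pl al => // l pl al.
rewrite big_mkord.
pose f (u : 'I_l.+1) : 'I_l.+1 := inord ((c + u * a) %% l.+1).
have fE (u : 'I_l.+1) : f u = ((c + u * a) %% l.+1)%N :> nat.
  by rewrite inordK // ltn_pmod.
have finj : injective f.
  move=> u v /(congr1 val); rewrite /= !fE => /eqP.
  rewrite eqn_modDl; wlog uv : u v / (v <= u)%N => [H|].
    by case/orP: (leq_total v u) => uv ?; [|symmetry]; apply: H; rewrite // eq_sym.
  rewrite eqn_mod_dvd ?leq_mul2r ?uv ?orbT// -mulnBl Gauss_dvdl; last by rewrite coprime_sym.
  move=> H; apply/val_inj => /=; apply/eqP; rewrite eqn_leq uv andbT.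
  move: H; rewrite -subn_eq0; case: (_ - _)%N (leq_subr v u) => // m mu /dvdn_leq.
  by move=> /(_ isT) lm; have := ltn_ord u; lia.
rewrite (eq_bigr (fun u => if f u == ord0 then x else y)); last first.
  by move=> u _; rewrite -val_eqE /= fE.
rewrite -(reindex_inj finj (P := xpredT) (F := fun v => if v == ord0 then x else y)) /=.
rewrite (bigD1 ord0)//= (eq_bigr (fun=> y)); last by move=> i /negbTE ->.
rewrite sumr_const cardC1 card_ord /= -[y *+ l]mulr_natl.
by rewrite -[l.+1%:R]natr1 addrK.
Qed.

(** The Chinese remainder theorem as independence: in [t = r + u * M], with [M] the product of the
    other primes, [u] leaves their conditions alone and runs through all residues mod [l]. *)
Lemma sum_prod_dvd (s : seq nat) (k c : nat) A B :
  uniq s -> all prime s -> all (coprime k) s ->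
  \sum_(0 <= t < \prod_(l <- s) l)
     \prod_(l <- s) (if (l %| c + t * k)%N then A l else B l) =
  \prod_(l <- s) (A l + (l%:R - 1) * B l).
Proof.
elim: s => [|l s IHs] /=; first by rewrite !big_nil big_nat1 big_nil.
move=> /andP[ls us] /andP[pl ps] /andP[kl ks].
rewrite big_cons sum_residues_mul big_cons -IHs // mulr_sumr.
apply: eq_big_nat => r _.
set M := (\prod_(j <- s) j)%N.
rewrite -(@sum_progression_dvd (M * k) (c + r * k)) //; last first.
  rewrite coprimeMl kl andbT /M.
  elim: s {IHs ks us} ps ls {M} => [|j s IHs] /=; first by rewrite big_nil coprime1n.
  move=> /andP[pj ps]; rewrite in_cons negb_or => /andP[lj ls].
  rewrite big_cons coprimeMl IHs // andbT prime_coprime // dvdn_prime2 //.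
  by rewrite eq_sym.
rewrite mulr_suml; apply: eq_bigr => u _; rewrite big_cons mulnDl addnA -mulnA.
congr (_ * _); apply: eq_big_seq => j js; congr (if _ then _ else _).
rewrite dvdn_addl // dvdn_mull // dvdn_mulr // /M (big_rem j) //=.
by rewrite dvdn_mulr.
Qed.

Lemma sum_periodic_le g M T (D : R) (M0 : (0 < M)%N)
    (per : forall t, g (t + M)%N = g t) (gle : forall t, g t <= 1)
    (gM : \sum_(0 <= t < M) g t = M%:R * D) (D0 : 0 <= D) :
  \sum_(0 <= t < T) g t <= T%:R * D + M%:R.
Proof.
rewrite (@big_cat_nat _ _ _ (T %/ M * M)) //=; last by rewrite leq_divM.
apply: lerD.
  rewrite sum_residues_mul.
  under eq_bigr => r _.
    under eq_bigr do rewrite (periodic_mul per).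
    rewrite sumr_const_nat subn0; over.
  rewrite /= sumrMnl gM -[X in X <= _]mulr_natl mulrA -natrM ler_wpM2r // ler_nat.
  by rewrite leq_divM.
apply: (@le_trans _ _ (\sum_(T %/ M * M <= t < T) 1)).
  by apply: ler_sum => t _.
rewrite sumr_const_nat ler_nat.
by rewrite leq_subLR {1}(divn_eq T M) leq_add2l ltnW // ltn_pmod.
Qed.

End PeriodicSums.

(** * Selberg's sieve *)

Lemma big_subset_uniq (T : Type) (idx : T) (op : Monoid.com_law idx)
    (r s : seq nat) (F : nat -> T) : uniq r -> uniq s -> {subset r <= s} ->
  \big[op/idx]_(l <- r) F l = \big[op/idx]_(l <- s | l \in r) F l.
Proof.
move=> ur us rs; rewrite -[RHS]big_filter; apply: perm_big.
apply: uniq_perm => // [|l]; first exact: filter_uniq.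
by rewrite mem_filter; case: (boolP (l \in r)) => //= /rs.
Qed.

(** Encoded as a product formula so that it can be used directly for rewriting; 0 is excluded
    because [primes 0] is empty. *)
Definition sqfree (f : nat) : bool := f == (\prod_(l <- primes f) l)%N.

Section SelbergSieve.
Context {R : realType}.
Variables (k c : nat).

(* The two values make the mean over residues mod l vanish, so that the products
   selberg_char f over squarefree f are orthogonal. *)
Definition selberg_local (l n : nat) : R :=
  if (l %| n)%N then -1 else (l%:R - 1)^-1.

Definition selberg_char (f n : nat) : R :=
  \prod_(l <- primes f) selberg_local l n.

(** For squarefree [f] this is 1 / phi(f); it is also the mean of [selberg_char f ^+ 2] over a full
    period. *)
Definition selberg_weight (f : nat) : R :=
  \prod_(l <- primes f) (l%:R - 1)^-1.

Lemma selberg_local_norm l n : prime l -> `|selberg_local l n| <= 1.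
Proof.
move=> /prime_gt1; rewrite -(ler_nat R) => l2.
rewrite /selberg_local; case: ifP => _; first by rewrite normrN normr1.
by rewrite ger0_norm ?invf_le1 ?invr_ge0; lra.
Qed.

Lemma selberg_weight_gt0 f : 0 < selberg_weight f.
Proof.
rewrite /selberg_weight big_seq; apply: prodr_gt0 => l.
rewrite mem_primes => /andP[/prime_gt1]; rewrite -(ler_nat R) => l2 _.
by rewrite invr_gt0; lra.
Qed.

Lemma selberg_char_norm f n : `|selberg_char f n| <= 1.
Proof.
rewrite /selberg_char normr_prod big_seq.
apply: prodr_ile1 => l; rewrite mem_primes => /andP[pl _].
by rewrite normr_ge0 selberg_local_norm.
Qed.

(** Over a full period, of length lcm(f, f'), the mean is an exact product of local factors, and a
    prime dividing only one of [f], [f'] makes it vanish. The term [f * f'] pays for the incomplete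
    period. *)
Lemma selberg_char_corr f f' T (f0 : (0 < f)%N) (f'0 : (0 < f')%N)
    (sf : sqfree f) (sf' : sqfree f')
    (kf : forall l, l \in primes f -> coprime k l)
    (kf' : forall l, l \in primes f' -> coprime k l) :
  \sum_(0 <= t < T) selberg_char f (c + t * k) * selberg_char f' (c + t * k)
  <= T%:R * (if f == f' then selberg_weight f else 0) + f%:R * f'%:R.
Proof.
pose s := undup (primes f ++ primes f').
have us : uniq s by exact: undup_uniq.
have s1 : {subset primes f <= s}.
  by move=> l lf; rewrite mem_undup mem_cat lf.
have s2 : {subset primes f' <= s}.
  by move=> l lf; rewrite mem_undup mem_cat lf orbT.
have sP l : l \in s -> prime l /\ coprime k l.
  rewrite mem_undup mem_cat => /orP[] lf.
    by split; [move: lf; rewrite mem_primes => /andP[] | exact: kf].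
  by split; [move: lf; rewrite mem_primes => /andP[] | exact: kf'].
set D := if _ then _ else _.
pose M := (\prod_(l <- s) l)%N.
have M0 : (0 < M)%N.
  by rewrite /M big_seq prodn_cond_gt0 // => l /sP[/prime_gt0].
have Mff : (M <= f * f')%N.
  rewrite [X in (_ <= X * _)%N](eqP sf) [X in (_ <= _ * X)%N](eqP sf').
  rewrite (big_subset_uniq _ _ (primes_uniq _) us s1).
  rewrite (big_subset_uniq _ _ (primes_uniq _) us s2).
  rewrite /M (bigID [in primes f]) /= leq_mul2l; apply/orP; right.
  rewrite [X in (_ <= X)%N](bigID [in primes f]) /=.
  rewrite [X in (_ <= _ * X)%N](eq_bigl (fun l => (l \notin primes f) && (l \in s))); last first.
    move=> l; rewrite mem_undup mem_cat andbC; case: (l \in primes f) => //=.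
  rewrite [X in (X <= _)%N]big_seq_cond.
  under eq_bigl do rewrite andbC.
  rewrite leq_pmull // big_seq_cond prodn_cond_gt0 // => l /and3P[ls _ _].
  by have [/prime_gt0] := sP l ls.
(* [A l] and [B l] are the local factors of the product of the two characters according as [l]
   divides [n] or not. The sum [A l + (l - 1) * B l] over the residues mod [l] is [l / (l - 1)] for
   a common prime and 0 for a prime of only one of [f], [f']. *)
pose A l : R := (if l \in primes f then -1 else 1) * (if l \in primes f' then -1 else 1).
pose B l : R := (if l \in primes f then (l%:R - 1)^-1 else 1) *
                (if l \in primes f' then (l%:R - 1)^-1 else 1).
have gE n : selberg_char f n * selberg_char f' n =
    \prod_(l <- s) (if (l %| n)%N then A l else B l).
  rewrite /selberg_char (big_subset_uniq _ _ (primes_uniq _) us s1).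
  rewrite (big_subset_uniq _ _ (primes_uniq _) us s2).
  rewrite [X in X * _]big_mkcond [X in _ * X]big_mkcond -big_split /=.
  apply: eq_bigr => l _; rewrite /selberg_local /A /B.
  by case: (l \in primes f); case: (l \in primes f'); case: ifP.
have full : \sum_(0 <= t < M) selberg_char f (c + t * k) * selberg_char f' (c + t * k)
    = M%:R * D.
  under eq_bigr do rewrite gE.
  rewrite sum_prod_dvd //; first last.
  - by apply/allP => l /sP[].
  - by apply/allP => l /sP[].
  rewrite /D; case: eqVneq => [ff|nff].
    rewrite /selberg_weight (big_subset_uniq _ _ (primes_uniq _) us s1).
    rewrite [X in _ = _ * X]big_mkcond /M natr_prod -big_split /=; apply: eq_big_seq => l ls.
    have lf : l \in primes f by move: ls; rewrite mem_undup mem_cat -ff orbb.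
    rewrite /A /B -ff lf.
    have : (1 < l)%N by have [/prime_gt1] := sP _ ls.
    rewrite -(ler_nat R); move: (l%:R : R) => x x2.
    have x10 : x - 1 != 0 by apply: lt0r_neq0; lra.
    rewrite mulrN1 opprK mulrA mulfV // mul1r.
    by apply: (mulfI x10); rewrite mulrDr mulrCA mulfV // !mulr1 subrK.
  have [l ls lff] : exists2 l, l \in s & (l \in primes f) != (l \in primes f').
    apply/hasP; apply: contraNT nff => /hasPn H; apply/eqP.
    rewrite (eqP sf) (eqP sf'); apply: perm_big; apply: uniq_perm; rewrite ?primes_uniq //.
    move=> l; case: (boolP (l \in s)) => [/H/negPn/eqP //|].
    by rewrite mem_undup mem_cat => /norP[/negbTE-> /negbTE->].
  rewrite (big_rem l) //= mulr0.
  have : (1 < l)%N by have [/prime_gt1] := sP _ ls.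
  rewrite -(ler_nat R) => l2.
  suff -> : A l + (l%:R - 1) * B l = 0 by rewrite mul0r.
  rewrite /A /B; move: lff l2; move: (l%:R : R) => x + x2.
  have x10 : x - 1 != 0 by apply: lt0r_neq0; lra.
  case: (l \in primes f); case: (l \in primes f') => //= _;
    by rewrite ?mulr1 ?mul1r mulfV // addNr.
apply: le_trans (_ : T%:R * D + M%:R <= _); last first.
  by rewrite lerD2l -natrM ler_nat.
apply: sum_periodic_le full _ => //.
- move=> t; rewrite !gE; apply: eq_big_seq => l ls.
  congr (if _ then _ else _).
  by rewrite mulnDl addnA dvdn_addl // dvdn_mulr // /M (big_rem l) //= dvdn_mulr.
- move=> t; apply: le_trans (ler_norm _) _; rewrite normrM.
  by rewrite -[leRHS]mulr1 ler_pM // selberg_char_norm.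
- by rewrite /D; case: ifP => // _; exact/ltW/selberg_weight_gt0.
Qed.

Variable z : nat.
Hypothesis kz : forall l, prime l -> (l <= z)%N -> coprime k l.

Let F := [seq f <- iota 1 z | sqfree f].
Definition selberg_mass : R := \sum_(f <- [seq f <- iota 1 z | sqfree f]) selberg_weight f.

(** If no prime up to [z] divides [n], each local value is [(l - 1)^-1] and the sum of
    [selberg_char f n] over squarefree [f <= z] equals [selberg_mass]. Its square therefore
    majorizes the indicator times [selberg_mass ^+ 2], and orthogonality leaves only the diagonal of
    the expanded square, up to [z ^ 4]. This is Selberg's quadratic form already diagonalized. *)
Lemma selberg_sieve T :
  (\sum_(0 <= t < T) (all (fun l => prime l ==> ~~ (l %| c + t * k)%N) (iota 1 z))%:R)
    * selberg_mass ^+ 2 <= T%:R * selberg_mass + z%:R ^+ 4.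
Proof.
have FP f : f \in F -> [/\ (0 < f)%N, (f <= z)%N & sqfree f].
  by rewrite mem_filter mem_iota => /andP[-> /andP[-> ]]; rewrite add1n ltnS.
have Fl f l : f \in F -> l \in primes f -> prime l && (l <= z)%N.
  move=> /FP[f0 fz _]; rewrite mem_primes => /and3P[-> _ /dvdn_leq lf] /=.
  exact: leq_trans (lf f0) fz.
apply: (@le_trans _ _ (\sum_(0 <= t < T) (\sum_(f <- F) selberg_char f (c + t * k)) ^+ 2)).
  rewrite mulr_suml; apply: ler_sum => t _; case: allP => [H|_]; last first.
    by rewrite mul0r sqr_ge0.
  rewrite mul1r le_eqVlt; apply/orP; left; apply/eqP; congr (_ ^+ 2).
  apply: eq_big_seq => f fF; apply: eq_big_seq => l lf.
  have /andP[pl lz] := Fl _ _ fF lf.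
  rewrite /selberg_local ifN //.
  have := H l; rewrite mem_iota add1n ltnS lz pl prime_gt0 //=; exact.
under eq_bigr do rewrite expr2 mulr_suml.
under eq_bigr do under eq_bigr do rewrite mulr_sumr.
rewrite exchange_big /=; under eq_bigr do rewrite exchange_big /=.
apply: (@le_trans _ _ (\sum_(f <- F) \sum_(f' <- F)
   (T%:R * (if f == f' then selberg_weight f else 0) + f%:R * f'%:R))).
  rewrite big_seq [leRHS]big_seq; apply: ler_sum => f fF.
  rewrite big_seq [leRHS]big_seq; apply: ler_sum => f' fF'.
  have [? ? ?] := FP _ fF; have [? ? ?] := FP _ fF'.
  apply: selberg_char_corr => // l.
    by move=> /(Fl _ _ fF)/andP[pl lz]; exact: kz.
  by move=> /(Fl _ _ fF')/andP[pl lz]; exact: kz.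
under eq_bigr do rewrite big_split /=.
rewrite big_split /=; apply: lerD.
  rewrite /selberg_mass mulr_sumr big_seq [leRHS]big_seq; apply: ler_sum => f fF.
  rewrite (bigD1_seq f) //=; last by rewrite filter_uniq ?iota_uniq.
  rewrite eqxx big1 ?addr0 // => f' /negbTE; rewrite eq_sym => ->.
  by rewrite mulr0.
under eq_bigr do rewrite -mulr_sumr.
rewrite -mulr_suml -expr2 -natr_sum -!natrX ler_nat.
rewrite -[4%N]/(2 * 2)%N expnM leq_exp2r //.
apply: (@leq_trans (\sum_(f <- F) z)).
  by rewrite big_seq [X in (_ <= X)%N]big_seq; apply: leq_sum => f /FP[].
rewrite big_const_seq count_predT iter_addn addn0 -mulnn leq_mul2l.
by rewrite size_filter (leq_trans (count_size _ _)) ?size_iota ?orbT.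
Qed.

End SelbergSieve.

Lemma sqfree_decomposition n : (0 < n)%N ->
  exists f m, [/\ sqfree f, (0 < m)%N & n = (f * m ^ 2)%N].
Proof.
elim/ltn_ind: n => n IHn n0.
have [sn|nsn] := boolP (sqfree n); first by exists n, 1%N; rewrite muln1.
have [l pl ln2] : exists2 l, prime l & (l ^ 2 %| n)%N.
  have [/hasP[l ln lg]|/hasPn H] := boolP (has (fun l => 1 < logn l n)%N (primes n)).
    exists l; first by move: ln; rewrite mem_primes => /andP[].
    by rewrite pfactor_dvdn //; move: ln; rewrite mem_primes => /andP[].
  exfalso; move/negP: nsn; apply; rewrite /sqfree {1}[n]prod_prime_decomp //.
  rewrite prime_decompE big_map /=; apply/eqP; apply: eq_big_seq => l ln.
  have := H l ln; rewrite -leqNgt => l1.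
  by rewrite (_ : logn l n = 1)%N ?expn1 //; apply/eqP; rewrite eqn_leq l1 logn_gt0.
have l2 : (1 < l ^ 2)%N by rewrite -[X in (X < _)%N](exp1n 2) ltn_exp2r // prime_gt1.
case/dvdnP: ln2 => n' nE.
have n'0 : (0 < n')%N by move: n0; rewrite nE; case: (n').
have [|f [m [sf m0 E]]] := IHn n' _ n'0; first by rewrite nE ltn_Pmulr.
exists f, (m * l)%N; split=> //; first by rewrite muln_gt0 m0 prime_gt0.
by rewrite nE E expnMn mulnA.
Qed.

Section SieveBound.
Context {R : realType}.

Lemma ln_le_harmonic z : ln (z.+1%:R : R) <= \sum_(1 <= n < z.+1) n%:R^-1.
Proof.
elim: z => [|z IHz]; first by rewrite big_geq // ln1.
rewrite big_nat_recr //=.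
have -> : (z.+2%:R : R) = z.+1%:R * (1 + z.+1%:R^-1).
  by rewrite mulrDr mulr1 mulfV ?pnatr_eq0 // natr1.
have z0 : 0 < (z.+1%:R^-1 : R) by rewrite invr_gt0.
rewrite lnM ?posrE ?addr_gt0 // lerD //.
by apply: le_ln1Dx; apply: lt_trans z0; rewrite ltrN10.
Qed.

Lemma sum_inv_squares z : (\sum_(1 <= m < z.+1) (m%:R ^+ 2)^-1 : R) <= 2.
Proof.
case: z => [|z]; first by rewrite big_geq.
suff : (\sum_(1 <= m < z.+2) (m%:R ^+ 2)^-1 : R) <= 2 - z.+1%:R^-1.
  by move=> H; apply: le_trans H _; rewrite lerBlDr lerDl invr_ge0.
elim: z => [|z IHz]; first by rewrite big_nat1 expr1n invr1; lra.
rewrite big_nat_recr //=; apply: le_trans (lerD IHz (lexx _)) _.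
have : (0 : R) < z.+1%:R by [].
rewrite -[z.+2%:R]natr1; move: (z.+1%:R : R) => x x0.
rewrite -addrA lerD2l -subr_ge0.
have -> : - (x + 1)^-1 - (- x^-1 + ((x + 1) ^+ 2)^-1) = (x * (x + 1) ^+ 2)^-1.
  by field; lra.
by rewrite invr_ge0 mulr_ge0 ?sqr_ge0 // ltW.
Qed.

(** Each [n] is [f * m ^ 2] with [f] squarefree, and [1 / f] is at most the weight of [f]; so the
    harmonic sum is at most [selberg_mass z] times the sum of [1 / m ^ 2], which is at most 2. *)
Lemma selberg_mass_ge z : ln (z.+1%:R) <= 2 * selberg_mass (R := R) z.
Proof.
apply: le_trans (ln_le_harmonic z) _.
rewrite mulrC.
apply: le_trans (_ : selberg_mass z * \sum_(1 <= m < z.+1) (m%:R ^+ 2)^-1 <= _); last first.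
  rewrite ler_wpM2l ?sum_inv_squares // /selberg_mass ?sumr_ge0 // => f _.
  exact/ltW/selberg_weight_gt0.
rewrite /selberg_mass mulr_suml.
apply: (@le_trans _ _ (\sum_(1 <= n < z.+1) \sum_(f <- [seq f <- iota 1 z | sqfree f])
   \sum_(1 <= m < z.+1) (if n == (f * m ^ 2)%N then selberg_weight f * (m%:R ^+ 2)^-1 else 0))).
  apply: ler_sum_nat => n /andP[n0 nz].
  have [f [m [sf m0 E]]] := sqfree_decomposition n0.
  have f0 : (0 < f)%N by move: n0; rewrite E; case: (f).
  have fz : (f <= z)%N by rewrite -ltnS (leq_ltn_trans _ nz) // E leq_pmulr // expn_gt0 m0.
  have mz : (m < z.+1)%N.
    by rewrite (leq_ltn_trans _ nz) // E -mulnn mulnA leq_pmull // muln_gt0 f0.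
  have term0 f' m' : 0 <= (if n == (f' * m' ^ 2)%N
      then selberg_weight f' * (m'%:R ^+ 2)^-1 else 0 : R).
    case: ifP => // _; rewrite mulr_ge0 ?invr_ge0 ?sqr_ge0 //.
    exact/ltW/selberg_weight_gt0.
  rewrite (bigD1_seq f) /=; last first.
  - by rewrite filter_uniq // iota_uniq.
  - by rewrite mem_filter sf mem_iota f0 add1n ltnS fz.
  rewrite -[leLHS]addr0; apply: lerD; last first.
    by apply: sumr_ge0 => f' _; apply: sumr_ge0.
  rewrite (bigD1_seq m) /=; last first.
  - exact: iota_uniq.
  - by rewrite mem_index_iota m0.
  rewrite -[leLHS]addr0; apply: lerD; last by apply: sumr_ge0.
  rewrite -E eqxx E natrM natrX invfM ler_wpM2r ?invr_ge0 ?sqr_ge0 //.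
  rewrite (eqP sf) natr_prod -prodfV /selberg_weight -(eqP sf).
  rewrite big_seq [leRHS]big_seq; apply: ler_prod => l.
  rewrite mem_primes => /andP[/prime_gt1 + _]; rewrite -(ler_nat R) => l2.
  by rewrite invr_ge0 ler0n lef_pV2 ?posrE //; lra.
rewrite exchange_big /= big_seq [leRHS]big_seq; apply: ler_sum => f.
rewrite mem_filter mem_iota => /and3P[sf f0 _].
rewrite exchange_big /= mulr_sumr; apply: ler_sum_nat => m /andP[m0 mz].
have w0 : 0 <= selberg_weight f * (m%:R ^+ 2)^-1 :> R.
  rewrite mulr_ge0 ?invr_ge0 ?sqr_ge0 //; exact/ltW/selberg_weight_gt0.
have [fmz|fmz] := boolP ((f * m ^ 2)%N \in index_iota 1 z.+1).
  rewrite (bigD1_seq _ fmz) ?iota_uniq //= eqxx big1 ?addr0 //.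
  by move=> n /negbTE->.
rewrite big1_seq // => n /andP[_ nz]; case: eqP => // nE.
by rewrite -nE nz in fmz.
Qed.

Lemma selberg_mass_ge1 z : (0 < z)%N -> 1 <= selberg_mass (R := R) z.
Proof.
case: z => // z _; rewrite /selberg_mass /= {1}/sqfree /= big_nil eqxx big_cons.
rewrite {1}/selberg_weight /= big_nil lerDl sumr_ge0 // => f _.
exact/ltW/selberg_weight_gt0.
Qed.

(* Brun-Titchmarsh up to a constant, for moduli without small prime factors. *)
Lemma prime_progression_bound (s : seq nat) (k z T : nat) :
  uniq s -> all prime s -> (forall p, p \in s -> z < p <= k * T)%N ->
  (0 < k)%N -> (forall l, prime l -> (l <= z)%N -> coprime k l) ->
  (0 < z)%N -> (z ^ 4 <= T)%N ->
  (\sum_(p <- s) (k %| p.-1)%:R) * ln z.+1%:R <= 4 * T%:R :> R.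
Proof.
move=> us ps sz k0 kz z0 zT.
(* The prime [p] corresponds to [t = (p - 1) / k]; then [1 + t * k] is a prime above [z] and
   survives the sieve. *)
pose good t := all (fun l => prime l ==> ~~ (l %| 1 + t * k)%N) (iota 1 z).
have le_count : \sum_(p <- s) (k %| p.-1)%:R <= \sum_(0 <= t < T) (good t)%:R :> R.
  have cE (r : seq nat) (a : pred nat) : (\sum_(i <- r) a i = count a r)%N.
    by rewrite -sum1_count [RHS]big_mkcond; apply: eq_bigr => i _; case: (a i).
  rewrite -!natr_sum ler_nat !cE -!size_filter.
  rewrite -(size_map (fun p => p.-1 %/ k)%N); apply: uniq_leq_size.
    rewrite map_inj_in_uniq ?filter_uniq // => p q.
    rewrite !mem_filter => /andP[kp ps'] /andP[kq qs'] /(congr1 (muln^~ k)).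
    rewrite !divnK // => pq.
    by rewrite -(prednK (prime_gt0 (allP ps _ ps'))) pq prednK // prime_gt0 // (allP ps).
  move=> t /mapP[p]; rewrite mem_filter => /andP[kp ps'] ->.
  have pp := allP ps _ ps'; have /andP[zp pT] := sz _ ps'.
  rewrite mem_filter mem_index_iota /= ltn_divLR // [(T * k)%N]mulnC.
  rewrite (leq_trans _ pT) ?prednK ?prime_gt0 // andbT.
  apply/allP => l; rewrite mem_iota add1n ltnS => /andP[l0 lz].
  apply/implyP => pl; rewrite divnK // add1n prednK ?prime_gt0 //.
  by rewrite dvdn_prime2 //; apply/eqP => lp; move: zp; rewrite ltnNge -lp lz.
have H := selberg_sieve (R := R) 1 kz T.
have H1 := selberg_mass_ge1 z0.
have H2 := selberg_mass_ge z.
move: H H1 H2 le_count; set N := \sum_(0 <= t < T) _; set N' := \sum_(p <- s) _.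
set G := selberg_mass z; set L := ln _ => H H1 H2 le_count.
have zT' : z%:R ^+ 4 <= T%:R :> R by rewrite -natrX ler_nat.
have N'0 : 0 <= N' by apply: sumr_ge0.
(* [z ^ 4 <= T] and [1 <= G] put the sieve error below the main term; [ln z.+1 <= 2 * G] then gives
   the constant 4. *)
have NG : N * G <= 2 * T%:R.
  rewrite -(@ler_pM2r _ G); last lra.
  rewrite -mulrA -expr2; apply: le_trans H _.
  have : z%:R ^+ 4 * 1 <= T%:R * G by rewrite ler_pM // exprn_ge0.
  lra.
apply: (@le_trans _ _ (N' * (2 * G))); first by rewrite ler_wpM2l.
have : N' * G <= N * G by rewrite ler_wpM2r //; lra.
lra.
Qed.

End SieveBound.

(** * Shifted primes *)

Lemma count_dvd_le (s : seq nat) (Y K m : nat) :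
  uniq s -> all prime s -> (forall q, q \in s -> Y <= q)%N ->
  (0 < m < Y ^ K.+1)%N -> (count (fun q => q %| m) s <= K)%N.
Proof.
move=> us ps Ys /andP[m0 mY].
have Y0 : (0 < Y)%N by case: (posnP Y) mY => // ->; rewrite exp0n.
have H : (\prod_(q <- s | q %| m) q %| m)%N.
  elim: s us ps {Ys} => [|q s IHs] /=; first by rewrite big_nil dvd1n.
  move=> /andP[qs us] /andP[pq ps]; rewrite big_cons; case: ifP => qm; last exact: IHs.
  rewrite Gauss_dvd ?qm ?IHs //.
  elim: s {IHs us} qs ps => [|r s IHs] /=; first by rewrite big_nil coprimen1.
  rewrite in_cons negb_or => /andP[qr qs] /andP[pr ps].
  rewrite big_cons; case: ifP => _; last exact: IHs.
  by rewrite coprimeMr IHs // andbT prime_coprime // dvdn_prime2.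
rewrite leqNgt; apply/negP => cK.
have := dvdn_leq m0 H; apply/negP; rewrite -ltnNge; apply: leq_trans mY _.
apply: (@leq_trans (Y ^ count (fun q => q %| m) s)%N); first exact: leq_pexp2l.
rewrite -sum1_count.
elim: s Ys {us ps H cK} => [|q s IHs] Ys; first by rewrite !big_nil.
have IH := IHs (fun r rs => Ys r (mem_behead (s := q :: s) rs)).
rewrite !big_cons; case: ifP => _ //; rewrite add1n expnS leq_mul // Ys //.
by rewrite in_cons eqxx.
Qed.

Section ShiftedPrimes.
Context {R : realType}.
Implicit Types (s G L : seq nat).

Definition shift_count s (m : nat) : R := \sum_(p <- s) (m %| p.-1)%:R.

Definition inv_totient_sum G : R := \sum_(q <- G) (totient q)%:R^-1.

(** Bounds the multiplicity with which a modulus below [M] arises from elements of [s], so that sums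
    over pairs and triples can be compared with the sum over moduli in the estimate. *)
Definition few_divisors (M : nat) (K : R) s : Prop :=
  forall m, (0 < m < M)%N -> (count (fun q => q %| m)%N s)%:R <= K.

(** A modulus [m] equals [F q l l'] for at most [K ^ 3] triples, since all three entries divide it.
    A free [F] and the dummy list [[:: 1]] let one statement serve the moduli [q], [q * l] and
    [q * lcmn l l']. *)
Lemma sum_moduli_le (e : nat -> R) (M : nat) (K : R) G L L' (F : nat -> nat -> nat -> nat) :
  (forall m, 0 <= e m) ->
  (forall q l l', q \in G -> l \in L -> l' \in L' ->
     [&& 0 < F q l l' < M, q %| F q l l', l %| F q l l' & l' %| F q l l']%N) ->
  few_divisors M K G ->
  few_divisors M K L ->
  few_divisors M K L' ->
  \sum_(q <- G) \sum_(l <- L) \sum_(l' <- L') e (F q l l') <=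
  K ^+ 3 * \sum_(1 <= m < M) e m.
Proof.
move=> e0 FP KG KL KL'.
apply: (@le_trans _ _ (\sum_(q <- G) \sum_(l <- L) \sum_(l' <- L') \sum_(1 <= m < M)
   (q %| m)%:R * ((l %| m)%:R * ((l' %| m)%:R * e m)))).
  rewrite big_seq [leRHS]big_seq; apply: ler_sum => q qG.
  rewrite big_seq [leRHS]big_seq; apply: ler_sum => l lL.
  rewrite big_seq [leRHS]big_seq; apply: ler_sum => l' lL'.
  have /and4P[Fm qF lF lF'] := FP q l l' qG lL lL'.
  rewrite (bigD1_seq (F q l l')) ?iota_uniq ?mem_index_iota //=.
  rewrite qF lF lF' !mul1r lerDl; apply: sumr_ge0 => m _.
  by rewrite !mulr_ge0.
under eq_bigr do under eq_bigr do rewrite exchange_big /=.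
under eq_bigr do rewrite exchange_big /=.
rewrite exchange_big /= mulr_sumr; apply: ler_sum_nat => m /andP[m0 mM].
have cE (r : seq nat) : \sum_(q <- r) (q %| m)%:R = (count (fun q => q %| m)%N r)%:R :> R.
  by rewrite -sum1_count natr_sum [RHS]big_mkcond; apply: eq_bigr => i _; case: (_ %| _)%N.
under eq_bigr do under eq_bigr do rewrite -!mulr_sumr -mulr_suml cE.
under eq_bigr do rewrite -mulr_sumr -mulr_suml cE.
rewrite -mulr_suml cE !mulrA ler_wpM2r //.
have H : (0 < m < M)%N by rewrite m0.
by rewrite !exprS expr0 mulr1 mulrA !ler_pM ?mulr_ge0 ?KG ?KL ?KL'.
Qed.

Definition equidistributed s (W : R) (M : nat) (E : R) : Prop :=
  \sum_(1 <= m < M) `|shift_count s m - W / (totient m)%:R| <= E.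

Lemma few_divisors1 M (K : R) : 1 <= K -> few_divisors M K [:: 1%N].
Proof. by move=> K1 m _; rewrite /= dvd1n. Qed.

Lemma inv_totient_sum_ge0 G : 0 <= inv_totient_sum G.
Proof. by apply: sumr_ge0 => q _; rewrite invr_ge0. Qed.

Lemma lcmn_self l : (0 < l)%N -> lcmn l l = l.
Proof. by move=> l0; rewrite /lcmn gcdnn mulnK. Qed.

(** Off the diagonal [lcmn l l'] is the product and [totient] is multiplicative, which gives the
    square; the diagonal contributes the linear term, the source of the variance. *)
Lemma sum_inv_totient_lcm L q : uniq L -> all prime L ->
  (forall l, l \in L -> coprime q l) ->
  \sum_(l <- L) \sum_(l' <- L) (totient (q * lcmn l l'))%:R^-1 <=
  (totient q)%:R^-1 * (inv_totient_sum L ^+ 2 + inv_totient_sum L) :> R.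
Proof.
move=> uL pL qL; rewrite expr2 [in leRHS]/inv_totient_sum mulr_suml -big_split mulr_sumr /=.
rewrite big_seq [leRHS]big_seq; apply: ler_sum => l lL.
apply: (@le_trans _ _ (\sum_(l' <- L) (totient q)%:R^-1 *
   ((totient l)%:R^-1 * (totient l')%:R^-1 + (if l' == l then (totient l)%:R^-1 else 0)))).
  rewrite big_seq [leRHS]big_seq; apply: ler_sum => l' lL'.
  have [->|nll] := eqVneq.
    rewrite lcmn_self ?prime_gt0 ?(allP pL) // totient_coprime ?qL // natrM invfM ler_wpM2l ?invr_ge0 //.
    by rewrite lerDr mulr_ge0 ?invr_ge0.
  have cll : coprime l l'.
    by rewrite prime_coprime ?(allP pL) // dvdn_prime2 ?(allP pL) // eq_sym.
  have -> : lcmn l l' = (l * l')%N by rewrite /lcmn (eqP cll) divn1.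
  by rewrite !totient_coprime ?coprimeMr ?qL // !natrM !invfM addr0.
rewrite -mulr_sumr ler_wpM2l ?invr_ge0 // big_split /= -mulr_sumr lerD2l.
by rewrite (bigD1_seq l) //= eqxx big1 ?addr0 // => l' /negbTE ->.
Qed.

(* Turan's second-moment argument: the number of l in L dividing p - 1 has
   mean and variance about inv_totient_sum L. *)
Lemma shifted_turan s (W E K : R) M G L :
  0 <= W -> equidistributed s W M E -> 1 <= K ->
  uniq L -> all prime L -> (forall q, q \in G -> 0 < q)%N ->
  (forall q l, q \in G -> l \in L -> coprime q l) ->
  (forall q l l', q \in G -> l \in L -> l' \in L -> q * (l * l') < M)%N ->
  few_divisors M K G -> few_divisors M K L -> 1 <= inv_totient_sum L ->
  \sum_(q <- G) \sum_(p <- s)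
     (q %| p.-1)%:R * (~~ has (fun l => l %| p.-1)%N L)%:R <=
  W * inv_totient_sum G / inv_totient_sum L + 4 * K ^+ 3 * E.
Proof.
have [mu muE] : {mu | mu = inv_totient_sum L} by exists (inv_totient_sum L).
rewrite -muE; move=> W0 equi K1 uL pL G0 cGL GLM KG KL mu1.
pose d m : R := `|shift_count s m - W / (totient m)%:R|.
have d0 m : 0 <= d m by exact: normr_ge0.
have E0 : 0 <= E by apply: le_trans equi; apply: sumr_ge0.
have dle m : shift_count s m <= W / (totient m)%:R + d m.
  by rewrite -lerBlDl; exact: ler_norm.
have dge m : W / (totient m)%:R - d m <= shift_count s m.
  by rewrite lerBlDr -lerBlDl /d distrC; exact: ler_norm.
have lL0 l : l \in L -> (0 < l)%N by move=> /(allP pL)/prime_gt0.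
have mu20 : 0 < mu ^+ 2 by rewrite exprn_gt0 //; lra.
pose Z p : R := \sum_(l <- L) (l %| p.-1)%:R.
(* Expanding the square gives the main term [W / totient q] times
   [(mu ^ 2 + mu) - 2 * mu ^ 2 + mu ^ 2], that is, times [mu]; every modulus that occurs contributes
   its deviation [d]. *)
have step q : q \in G -> \sum_(p <- s) (q %| p.-1)%:R * (Z p - mu) ^+ 2 <=
    W * mu * (totient q)%:R^-1 + (\sum_(l <- L) \sum_(l' <- L) d (q * lcmn l l')%N
     + 2 * mu * (\sum_(l <- L) d (q * l)%N) + mu ^+ 2 * d q).
  move=> qG.
  have ->: \sum_(p <- s) (q %| p.-1)%:R * (Z p - mu) ^+ 2 =
     \sum_(l <- L) \sum_(l' <- L) shift_count s (q * lcmn l l')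
     - 2 * mu * (\sum_(l <- L) shift_count s (q * l)) + mu ^+ 2 * shift_count s q.
    rewrite /shift_count; under [X in X - _ + _]eq_bigr do rewrite exchange_big /=.
    rewrite exchange_big [X in _ - _ * X + _]exchange_big /= !mulr_sumr -sumrB -big_split /=.
    apply: eq_bigr => p _; rewrite /Z.
    have -> : \sum_(l <- L) \sum_(l' <- L) (q * lcmn l l' %| p.-1)%:R =
       (q %| p.-1)%:R * (Z p * Z p) :> R.
      rewrite /Z big_distrlr /= mulr_sumr big_seq [RHS]big_seq; apply: eq_bigr => l lL.
      rewrite mulr_sumr big_seq [RHS]big_seq; apply: eq_bigr => l' lL'.
      rewrite Gauss_dvd ?dvdn_lcm; last first.
        have [<-|nll] := eqVneq l l'; first by rewrite lcmn_self ?lL0 ?cGL.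
        rewrite /lcmn (_ : gcdn l l' = 1)%N ?divn1 ?coprimeMr ?cGL //.
        by apply/eqP; rewrite -/(coprime _ _) prime_coprime ?(allP pL) // dvdn_prime2 ?(allP pL).
      by case: (q %| _)%N; case: (l %| _)%N; case: (l' %| _)%N; rewrite ?mulr1 ?mulr0 ?mul1r.
    have -> : \sum_(l <- L) (q * l %| p.-1)%:R = (q %| p.-1)%:R * Z p :> R.
      rewrite /Z mulr_sumr big_seq [RHS]big_seq; apply: eq_bigr => l lL.
      rewrite Gauss_dvd ?cGL //.
      by case: (q %| _)%N; case: (l %| _)%N; rewrite ?mulr1 ?mulr0 ?mul1r.
    rewrite -/(Z p); ring.
  have H1 : \sum_(l <- L) \sum_(l' <- L) shift_count s (q * lcmn l l') <=
     W * ((totient q)%:R^-1 * (mu ^+ 2 + mu)) + \sum_(l <- L) \sum_(l' <- L) d (q * lcmn l l')%N.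
    apply: (@le_trans _ _ (\sum_(l <- L) \sum_(l' <- L)
        (W / (totient (q * lcmn l l'))%:R + d (q * lcmn l l')%N))).
      by apply: ler_sum => l _; apply: ler_sum.
    under eq_bigr do rewrite big_split /= -mulr_sumr.
    rewrite big_split /= -mulr_sumr lerD2r ler_wpM2l // muE.
    by apply: sum_inv_totient_lcm => // l lL; exact: cGL.
  have H2 : W * ((totient q)%:R^-1 * mu) - \sum_(l <- L) d (q * l)%N <=
      \sum_(l <- L) shift_count s (q * l).
    rewrite muE /inv_totient_sum !mulr_sumr -sumrB big_seq [leRHS]big_seq.
    apply: ler_sum => l lL; apply: le_trans (dge _); rewrite lerD2r.
    by rewrite totient_coprime ?cGL // natrM invfM.
  have H3 := dle q.
  have := ler_wpM2l (ltW mu20) H3.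
  have mu2 : 0 <= 2 * mu by lra.
  have := ler_wpM2l mu2 H2.
  move: H1; set a := \sum_(l <- L) \sum_(l' <- L) _; set a' := \sum_(l <- L) \sum_(l' <- L) _.
  set b := \sum_(l <- L) _; set b' := \sum_(l <- L) _.
  set u := (totient q)%:R^-1; lra.
(* Chebyshev's inequality: when no [l] divides [p - 1], [Z p] is 0 and the square equals
   [mu ^ 2]. *)
rewrite -(ler_pM2l mu20); apply: (@le_trans _ _
    (\sum_(q <- G) \sum_(p <- s) (q %| p.-1)%:R * (Z p - mu) ^+ 2)).
  rewrite mulr_sumr; apply: ler_sum => q _; rewrite mulr_sumr; apply: ler_sum => p _.
  rewrite mulrCA ler_wpM2l //; case: hasPn => [H|_]; last by rewrite mulr0 sqr_ge0.
  rewrite /Z big_seq big1 ?sub0r ?sqrrN ?mulr1 // => l lL.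
  by rewrite (negbTE (H l lL)).
rewrite big_seq; apply: le_trans (ler_sum _ step) _; rewrite -big_seq.
rewrite !big_split /= -!mulr_sumr -/(inv_totient_sum G).
have KL1 := few_divisors1 (M := M) K1.
have S1 : \sum_(q <- G) \sum_(l <- L) \sum_(l' <- L) d (q * lcmn l l')%N <= K ^+ 3 * E.
  apply: le_trans (_ : K ^+ 3 * \sum_(1 <= m < M) d m <= _); last first.
    by rewrite ler_wpM2l ?exprn_ge0 //; lra.
  apply: (sum_moduli_le (F := fun q l l' => (q * lcmn l l')%N)) => // q l l' qG lL lL'.
  rewrite muln_gt0 G0 // lcmn_gt0 !lL0 //= dvdn_mulr // dvdn_mull ?dvdn_lcml // dvdn_mull ?dvdn_lcmr // !andbT.
  by apply: leq_ltn_trans (GLM q l l' qG lL lL'); rewrite leq_mul2l dvdn_leq ?orbT ?muln_gt0 ?lL0 // dvdn_lcm dvdn_mulr ?dvdn_mull.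
have S2 : \sum_(q <- G) \sum_(l <- L) d (q * l)%N <= K ^+ 3 * E.
  apply: le_trans (_ : K ^+ 3 * \sum_(1 <= m < M) d m <= _); last first.
    by rewrite ler_wpM2l ?exprn_ge0 //; lra.
  have := @sum_moduli_le d M K G L [:: 1%N] (fun q l _ => (q * l)%N) d0.
  under eq_bigr do under eq_bigr do rewrite big_seq1.
  apply=> // q l l' qG lL; rewrite inE => /eqP->.
  rewrite muln_gt0 G0 ?lL0 //= dvdn_mulr // dvdn_mull // dvd1n !andbT.
  by apply: leq_ltn_trans (GLM q l l qG lL lL); rewrite leq_mul2l leq_pmulr ?lL0 ?orbT.
have [l0 l0L] : exists l, l \in L.
  case: (L) mu1 muE => [|l L']; last by exists l; rewrite mem_head.
  by rewrite /inv_totient_sum big_nil => + muE; rewrite muE ler10.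
have S3 : \sum_(q <- G) d q <= K ^+ 3 * E.
  apply: le_trans (_ : K ^+ 3 * \sum_(1 <= m < M) d m <= _); last first.
    by rewrite ler_wpM2l ?exprn_ge0 //; lra.
  have := @sum_moduli_le d M K G [:: 1%N] [:: 1%N] (fun q _ _ => q) d0.
  under eq_bigr do rewrite !big_seq1.
  apply=> // q l l' qG; rewrite !inE => /eqP-> /eqP->; rewrite dvdnn dvd1n G0 //= !andbT.
  by apply: leq_ltn_trans (GLM q l0 l0 qG l0L l0L); rewrite leq_pmulr // muln_gt0 !lL0.
(* The three deviation sums carry the coefficients 1, [2 * mu] and [mu ^ 2]; since [1 <= mu] they
   total at most [4 * mu ^ 2]. *)
have : 0 <= K ^+ 3 * E by rewrite mulr_ge0 ?exprn_ge0 //; lra.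
have -> : mu ^+ 2 * (W * inv_totient_sum G / mu + 4 * K ^+ 3 * E) =
  W * mu * inv_totient_sum G + 4 * mu ^+ 2 * (K ^+ 3 * E) by field; lra.
move: S1 S2 S3; move: (K ^+ 3 * E) => c S1 S2 S3 c0.
have mu2 : 0 <= 2 * mu by lra.
have S2' := ler_wpM2l mu2 S2; have S3' := ler_wpM2l (ltW mu20) S3.
have M1 : mu * c <= mu ^+ 2 * c by rewrite ler_wpM2r // ler_eXnr.
have M2 : c <= mu ^+ 2 * c by rewrite ler_peMl // exprn_ege1.
move: S1 S2' S3' M1 M2.
set a := \sum_(q <- G) _; set b := \sum_(q <- G) _; set e := \sum_(q <- G) _.
lra.
Qed.

End ShiftedPrimes.

Section ShiftedPrimeHits.
Context {R : realType}.
Implicit Types (s G L : seq nat).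

Lemma sum_shift_count_ge s (W E K : R) M G :
  equidistributed s W M E -> 1 <= K -> (forall q, q \in G -> 0 < q < M)%N ->
  few_divisors M K G ->
  W * inv_totient_sum G - K ^+ 3 * E <= \sum_(q <- G) shift_count s q.
Proof.
move=> equi K1 GM KG.
pose d m : R := `|shift_count s m - W / (totient m)%:R|.
have H : \sum_(q <- G) d q <= K ^+ 3 * E.
  apply: le_trans (_ : K ^+ 3 * \sum_(1 <= m < M) d m <= _); last first.
    by rewrite ler_wpM2l ?exprn_ge0 //; lra.
  have := @sum_moduli_le R d M K G [:: 1%N] [:: 1%N] (fun q _ _ => q) (fun m => normr_ge0 _).
  have KL1 := few_divisors1 (M := M) K1.
  under eq_bigr do rewrite !big_seq1.
  by apply=> // q l l' qG; rewrite !inE => /eqP-> /eqP->; rewrite dvdnn dvd1n GM.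
rewrite lerBlDr; apply: le_trans (lerD (lexx _) H); rewrite /inv_totient_sum mulr_sumr -big_split.
apply: ler_sum => q _ /=.
by rewrite -lerBlDl /d distrC; exact: ler_norm.
Qed.

(** [n ^ 2 - n] counts ordered pairs of distinct hits. The factor [t] acts as the probability of
    keeping a hit: it lowers the mean to any desired mass without selecting a subset. For [n >= 2]
    the left side is at most 1/2, because [(t * n - 1) ^ 2 >= 0]. *)
Lemma hit_ge_moments (n : nat) (t : R) : 0 <= t <= 1 ->
  t * n%:R - t ^+ 2 * (n%:R ^+ 2 - n%:R) <= (0 < n)%:R.
Proof.
move=> /andP[t0 t1]; case: n => [|[|n]]; first by rewrite expr0n /= subr0 !mulr0 subr0.
  by rewrite expr1n subrr mulr0 subr0 mulr1.
have : (2 : R) <= n.+2%:R by rewrite ler_nat.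
rewrite [(0 < _)%N]/=; move: (n.+2%:R : R) => x x2.
have : 0 <= (t * x - 1) ^+ 2 by exact: sqr_ge0.
have : t ^+ 2 * x * 2 <= t ^+ 2 * x * x by rewrite ler_wpM2l // mulr_ge0 ?sqr_ge0 //; lra.
rewrite /=; lra.
Qed.

(** Hits are counted only for [p] such that some [l] in [L] divides [p - 1]: the hypothesis on pairs
    then controls the second moment, while the first moment loses just the share
    [1 / inv_totient_sum L] found by Turan's method. The constant 5 is 1 from the first moment plus
    4 from that method. *)
Lemma shifted_hits s (W E K C m : R) M G L :
  0 <= W -> equidistributed s W M E -> 1 <= K -> 0 <= C ->
  uniq G -> uniq L -> all prime L -> (forall q, q \in G -> 0 < q < M)%N ->
  (forall q l, q \in G -> l \in L -> coprime q l) ->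
  (forall q l l', q \in G -> l \in L -> l' \in L -> q * (l * l') < M)%N ->
  few_divisors M K G -> few_divisors M K L -> 1 <= inv_totient_sum L :> R ->
  (forall q q', q \in G -> q' \in G -> q != q' ->
     \sum_(p <- s) (has (fun l => l %| p.-1)%N L && (q %| p.-1)%N && (q' %| p.-1)%N)%:R
     <= C * W / ((totient q)%:R * (totient q')%:R)) ->
  0 <= m <= inv_totient_sum G ->
  W * (m * (1 - (inv_totient_sum (R := R) L)^-1) - C * m ^+ 2) - 5 * K ^+ 3 * E <=
  \sum_(p <- s) (has (fun q => q %| p.-1)%N G)%:R :> R.
Proof.
move=> W0 equi K1 C0 uG uL pL GM cGL GLM KG KL mu1 pairs /andP[m0 mG].
have E0 : 0 <= E by apply: le_trans equi; apply: sumr_ge0.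
have turan := shifted_turan W0 equi K1 uL pL
  (fun q qG => proj1 (andP (GM q qG))) cGL GLM KG KL mu1.
have first := sum_shift_count_ge equi K1 GM KG.
pose X p := (has (fun l => l %| p.-1)%N L * \sum_(q <- G) (q %| p.-1))%N.
have X1 : \sum_(p <- s) (X p)%:R = \sum_(q <- G) shift_count s q -
   \sum_(q <- G) \sum_(p <- s)
     (q %| p.-1)%:R * (~~ has (fun l => l %| p.-1)%N L)%:R :> R.
  rewrite /shift_count -sumrB; under [RHS]eq_bigr do rewrite -sumrB.
  rewrite exchange_big /=; apply: eq_bigr => p _.
  rewrite natrM natr_sum mulr_sumr; apply: eq_bigr => q _.
  by case: (has _ _); case: (_ %| _)%N; rewrite /= ?mulr1 ?mulr0 ?subr0 ?subrr.
have X2 : \sum_(p <- s) ((X p)%:R ^+ 2 - (X p)%:R) <=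
    C * W * inv_totient_sum G ^+ 2 :> R.
  have -> : \sum_(p <- s) ((X p)%:R ^+ 2 - (X p)%:R) = \sum_(q <- G) \sum_(q' <- G | q' != q)
     \sum_(p <- s) (has (fun l => l %| p.-1)%N L && (q %| p.-1)%N && (q' %| p.-1)%N)%:R :> R.
    under [RHS]eq_bigr do rewrite exchange_big /=.
    rewrite exchange_big /=; apply: eq_bigr => p _.
    rewrite /X natrM natr_sum; case: (has _ _); last first.
      by rewrite mul0r expr0n subr0 big1 // => q _; rewrite big1.
    rewrite mul1r expr2 mulr_suml -sumrB big_seq [RHS]big_seq; apply: eq_bigr => q qG.
    rewrite mulr_sumr (bigD1_seq q) //= -natrM mulnb andbb addrC addrK.
    by apply: eq_bigr => q' _; rewrite -natrM mulnb.
  rewrite expr2 {1}/inv_totient_sum mulr_suml mulr_sumr big_seq [leRHS]big_seq.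
  apply: ler_sum => q qG.
  rewrite mulrA /inv_totient_sum mulr_sumr [leRHS](bigD1_seq q) //=.
  rewrite -[leLHS]add0r; apply: lerD; first by rewrite !mulr_ge0 ?invr_ge0.
  rewrite big_seq_cond [leRHS]big_seq_cond; apply: ler_sum => q' /andP[qG' qq].
  by rewrite -mulrA -invfM; apply: pairs; rewrite // eq_sym.
have [mG0|mG0] := eqVneq (inv_totient_sum (R := R) G) 0.
  have -> : m = 0 by apply/eqP; rewrite eq_le m0 andbT -mG0.
  rewrite mul0r expr0n /= mulr0 subr0 mulr0 sub0r.
  apply: (@le_trans _ _ 0); last by apply: sumr_ge0.
  by rewrite oppr_le0 !mulr_ge0 ?exprn_ge0 //; lra.
set g := inv_totient_sum G in mG mG0 turan first X2 *.
have g0 : 0 < g by rewrite lt0r mG0 inv_totient_sum_ge0.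
(* The thinning factor brings the mass [g] of [G] down to [m], so that the quadratic loss is
   [C * m ^ 2] however large [g] is. *)
pose t := m / g.
have t01 : 0 <= t <= 1 by rewrite divr_ge0 ?ler_pdivrMr ?mul1r // ltW.
have tg : t * g = m by rewrite /t divfK.
have H : t * (\sum_(p <- s) (X p)%:R) - t ^+ 2 * (\sum_(p <- s) ((X p)%:R ^+ 2 - (X p)%:R))
   <= \sum_(p <- s) (has (fun q => q %| p.-1)%N G)%:R.
  rewrite !mulr_sumr -sumrB; apply: ler_sum => p _.
  apply: le_trans (hit_ge_moments (X p) t01) _; rewrite ler_nat.
  rewrite /X; case: (has _ L); last by rewrite mul0n.
  rewrite mul1n; case: (boolP (has _ G)) => [_|/hasPn H]; first exact: leq_b1.
  rewrite big_seq big1 // => q qG.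
  by rewrite (negbTE (H q qG)).
apply: le_trans _ H.
have tX2 := ler_wpM2l (sqr_ge0 t) X2.
have tX1 : t * (W * g * (1 - (inv_totient_sum L)^-1) - 5 * (K ^+ 3 * E)) <=
   t * (\sum_(p <- s) (X p)%:R).
  rewrite ler_wpM2l ?(andP t01).1 // X1.
  move: turan first; set a := \sum_(q <- G) _; set b := \sum_(q <- G) _; lra.
have KE : t * (5 * (K ^+ 3 * E)) <= 5 * (K ^+ 3 * E).
  rewrite ler_piMl ?(andP t01).2 // !mulr_ge0 ?exprn_ge0 //; lra.
move: tX1 tX2 KE; rewrite -tg.
set a := \sum_(p <- s) _; set b := \sum_(p <- s) _; lra.
Qed.

End ShiftedPrimeHits.

(** * Geometric blocks of primes *)

Section Equidistribution.
Context {R : realType}.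
Implicit Types (x y theta : R).

Lemma ln2_gt0 : 0 < ln (2 : R).
Proof. by rewrite ln_gt0 // ltr1n. Qed.

Lemma integrable_invln x y : 1 < x ->
  lebesgue_measure.-integrable `[x, y] (EFin \o (fun t : R => (ln t)^-1)).
Proof.
move=> x1; apply: continuous_compact_integrable; first exact: segment_compact.
apply: continuous_in_subspaceT => t; rewrite inE /= in_itv /= => /andP[xt _].
have t1 : 1 < t by apply: lt_le_trans xt.
apply: cvgV; first by rewrite gt_eqF // ln_gt0.
by apply: continuous_ln; apply: lt_trans t1.
Qed.

Lemma li_diff_bounds x y : 2 <= x -> x <= y ->
  (y - x) / ln y <= li y - li x <= (y - x) / ln x.
Proof.
move=> x2 xy; have x1 : 1 < x by apply: lt_le_trans x2; rewrite ltr1n.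
rewrite /li Rintegral_itvB ?bnd_simp //; last first.
  by apply: integrable_invln; rewrite ltr1n.
have intf : lebesgue_measure.-integrable `]x, y] (EFin \o (fun t : R => (ln t)^-1)).
  apply: integrableS (integrable_invln y x1) => //.
  by move=> t /=; rewrite !in_itv /= => /andP[/ltW-> ->].
have intc (c : R) : lebesgue_measure.-integrable `]x, y] (EFin \o (fun _ : R => c)).
  apply: integrableS (_ : lebesgue_measure.-integrable `[x, y] _) => //.
    by move=> t /=; rewrite !in_itv /= => /andP[/ltW-> ->].
  apply: continuous_compact_integrable; first exact: segment_compact.
  by apply: continuous_in_subspaceT => t _; apply: cvg_cst.
have cstE (c : R) : \int[lebesgue_measure]_(_ in `]x, y]) c = (y - x) * c.
  rewrite Rintegral_cst // mulrC; congr (_ * _).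
  apply: etrans (congr1 fine (lebesgue_measure_itv `]x, y])) _ => /=.
  rewrite lte_fin.
  case: ltP => [_|yx]; first by [].
  by apply/esym/eqP; rewrite subr_eq0 eq_le xy yx.
rewrite -!cstE; apply/andP; split; apply: le_Rintegral => // t /=;
  rewrite in_itv /= => /andP[xt ty].
- rewrite lef_pV2 ?posrE ?ln_gt0 //; try lra.
  by rewrite ler_ln ?posrE; lra.
- rewrite lef_pV2 ?posrE ?ln_gt0 //; try lra.
  by rewrite ler_ln ?posrE; lra.
Qed.

Lemma li_ge0 x : 0 <= li x.
Proof.
apply: Rintegral_ge0 => t /=; rewrite in_itv /= => /andP[t2 _].
by rewrite invr_ge0 ln_ge0 //; apply: le_trans t2; rewrite ler1n.
Qed.

Lemma li_mono x y : 2 <= x -> x <= y -> li x <= li y.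
Proof.
move=> x2 xy; rewrite -subr_ge0; have /andP[H _] := li_diff_bounds x2 xy.
apply: le_trans H; rewrite divr_ge0 ?subr_ge0 // ln_ge0 //; lra.
Qed.

Lemma prime_count_le (P : pred nat) x : 0 <= x -> (prime_count P x)%:R <= x + 1.
Proof.
move=> x0; rewrite /prime_count sum1_count.
apply: (@le_trans _ _ (Num.truncn x).+1%:R).
  by rewrite ler_nat (leq_trans (count_size _ _)) // size_iota subn0.
by rewrite -natr1 lerD2r truncn_le.
Qed.

Lemma le_max_discrepancy m x y : (0 < m)%N -> 2 <= y -> y <= x ->
  `|(primepi_mod y m 1)%:R - li y / (totient m)%:R| <= max_discrepancy m x.
Proof.
move=> m0 y2 yx; apply: ub_le_sup; last by exists y => //=; rewrite in_itv /= y2.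
(* [sup] dominates its members only when the set is bounded above; the trivial bounds for both
   counting functions supply this. *)
exists (x + 1 + li x) => r [z]; rewrite /= in_itv /= => /andP[z2 zx] <-.
apply: le_trans (ler_normB _ _) _; apply: lerD.
  rewrite ger0_norm //; apply: le_trans (prime_count_le _ _) _; lra.
have tm : 1 <= (totient m)%:R :> R by rewrite ler1n totient_gt0.
rewrite ger0_norm ?divr_ge0 ?li_ge0 // ler_pdivrMr; last lra.
apply: le_trans (li_mono z2 zx) _; rewrite ler_peMr ?li_ge0 //.
Qed.

Definition primes_between x y : seq nat :=
  [seq p <- index_iota 0 (Num.truncn y).+1 | prime p && (x < p%:R)].

Lemma primes_betweenP x y p : 0 <= y ->
  reflect [/\ prime p, x < p%:R & p%:R <= y] (p \in primes_between x y).
Proof.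
move=> y0; rewrite mem_filter mem_index_iota /= ltnS truncn_ge_nat // -andbA.
exact: and3P.
Qed.

Lemma primes_between_uniq x y : uniq (primes_between x y).
Proof. by rewrite filter_uniq // iota_uniq. Qed.

Lemma primes_between_sum x y (F : nat -> R) : 0 <= x -> x <= y ->
  \sum_(p <- primes_between x y) F p =
  \sum_(0 <= p < (Num.truncn y).+1 | prime p) F p -
  \sum_(0 <= p < (Num.truncn x).+1 | prime p) F p.
Proof.
move=> x0 xy; rewrite /primes_between big_filter.
have txy : ((Num.truncn x).+1 <= (Num.truncn y).+1)%N by rewrite ltnS le_truncn.
rewrite (big_nat_widen _ _ _ _ _ txy) /=.
apply/esym/eqP; rewrite subr_eq; apply/eqP.
rewrite (bigID (fun p => x < p%:R)) /=; congr (_ + _); apply: eq_bigl => p.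
by rewrite ltnS truncn_ge_nat // -leNgt.
Qed.

Lemma shift_count_between m x y : (0 < m)%N -> 2 <= x -> x <= y ->
  `|shift_count (primes_between x y) m - (li y - li x) / (totient m)%:R| <=
  2 * max_discrepancy m y.
Proof.
move=> m0 x2 xy; have x0 : 0 <= x by lra.
have piE z : (primepi_mod z m 1)%:R =
    \sum_(0 <= p < (Num.truncn z).+1 | prime p) (m %| p.-1)%:R :> R.
  rewrite /primepi_mod /prime_count natr_sum big_mkcondr /=; apply: eq_bigr => p pp.
  by rewrite eqn_mod_dvd ?prime_gt0 // subn1; case: (_ %| _)%N.
rewrite /shift_count primes_between_sum // -!piE.
have H1 := le_max_discrepancy m0 x2 xy.
have H2 := le_max_discrepancy m0 (le_trans x2 xy) (lexx y).
have -> : (primepi_mod y m 1)%:R - (primepi_mod x m 1)%:R - (li y - li x) / (totient m)%:R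
  = ((primepi_mod y m 1)%:R - li y / (totient m)%:R) -
    ((primepi_mod x m 1)%:R - li x / (totient m)%:R) :> R by rewrite mulrBl; ring.
by apply: le_trans (ler_normB _ _) _; lra.
Qed.

Lemma primes_between_equidistributed theta x y : 2 <= x -> x <= y ->
  equidistributed (primes_between x y) (li y - li x)
    (Num.truncn (y `^ theta)).+1 (2 * discrepancy_sum (fun t => t `^ theta) y).
Proof.
move=> x2 xy; rewrite /equidistributed /discrepancy_sum mulr_sumr.
by apply: ler_sum_nat => m /andP[m0 _]; apply: shift_count_between.
Qed.

End Equidistribution.

Lemma maxchain_step q p : prime q -> prime p -> (q %| p.-1)%N ->
  (maxchain q < maxchain p)%N.
Proof.
move=> pq pp qp; have [s sq <-] := maxchain_attained pq.
have /and4P[s0 /eqP sl sp ss] := sq.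
rewrite -(size_rcons s p); apply: leq_maxchain.
rewrite /prime_chain last_rcons eqxx -size_eq0 size_rcons /= all_rcons pp sp /=.
case: s s0 {sq} sl sp ss => // x s _ /= sl sp ss.
by rewrite rcons_path ss /= sl /prec eqn_mod_dvd ?prime_gt0 // subn1.
Qed.

Lemma maxchain_gt0 p : prime p -> (0 < maxchain p)%N.
Proof. by move=> pp; apply: (@leq_maxchain [:: p]); rewrite /prime_chain /= eqxx pp. Qed.

Section Blocks.
Context {R : realType}.
Variables (b theta : R).
Hypotheses (b1 : 1 < b) (theta1 : theta <= 1).

Definition block (i : nat) : seq nat := primes_between (b ^+ i) (b ^+ i.+1).

Definition block_mass (i : nat) : R := li (b ^+ i.+1) - li (b ^+ i).

(** The deviation of block [i], summed over all moduli in the range of the estimate, relative to the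
    expected number of primes; the 2 is for the two endpoints. *)
Definition block_error (i : nat) : R :=
  2 * discrepancy_sum (fun t => t `^ theta) (b ^+ i.+1) / block_mass i.

(** Relative to the expected count [block_mass], the quantity that enters the estimate, rather than
    to the true number of primes. *)
Definition density (P : pred nat) (i : nat) : R :=
  (\sum_(p <- block i) (P p)%:R) / block_mass i.

Definition window (P : pred nat) (j n : nat) : seq nat :=
  flatten [seq [seq p <- block i | P p] | i <- iota j n].

Let b0 : 0 < b. Proof. by apply: lt_trans b1. Qed.

Let lnb0 : 0 < ln b. Proof. exact: ln_gt0. Qed.

Let bX0 i : 0 < b ^+ i. Proof. exact: exprn_gt0. Qed.

Let bX1 i : 1 <= b ^+ i. Proof. by rewrite exprn_ege1 // ltW. Qed.

Let bXle i j : (i <= j)%N -> b ^+ i <= b ^+ j.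
Proof. by move=> ij; rewrite ler_weXn2l // ltW. Qed.

Lemma blockP i p : reflect [/\ prime p, b ^+ i < p%:R & p%:R <= b ^+ i.+1] (p \in block i).
Proof. exact/primes_betweenP/ltW/bX0. Qed.

Lemma block_uniq i : uniq (block i).
Proof. exact: primes_between_uniq. Qed.

(** The factor [(b - 1) / ln b] is at least 1 and is dropped, so the bound carries no constant
    depending on [b]. *)
Lemma block_mass_ge i : 2 <= b ^+ i -> b ^+ i / i.+1%:R <= block_mass i.
Proof.
move=> bi; have /andP[H _] := li_diff_bounds bi (bXle (leqnSn i)).
apply: le_trans H; rewrite lnXn // exprS -[X in _ - X]mul1r -mulrBl.
have lb : ln b <= b - 1.
  by have := @le_ln1Dx R (b - 1); rewrite [1 + _]addrC subrK; apply; rewrite ltrBrDr addNr; exact: b0.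
have -> : (b - 1) * b ^+ i / (ln b *+ i.+1) = b ^+ i / i.+1%:R * ((b - 1) / ln b).
  by rewrite -[ln b *+ _]mulr_natl invfM; ring.
by rewrite ler_peMr ?divr_ge0 ?(ltW (bX0 _)) // ler_pdivlMr // mul1r.
Qed.

Lemma block_mass_gt0 i : 2 <= b ^+ i -> 0 < block_mass i.
Proof. by move=> bi; apply: lt_le_trans (block_mass_ge bi); rewrite divr_gt0. Qed.

Lemma density_ge0 P i : 2 <= b ^+ i -> 0 <= density P i.
Proof.
by move=> bi; rewrite divr_ge0 ?sumr_ge0 // ltW // block_mass_gt0.
Qed.

Lemma block_equidistributed i : 2 <= b ^+ i ->
  equidistributed (block i) (block_mass i)
    (Num.truncn ((b ^+ i.+1) `^ theta)).+1 (block_error i * block_mass i).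
Proof.
move=> bi; rewrite /block_error divfK ?gt_eqF ?block_mass_gt0 //.
exact: primes_between_equidistributed bi (bXle (leqnSn i)).
Qed.

Lemma lt_modulus i k (m : nat) : k%:R <= theta * i.+1%:R -> m%:R <= b ^+ k ->
  (m < (Num.truncn ((b ^+ i.+1) `^ theta)).+1)%N.
Proof.
move=> ki mk; rewrite ltnS truncn_ge_nat ?powR_ge0 //.
apply: le_trans mk _; rewrite -!powR_mulrn ?(ltW b0) // -powRrM mulrC.
by rewrite ler_powR // (ltW b1).
Qed.

Lemma modulus_le i m : (0 < m < (Num.truncn ((b ^+ i.+1) `^ theta)).+1)%N ->
  m%:R <= b ^+ i.+1.
Proof.
rewrite ltnS => /andP[_]; rewrite truncn_ge_nat ?powR_ge0 // => /le_trans; apply.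
by rewrite -[leRHS]powRr1 ?(ltW (bX0 _)) // ler_powR.
Qed.

Lemma windowP P j n q : q \in window P j n ->
  [/\ prime q, P q, b ^+ j < q%:R & q%:R <= b ^+ (j + n)].
Proof.
move=> /flattenP[_ /mapP[i + ->]]; rewrite mem_iota => /andP[ji ijn].
rewrite mem_filter => /andP[Pq /blockP[pq bq qb]]; split=> //.
  exact: le_lt_trans (bXle ji) bq.
exact: le_trans qb (bXle ijn).
Qed.

Lemma window_prime P j n : all prime (window P j n).
Proof. by apply/allP => q /windowP[]. Qed.

Lemma window_uniq P j n : uniq (window P j n).
Proof.
elim: n j => // n IHn j; rewrite /window /= cat_uniq filter_uniq ?block_uniq //.
rewrite -/(window P j.+1 n) IHn andbT; apply/hasPn => q /windowP[_ _ qj _].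
by apply/negP; rewrite mem_filter => /andP[_ /blockP[_ _]]; rewrite leNgt qj.
Qed.

(** A prime [q] of block [i] has [1 / totient q >= 1 / b ^ (i + 1)], and the block holds at least
    [density] times [b ^ i / (i + 1)] of them. The factor [b] is the price of replacing [q] by the
    right end of its block. *)
Lemma inv_totient_window P j n : 2 <= b ^+ j ->
  \sum_(j <= i < j + n) density P i / (b * i.+1%:R) <= inv_totient_sum (window P j n).
Proof.
move=> bj; rewrite /inv_totient_sum big_flatten big_map /index_iota addKn.
rewrite big_seq [leRHS]big_seq; apply: ler_sum => i; rewrite mem_iota => /andP[ji _].
have bi : 2 <= b ^+ i by apply: le_trans bj (bXle ji).
apply: (@le_trans _ _ ((\sum_(p <- block i) (P p)%:R) * (b ^+ i.+1)^-1)).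
  rewrite /density -mulrA ler_wpM2l ?sumr_ge0 // -invfM lef_pV2 ?posrE //; last first.
    by rewrite !mulr_gt0 ?block_mass_gt0.
  by have := block_mass_ge bi; rewrite ler_pdivrMr // => H; rewrite mulrCA exprS ler_pM2l.
rewrite mulr_suml big_filter [leRHS]big_mkcond big_seq [leRHS]big_seq.
apply: ler_sum => p /blockP[pp _ pb]; case: (P p); last by rewrite mul0r.
have p1 := prime_gt1 pp.
rewrite mul1r lef_pV2 ?posrE ?ltr0n ?totient_gt0 ?(ltnW p1) //.
by apply: le_trans pb; rewrite ler_nat totient_prime // leq_pred.
Qed.

Lemma window_count_dvd P i j n K m : (i < K.+1 * j)%N -> (0 < m)%N ->
  m%:R <= b ^+ i.+1 -> (count (fun q => q %| m) (window P j n) <= K)%N.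
Proof.
move=> iKj m0 mb.
(* The next integer above [b ^ j] still bounds the primes of the window from below; being strictly
   larger, it turns [m <= b ^ (i + 1)] into the strict inequality wanted. *)
apply: (@count_dvd_le _ (Num.truncn (b ^+ j)).+1); rewrite ?window_uniq ?window_prime //.
  by move=> q /windowP[_ _ qj _]; rewrite -(ltr_nat R) (le_lt_trans _ qj) // truncn_le ltW.
rewrite m0 -(ltr_nat R) natrX; apply: le_lt_trans mb _.
apply: (@le_lt_trans _ _ ((b ^+ j) ^+ K.+1)); first by rewrite -exprM bXle // mulnC.
by rewrite ltrXn2r // ?truncnS_gt // ltW.
Qed.

Lemma window_few_divisors P i j n K : (i < K.+1 * j)%N ->
  few_divisors (Num.truncn ((b ^+ i.+1) `^ theta)).+1 (K%:R : R) (window P j n).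
Proof.
move=> iKj m mM; rewrite ler_nat; apply: (window_count_dvd _ _ iKj) (modulus_le mM).
by case/andP: mM.
Qed.

Definition chain_ge (h : nat) : pred nat := fun p => (h <= maxchain p)%N.

Lemma chain_ge_step h p j n : prime p ->
  has (fun q => q %| p.-1)%N (window (chain_ge h) j n) -> chain_ge h.+1 p.
Proof.
by move=> pp /hasP[q /windowP[pq hq _ _] qp]; apply: leq_ltn_trans hq (maxchain_step pq pp qp).
Qed.

(** A prime of block [i] is hit by at most [K] primes of the window, so pairs are counted and
    divided by [K]. This constant loss confines the lemma to part (b). *)
Lemma density_first_moment h i j n K : 2 <= b ^+ i -> (0 < K)%N ->
  (i < K.+1 * j)%N -> (j + n)%:R <= theta * i.+1%:R ->
  inv_totient_sum (window (chain_ge h) j n) / K%:R - K%:R ^+ 2 * block_error i <=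
  density (chain_ge h.+1) i.
Proof.
move=> bi K0 iKj jni; set G := window _ j n.
have W0 := block_mass_gt0 bi.
have K1 : 1 <= K%:R :> R by rewrite ler1n.
have := sum_shift_count_ge (block_equidistributed bi) K1 _ (window_few_divisors _ _ iKj).
move=> /(_ (chain_ge h) n) H.
have {}H : block_mass i * inv_totient_sum G - K%:R ^+ 3 * (block_error i * block_mass i)
   <= K%:R * (\sum_(p <- block i) (chain_ge h.+1 p)%:R).
  apply: le_trans (H _) _.
    move=> q /windowP[pq _ _ qb]; rewrite prime_gt0 //.
    exact: lt_modulus jni qb.
  rewrite /shift_count exchange_big /= mulr_sumr big_seq [leRHS]big_seq.
  apply: ler_sum => p /blockP[pp bp pb].
  rewrite -natr_sum -natrM ler_nat.
  have [hp|hp] := boolP (has (fun q => q %| p.-1)%N G).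
    rewrite (chain_ge_step pp hp) muln1.
    have -> : (\sum_(q <- G) (q %| p.-1) = count (fun q => q %| p.-1) G)%N.
      by rewrite -sum1_count [RHS]big_mkcond; apply: eq_bigr => q _; case: (_ %| _)%N.
    apply: (window_count_dvd _ _ iKj); first by rewrite -ltnS prednK ?prime_gt1 ?prime_gt0.
    by apply: le_trans pb; rewrite ler_nat leq_pred.
  rewrite big_seq big1 // => q qG; move/hasPn: hp => /(_ q qG) /negbTE -> //.
rewrite /density ler_pdivlMr // -(@ler_pM2l _ K%:R); last by rewrite ltr0n.
apply: le_trans H; rewrite le_eqVlt; apply/orP; left; apply/eqP.
by field; rewrite pnatr_eq0 -lt0n.
Qed.

(** Turan's method with the single modulus 1 for [G], applied to primes [q] that already end long
    chains: once their mass is large, almost no prime of the block avoids them all. The 2 in the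
    range condition makes room for a product of two such [q]. *)
Lemma density_turan h i j n K : 2 <= b ^+ i -> (0 < K)%N ->
  (i < K.+1 * j)%N -> (2 * (j + n))%:R <= theta * i.+1%:R ->
  1 <= inv_totient_sum (window (chain_ge h) j n) :> R ->
  \sum_(p <- block i) (~~ chain_ge h.+1 p)%:R <=
  block_mass i * ((inv_totient_sum (window (chain_ge h) j n))^-1
                  + 4 * K%:R ^+ 3 * block_error i).
Proof.
move=> bi K0 iKj jni; set L := window _ j n => mu1.
have W0 := block_mass_gt0 bi.
have K1 : 1 <= K%:R :> R by rewrite ler1n.
have := @shifted_turan R (block i) _ _ _ _ [:: 1%N] L (ltW W0) (block_equidistributed bi) K1.
move=> /(_ (window_uniq _ _ _) (window_prime _ _ _)) H.
have {H} := H _ _ _ (few_divisors1 K1) (window_few_divisors _ _ iKj) mu1.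
rewrite big_seq1 /inv_totient_sum big_seq1 (_ : totient 1 = 1%N) // invr1 mulr1.
rewrite -/(inv_totient_sum L) => H.
apply: le_trans (_ : _ <= block_mass i / inv_totient_sum L +
   4 * K%:R ^+ 3 * (block_error i * block_mass i)) _; last by rewrite le_eqVlt; apply/orP; left; apply/eqP; ring.
apply: le_trans (H _ _ _).
- rewrite big_seq [leRHS]big_seq; apply: ler_sum => p /blockP[pp _ _].
  rewrite dvd1n mul1r ler_nat; case: (boolP (has _ _)) => hp; last exact: leq_b1.
  by rewrite (chain_ge_step pp hp).
- by move=> q; rewrite inE => /eqP ->.
- by move=> q l; rewrite inE => /eqP -> _; exact: coprime1n.
- move=> q l l'; rewrite inE => /eqP -> /windowP[_ _ _ lb] /windowP[_ _ _ lb'].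
  rewrite mul1n; apply: lt_modulus jni _.
  by rewrite natrM mul2n -addnn exprD ler_pM.
Qed.

(** An auxiliary [l] dividing [p - 1] besides [q] and [q'] forces [q * q' < b ^ (i + 1) / b ^ j'],
    so [p = 1 + q * q' * t] leaves [t] a range longer than [b ^ j']. The sieve by primes up to
    [b ^ s], where [4 * s <= j'], then saves the factor [s * ln b], a fixed part of [ln p]. *)
Lemma window_pair_bound P Q i j n j' n' s q q' (e : R) :
  2 <= b ^+ i -> (0 < s)%N -> (s <= j)%N -> (4 * s <= j')%N -> (s <= i)%N ->
  0 < e -> e * i.+1%:R <= s%:R ->
  q \in window P j n -> q' \in window P j n -> q != q' ->
  (forall l, l \in window Q j' n' -> l != q /\ l != q') ->
  \sum_(p <- block i) (has (fun l => l %| p.-1)%N (window Q j' n') &&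
     (q %| p.-1)%N && (q' %| p.-1)%N)%:R <=
  8 * b / (e * ln b) * block_mass i / ((totient q)%:R * (totient q')%:R).
Proof.
move=> bi s0 sj sj' si e0 es qG qG' qq Lq.
have [pq _ bq _] := windowP qG; have [pq' _ bq' _] := windowP qG'.
have W0 := block_mass_gt0 bi.
have C0 : 0 <= 8 * b / (e * ln b) by rewrite divr_ge0 ?mulr_ge0 ?ltW.
(* If no prime of the block is counted there is nothing to prove; otherwise one such [p0] bounds
   [q * q'] for the whole sum. *)
have [/eqP noL|] := boolP (has (fun p => has (fun l => l %| p.-1)%N (window Q j' n') &&
     (q %| p.-1)%N && (q' %| p.-1)%N) (block i) == false).
  rewrite big_seq big1; last first.
    move=> p pB; case: (boolP (_ && _)) => // H.
    by move/hasPn: noL => /(_ p pB); rewrite H.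
  by apply: divr_ge0; [apply: mulr_ge0 => //; exact: ltW|exact: mulr_ge0].
rewrite eqbF_neg negbK => /hasP[p0 /blockP[pp0 bp0 p0b] /andP[/andP[/hasP[l lL lp] qp] qp']].
have [pl _ bl _] := windowP lL.
have [lq lq'] := Lq _ lL.
set k := (q * q')%N.
have k0 : (0 < k)%N by rewrite muln_gt0 !prime_gt0.
have kl : b ^+ j' < b ^+ i.+1 / k%:R.
  rewrite ltr_pdivlMr ?ltr0n //; apply: lt_le_trans (_ : l%:R * k%:R <= _).
    by rewrite ltr_pM2r ?ltr0n.
  apply: le_trans p0b; rewrite -natrM ler_nat.
  apply: (@leq_trans p0.-1); last exact: leq_pred.
  apply: dvdn_leq; first by rewrite -ltnS prednK ?prime_gt1 ?prime_gt0.
  rewrite Gauss_dvd ?lp /= /k; last by rewrite coprimeMr !prime_coprime // !dvdn_prime2 // lq lq'.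
  by rewrite Gauss_dvd ?qp // prime_coprime // dvdn_prime2.
set x := b ^+ i.+1 / k%:R in kl.
have x1 : 1 <= x by apply: le_trans (bX1 j') (ltW kl).
pose T := (Num.truncn x).+1.
have xT : x < T%:R by exact: truncnS_gt.
have Tx : T%:R <= 2 * x by rewrite /T -natr1; have := truncn_le x; rewrite (le_trans ler01 x1); lra.
pose z := Num.truncn (b ^+ s).
have zb : z%:R <= b ^+ s by rewrite truncn_le ltW.
have z0 : (0 < z)%N by rewrite truncn_gt0.
have := @prime_progression_bound R (block i) k z T (block_uniq i).
have -> : all prime (block i) by apply/allP => p /blockP[].
move=> /(_ isT) H.
have {H} H : (\sum_(p <- block i) (k %| p.-1)%:R) * ln z.+1%:R <= 4 * T%:R :> R.
  apply: H => //.
  - move=> p /blockP[_ bp pb]; apply/andP; split.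
      by rewrite -(ltr_nat R) (le_lt_trans zb) // (le_lt_trans _ bp) // bXle.
    rewrite -(ler_nat R) natrM; apply: le_trans pb _.
    by rewrite -ler_pdivrMl ?ltr0n // mulrC ltW.
  - move=> r pr rz; rewrite /k coprimeMl ![coprime _ r]coprime_sym !prime_coprime //.
    have rb : r%:R <= b ^+ j by apply: le_trans (_ : z%:R <= _); rewrite ?ler_nat // (le_trans zb) // bXle.
    rewrite !dvdn_prime2 //; apply/andP; split; apply/eqP => rE.
      by move: bq; rewrite -rE ltNge rb.
    by move: bq'; rewrite -rE ltNge rb.
  - rewrite -(ler_nat R) natrX; apply: le_trans (_ : (b ^+ s) ^+ 4 <= _).
      by rewrite lerXn2r ?nnegrE ?ler0n ?(ltW (bX0 _)).
    rewrite -exprM mulnC; apply: le_trans (bXle sj') _; exact/ltW/(lt_trans kl).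
have lnz : e * i.+1%:R * ln b <= ln (z.+1%:R : R).
  apply: le_trans (_ : s%:R * ln b <= _); first by rewrite ler_pM2r.
  rewrite mulr_natl -lnXn // ler_ln ?posrE // ltW // truncnS_gt //.
set N := \sum_(p <- block i) (k %| p.-1)%:R in H.
have N0 : 0 <= N by apply: sumr_ge0.
have NE : \sum_(p <- block i) (has (fun l => l %| p.-1)%N (window Q j' n') &&
     (q %| p.-1)%N && (q' %| p.-1)%N)%:R <= N.
  apply: ler_sum => p _; rewrite ler_nat /k Gauss_dvd; last by rewrite prime_coprime // dvdn_prime2.
  by case: (has _ _); case: (_ %| _)%N; case: (_ %| _)%N.
apply: le_trans NE _.
have ei0 : 0 < e * i.+1%:R * ln b by rewrite !mulr_gt0 // ltr0n.
have H2 : N * (e * i.+1%:R * ln b) <= 8 * x.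
  apply: le_trans (_ : N * ln (z.+1%:R : R) <= _); first by rewrite ler_wpM2l.
  by apply: le_trans H _; lra.
have H3 : x <= b * i.+1%:R * block_mass i / k%:R.
  rewrite /x ler_pM2r ?invr_gt0 ?ltr0n // exprS -mulrA ler_pM2l // mulrC.
  by have := block_mass_ge bi; rewrite ler_pdivrMr.
have H4 : N <= 8 * b / (e * ln b) * block_mass i / k%:R.
  rewrite -(@ler_pM2r _ (e * i.+1%:R * ln b)) //; apply: le_trans H2 _.
  have -> : 8 * b / (e * ln b) * block_mass i / k%:R * (e * i.+1%:R * ln b) =
     8 * (b * i.+1%:R * block_mass i / k%:R).
    by field; rewrite ?gt_eqF // ltr0n.
  lra.
apply: le_trans H4 _; apply: ler_wpM2l; first by apply: mulr_ge0 => //; exact: ltW.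
rewrite lef_pV2 ?posrE ?mulr_gt0 ?ltr0n ?k0 ?totient_gt0 ?(prime_gt0 pq) ?(prime_gt0 pq') //.
by rewrite /k natrM ler_pM // ler_nat totient_prime // leq_pred.
Qed.

(** The auxiliary window ends before the window of the [q] begins, so every [l] is smaller than
    every [q], and the bound [K] on prime factors above [b ^ j'] serves both windows. The range
    condition reserves room for one [q] and two [l]. *)
Lemma density_second_moment h i j n j' n' s K (e m : R) :
  2 <= b ^+ i -> (0 < K)%N -> (0 < s)%N -> (4 * s <= j')%N -> (j' + n' <= j)%N ->
  (j <= i)%N -> (i < K.+1 * j')%N -> (j + n + 2 * (j' + n'))%:R <= theta * i.+1%:R ->
  0 < e -> e * i.+1%:R <= s%:R ->
  1 <= inv_totient_sum (window xpredT j' n') :> R ->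
  0 <= m <= inv_totient_sum (window (chain_ge h) j n) ->
  m * (1 - (inv_totient_sum (R := R) (window xpredT j' n'))^-1)
    - 8 * b / (e * ln b) * m ^+ 2 - 5 * K%:R ^+ 3 * block_error i <=
  density (chain_ge h.+1) i.
Proof.
move=> bi K0 s0 sj' jj ji iK jni e0 es mu1 mG.
pose G := window (chain_ge h) j n; pose L := window xpredT j' n'.
have W0 := block_mass_gt0 bi.
have K1 : 1 <= K%:R :> R by rewrite ler1n.
have iK' : (i < K.+1 * j)%N.
  by apply: leq_trans iK _; rewrite leq_mul2l (leq_trans _ jj) ?leq_addr ?orbT.
have sep q l : q \in G -> l \in L -> (l < q)%N.
  move=> /windowP[_ _ bq _] /windowP[_ _ _ bl]; rewrite -(ltr_nat R).
  by apply: le_lt_trans bl (le_lt_trans _ bq); exact: bXle.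
have prod3 q l l' : q \in G -> l \in L -> l' \in L ->
    (q * (l * l') < (Num.truncn ((b ^+ i.+1) `^ theta)).+1)%N.
  move=> /windowP[_ _ _ bq] /windowP[_ _ _ bl] /windowP[_ _ _ bl'].
  apply: lt_modulus jni _; rewrite !natrM exprD mul2n -addnn (exprD _ (j' + n')).
  by apply: ler_pM => //; exact: ler_pM.
have C0 : 0 <= 8 * b / (e * ln b) by rewrite divr_ge0 ?mulr_ge0 ?ltW.
have := @shifted_hits R (block i) _ _ _ (8 * b / (e * ln b)) m _ G L (ltW W0)
  (block_equidistributed bi) K1 C0 (window_uniq _ _ _) (window_uniq _ _ _) (window_prime _ _ _).
move=> H.
have {H} H := H _ _ prod3 (window_few_divisors _ _ iK') (window_few_divisors _ _ iK) mu1 _ mG.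
rewrite /density ler_pdivlMr //; apply: le_trans (_ : _ <= block_mass i *
   (m * (1 - (inv_totient_sum L)^-1) - 8 * b / (e * ln b) * m ^+ 2) -
   5 * K%:R ^+ 3 * (block_error i * block_mass i)) _; first by rewrite le_eqVlt; apply/orP; left; apply/eqP; ring.
apply: le_trans (H _ _ _) _.
- move=> q /windowP[pq _ _ bq]; rewrite prime_gt0 //=; apply: lt_modulus bq.
  by apply: le_trans jni; rewrite ler_nat leq_addr.
- move=> q l qG lL; rewrite coprime_sym prime_coprime; last by have [] := windowP lL.
  rewrite dvdn_prime2; [|by have [] := windowP lL|by have [] := windowP qG].
  by rewrite neq_ltn sep.
- move=> q q' qG qG' qq; apply: (window_pair_bound (s := s) bi _ _ _ _ e0 es qG qG' qq) => //.
  + by rewrite (leq_trans _ jj) // (leq_trans _ (leq_addr _ _)) // (leq_trans _ sj') // leq_pmull.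
  + by rewrite (leq_trans _ ji) // (leq_trans _ jj) // (leq_trans _ (leq_addr _ _)) // (leq_trans _ sj') // leq_pmull.
  + by move=> l lL; split; rewrite neq_ltn sep.
rewrite big_seq [leRHS]big_seq; apply: ler_sum => p /blockP[pp _ _].
by rewrite ler_nat; case: (boolP (has _ _)) => // /(chain_ge_step pp) ->.
Qed.

End Blocks.

(** * Chains in a positive proportion of the primes *)

Section OneStep.
Context {R : realType}.

Lemma harmonic_window j n :
  ln ((j + n).+1%:R / j.+1%:R) <= \sum_(j <= i < j + n) (i.+1%:R^-1 : R).
Proof.
elim: n => [|n IHn]; first by rewrite addn0 divff // ln1 big_geq.
rewrite addnS big_nat_recr ?leq_addr //=.
have -> : (j + n).+2%:R / j.+1%:R =
    (j + n).+1%:R / j.+1%:R * (1 + (j + n).+1%:R^-1) :> R.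
  have : 0 < (j + n).+1%:R :> R by [].
  have : 0 < j.+1%:R :> R by [].
  rewrite -[(j + n).+2%:R]natr1; move: (_.+1%:R : R) ((j + n).+1%:R : R) => y x y0 x0.
  by field; rewrite !gt_eqF.
rewrite lnM ?posrE ?divr_gt0 ?addr_gt0 ?invr_gt0 // lerD //.
by apply: le_ln1Dx; apply: (@lt_trans _ _ 0); rewrite ?ltrN10 // invr_gt0.
Qed.

Lemma near_expr_ge (b y : R) : 1 < b -> \forall i \near \oo, y <= b ^+ i.
Proof.
move=> b1; have lb := ln_gt0 b1.
near=> i.
have -> : b ^+ i = expR (i%:R * ln b).
  by rewrite mulr_natl -lnXn ?lnK ?posrE ?exprn_gt0 // (lt_trans _ b1).
apply: le_trans (expR_ge1Dx _); rewrite -lerBlDl -ler_pdivrMr //.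
by near: i; exact: nbhs_infty_ger.
Unshelve. all: by end_near. Qed.

Lemma divn_le_real i A : (0 < A)%N -> (i %/ A)%:R <= i%:R / A%:R :> R.
Proof. by move=> A0; rewrite ler_pdivlMr ?ltr0n // -natrM ler_nat leq_divM. Qed.

Lemma divn_gt_real i A : (0 < A)%N -> i%:R / A%:R - 1 < (i %/ A)%:R :> R.
Proof.
move=> A0; rewrite ltrBlDr natr1 ltr_pdivrMr ?ltr0n // -natrM ltr_nat.
by rewrite ltn_ceil.
Qed.

Lemma near_divn N A : (0 < A)%N -> \forall i \near \oo, (N <= i %/ A)%N.
Proof.
move=> A0; near=> i; rewrite leq_divRL //.
by near: i; exact: nbhs_infty_ge.
Unshelve. all: by end_near. Qed.

Section OneStepFixedBase.
Variables (b theta : R).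
Hypotheses (b1 : 1 < b) (theta1 : theta <= 1).
Hypothesis error0 : forall tau, 0 < tau -> \forall i \near \oo, block_error b theta i <= tau.

Let b0 : 0 < b. Proof. exact: lt_trans b1. Qed.

(** The modulus 1 alone gives prime number information on blocks: the density of all primes is at
    least [1 - block_error]. *)
Lemma near_prime_density : 0 < theta ->
  \forall i \near \oo, 1 / 2 <= density b xpredT i.
Proof.
move=> th0; near=> i.
have bi : 2 <= b ^+ i by near: i; exact: near_expr_ge.
have W0 := block_mass_gt0 b1 bi.
have err : block_error b theta i <= 1 / 2 by near: i; apply: error0; lra.
have M1 : (1 < (Num.truncn ((b ^+ i.+1) `^ theta)).+1)%N.
  by apply: (lt_modulus b1 (k := 0)); rewrite ?expr0 // mulr_ge0 // ltW.
have := sum_shift_count_ge (block_equidistributed theta b1 bi) (lexx 1) _ (few_divisors1 (lexx 1)).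
move=> /(_ ltac:(by move=> q; rewrite inE => /eqP ->)).
rewrite expr1n mul1r big_seq1 /inv_totient_sum big_seq1 (_ : totient 1 = 1%N) // invr1 mulr1.
rewrite /shift_count /density => H.
rewrite ler_pdivlMr //; apply: le_trans (_ : _ <= \sum_(p <- block b i) (1 %| p.-1)%:R) _; last first.
  by apply: ler_sum => p _; rewrite dvd1n.
apply: le_trans H; have := ler_wpM2r (ltW W0) err; lra.
Unshelve. all: by end_near. Qed.

(* The window of auxiliary primes l makes the multiplicity of p - 1 outside
   the pair (q, q') at least b^(i/A), which is what the sieve bound needs. *)
Lemma density_one_step (alpha beta eta : R) :
  0 < theta -> 0 < alpha -> 0 < beta < theta -> 0 < eta ->
  exists2 C, 0 <= C & forall tau, 0 < tau -> \forall i \near \oo,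
    forall h j n m, alpha * i%:R <= j%:R -> (j + n)%:R <= beta * i%:R ->
      0 <= m <= \sum_(j <= k < j + n) density b (chain_ge h) k / (b * k.+1%:R) ->
      m * (1 - eta) - C * m ^+ 2 - tau <= density b (chain_ge h.+1) i.
Proof.
move=> th0 al0 /andP[be0 beth] eta0.
have lb := ln_gt0 b1.
(* The auxiliary window runs from [i / A] to [i / B]. The first summand in [B] puts its end below
   [alpha * i <= j]; the second lets two of its primes fit into the exponent
   [(theta - beta) * i]. *)
pose B := (Num.truncn (alpha^-1 + 2 / (theta - beta))).+1.
have Bge : alpha^-1 + 2 / (theta - beta) <= B%:R by exact/ltW/truncnS_gt.
have d0 : 0 < theta - beta by rewrite subr_gt0.
have B1 : alpha^-1 <= B%:R by apply: le_trans Bge; rewrite lerDl divr_ge0 // ltW.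
have B2 : 2 / (theta - beta) <= B%:R by apply: le_trans Bge; rewrite lerDr invr_ge0 ltW.
(* Every block of the window has density at least 1/2, so its mass is at least
   [ln (A / (2 * B)) / (2 * b)], where the 2 beside [B] absorbs the rounding. This [A] makes the
   mass at least [1 + eta^-1], and Turan's loss at most [eta]. *)
pose A := (Num.truncn (2 * B%:R * expR (2 * b * (1 + eta^-1)))).+1.
have Age : 2 * B%:R * expR (2 * b * (1 + eta^-1)) <= A%:R by exact/ltW/truncnS_gt.
have ei0 : 0 < eta^-1 by rewrite invr_gt0.
have AB : (B <= A)%N.
  rewrite -(ler_nat R); apply: le_trans Age.
  have e1 : 1 <= expR (2 * b * (1 + eta^-1)).
    by apply: le_trans (expR_ge1Dx _); rewrite lerDl !mulr_ge0 ?(ltW b0) //; lra.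
  have : B%:R * 1 <= B%:R * expR (2 * b * (1 + eta^-1)) by rewrite ler_wpM2l.
  have : 0 <= B%:R * expR (2 * b * (1 + eta^-1)) by rewrite mulr_ge0 // expR_ge0.
  lra.
have A0 : (0 < A)%N by [].
have B0 : (0 < B)%N by [].
have AR : 0 < A%:R :> R by rewrite ltr0n.
have BR : 0 < B%:R :> R by rewrite ltr0n.
(* The sieve level is [s = i / (4 * A)], of which half survives the rounding. As [e] does not
   involve [tau], neither does the constant [C]. *)
pose e : R := (8 * A%:R)^-1.
have e0 : 0 < e by rewrite invr_gt0 mulr_gt0.
exists (8 * b / (e * ln b)); first by rewrite divr_ge0 ?mulr_ge0 // ltW.
move=> tau tau0; pose K := (2 * A)%N.
have K0 : (0 < K)%N by rewrite muln_gt0.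
have [N _ primeN] := near_prime_density th0.
have [M _ bM] := near_expr_ge 2 b1.
near=> i => h j n m alj jnb mS.
have iA : (N <= i %/ A)%N by near: i; exact: near_divn.
have i11 : (11 * A <= i)%N by near: i; exact: nbhs_infty_ge.
have biA : 2 <= b ^+ (i %/ A).
  apply: bM => /=; near: i; exact: near_divn.
have i11R : 11 * A%:R <= i%:R :> R by rewrite -natrM ler_nat.
have iR : 0 < i%:R :> R by lra.
have iAge := divn_gt_real i A0.
have iBle := divn_le_real i B0.
have iBgt := divn_gt_real i B0.
have iAle := divn_le_real i A0.
have iABn : (i %/ A <= i %/ B)%N by exact: leq_div2l.
have jn : (i %/ A + (i %/ B - i %/ A) = i %/ B)%N by rewrite subnKC.
have bi : 2 <= b ^+ i by apply: le_trans biA _; rewrite ler_weXn2l ?leq_div // ltW.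
have sbound : e * i.+1%:R <= (i %/ A %/ 4)%:R.
  have := divn_gt_real (i %/ A) (isT : (0 < 4)%N).
  rewrite /e invfM -[i.+1%:R]natr1.
  have : i%:R / A%:R * A%:R = i%:R :> R by rewrite divfK // gt_eqF.
  move: iAge; set y := i%:R / A%:R; set w := (i %/ A)%:R => H1 H2 H3.
  have y11 : 11 <= y by rewrite /y ler_pdivlMr.
  have Ai : A%:R^-1 <= 1 :> R by rewrite invf_le1 // ler1n.
  have -> : 8^-1 * A%:R^-1 * (i%:R + 1) = 8^-1 * y + 8^-1 * A%:R^-1 :> R by rewrite /y; ring.
  lra.
have s0 : (0 < i %/ A %/ 4)%N.
  by rewrite -(ltr_nat R); apply: lt_le_trans sbound; rewrite mulr_gt0.
have muge : 1 + eta^-1 <= inv_totient_sum (window b xpredT (i %/ A) (i %/ B - i %/ A)).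
  apply: le_trans (inv_totient_window b1 _ _ biA).
  apply: (@le_trans _ _ (\sum_(i %/ A <= k < i %/ A + (i %/ B - i %/ A)) (2 * b)^-1 * k.+1%:R^-1)).
    rewrite -mulr_sumr ler_pdivlMl ?mulr_gt0 //.
    apply: le_trans (harmonic_window _ _); rewrite jn.
    rewrite -[leLHS]expRK ler_ln ?posrE ?expR_gt0 ?divr_gt0 //.
    rewrite ler_pdivlMr // -[(i %/ B).+1%:R]natr1 -[(i %/ A).+1%:R]natr1.
    set E := expR _.
    have E0 : 0 < E by exact: expR_gt0.
    apply: (@le_trans _ _ (i%:R / B%:R)); last lra.
    rewrite ler_pdivlMr //.
    apply: (@le_trans _ _ (E * (2 * (i%:R / A%:R)) * B%:R)).
      rewrite ler_pM2r // ler_pM2l //.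
      have : 11 <= i%:R / A%:R :> R by rewrite ler_pdivlMr.
      lra.
    have -> : E * (2 * (i%:R / A%:R)) * B%:R = i%:R * (2 * B%:R * E / A%:R) by ring.
    by rewrite ler_piMr ?(ltW iR) // ler_pdivrMr // mul1r.
  apply: ler_sum_nat => k /andP[ik _].
  have := primeN k (leq_trans iA ik) => /= dk.
  rewrite invfM -mulrA -invfM; apply: ler_wpM2r; first by rewrite invr_ge0 mulr_ge0 // ltW.
  lra.
have mu1 : 1 <= inv_totient_sum (window b xpredT (i %/ A) (i %/ B - i %/ A)) :> R by lra.
have ji : (j + n <= i)%N.
  rewrite -(ler_nat R); apply: le_trans jnb _; rewrite ler_piMl //.
  exact: le_trans (ltW beth) theta1.
have iBj : (i %/ B <= j)%N.
  rewrite -(ler_nat R); apply: le_trans iBle _; apply: le_trans alj.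
  rewrite ler_pdivrMr // -ler_pdivrMl ?mulr_gt0 // invfM -mulrA mulVf ?mulr1 // gt_eqF //.
have bj : 2 <= b ^+ j.
  apply: le_trans biA _; rewrite ler_weXn2l ?(leq_trans _ iBj) // ltW //.
have iK : (i < K.+1 * (i %/ A))%N.
  have := ltn_ceil i A0; have : (4 <= i %/ A)%N by apply: leq_trans (leq_divM _ 4); rewrite leq_pmull.
  rewrite /K; move: (i %/ A)%N => d d4 iA'; apply: leq_trans iA' _.
  apply: (@leq_trans (2 * d * A)%N); first by rewrite leq_mul2r ltn_Pmull ?orbT // (leq_trans _ d4).
  by rewrite [leqRHS]mulSn mulnAC leq_addl.
have total : (j + n + 2 * (i %/ A + (i %/ B - i %/ A)))%:R <= theta * i.+1%:R.
  rewrite jn natrD natrM; apply: (@le_trans _ _ (beta * i%:R + 2 * (i%:R / B%:R))).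
    by rewrite lerD // ler_pM2l.
  have : 2 * (i%:R / B%:R) <= (theta - beta) * i%:R.
    rewrite mulrCA mulrC ler_pM2r // ler_pdivrMr // mulrC -ler_pdivrMr //.
  rewrite -[i.+1%:R]natr1; lra.
have jB : (i %/ A + (i %/ B - i %/ A) <= j)%N by rewrite jn.
have m0m : 0 <= m <= inv_totient_sum (window b (chain_ge h) j n).
  case/andP: mS => -> /= mS; apply: le_trans mS (inv_totient_window b1 _ _ bj).
have s4 : (4 * (i %/ A %/ 4) <= i %/ A)%N by rewrite mulnC leq_divM.
have := density_second_moment b1 theta1 bi K0 s0 s4 jB (leq_trans (leq_addr n j) ji) iK total e0 sbound mu1 m0m.
apply: le_trans.
have err : 5 * K%:R ^+ 3 * block_error b theta i <= tau.
  rewrite -ler_pdivlMl ?mulr_gt0 ?exprn_gt0 ?ltr0n //.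
  near: i; apply: error0; rewrite mulr_gt0 // invr_gt0 mulr_gt0 ?exprn_gt0 ?ltr0n //.
have mueta : (inv_totient_sum (window b xpredT (i %/ A) (i %/ B - i %/ A)))^-1 <= eta.
  rewrite -[leRHS]invrK lef_pV2 ?posrE //; last exact: lt_le_trans mu1.
  by apply: le_trans muge; rewrite lerDr.
case/andP: mS => m0 _; apply: lerB => //.
by rewrite lerD2r ler_wpM2l // lerD2l lerN2.
Unshelve. all: by end_near. Qed.

End OneStepFixedBase.
End OneStep.

(** * The linearized recursion and its iteration *)

Section Iteration.
Context {R : realType}.

Lemma exprB_le (x y : R) k : 0 <= y <= x ->
  x ^+ k.+1 - y ^+ k.+1 <= k.+1%:R * x ^+ k * (x - y).
Proof.
move=> /andP[y0 yx]; have x0 : 0 <= x by apply: le_trans yx.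
elim: k => [|k IHk]; first by rewrite !expr1 expr0 mulr1 mul1r.
have -> : x ^+ k.+2 - y ^+ k.+2 = x * (x ^+ k.+1 - y ^+ k.+1) + y ^+ k.+1 * (x - y).
  by rewrite (exprS x k.+1) (exprS y k.+1); ring.
have H1 := ler_wpM2l x0 IHk.
have H2 : y ^+ k.+1 * (x - y) <= x ^+ k.+1 * (x - y).
  by rewrite ler_wpM2r ?subr_ge0 // lerXn2r.
apply: le_trans (lerD H1 H2) _.
by rewrite -[k.+2%:R]natr1 le_eqVlt; apply/orP; left; apply/eqP; rewrite exprS; ring.
Qed.

(** With [kappa = - k * ln beta] this is the logarithm of [beta ^ k * i / X], cut off at 0; its
    [k]-th power over [k!] is the shape that the linearized recursion reproduces. *)
Definition log_excess (X : nat) (kappa : R) (i : nat) : R :=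
  Num.max 0 (ln (i%:R / X%:R) - kappa).

Lemma log_excess_ge0 X kappa i : 0 <= log_excess X kappa i.
Proof. by rewrite le_max lexx. Qed.

Lemma log_excess_step X kappa i : (0 < X)%N -> (0 < i)%N ->
  log_excess X kappa i <= log_excess X kappa i.+1 <= log_excess X kappa i + i%:R^-1.
Proof.
move=> X0 i0; have XR : 0 < X%:R :> R by rewrite ltr0n.
have iR : 0 < i%:R :> R by rewrite ltr0n.
have lt1 : ln (i%:R / X%:R) <= ln (i.+1%:R / X%:R) :> R.
  by rewrite ler_ln ?posrE ?divr_gt0 // ler_pM2r ?invr_gt0 // ler_nat.
have lt2 : ln (i.+1%:R / X%:R) <= ln (i%:R / X%:R) + i%:R^-1 :> R.
  have -> : i.+1%:R / X%:R = i%:R / X%:R * (1 + i%:R^-1) :> R.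
    by rewrite -natr1; field; rewrite !gt_eqF.
  rewrite lnM ?posrE ?divr_gt0 ?addr_gt0 ?invr_gt0 // lerD2l.
  by apply: le_ln1Dx; apply: (@lt_trans _ _ 0); rewrite ?ltrN10 // invr_gt0.
have v0 : 0 < i%:R^-1 :> R by rewrite invr_gt0.
rewrite /log_excess; move: lt1 lt2 v0.
move: (ln _) (ln _) (i%:R^-1 : R) => u v w H1 H2 H3; apply/andP; split.
  by rewrite ge_max le_max lexx /= le_max lerD2r H1 orbT.
rewrite ge_max; apply/andP; split; first by rewrite addr_ge0 ?le_max ?lexx // ltW.
by rewrite addr_maxl le_max; apply/orP; right; lra.
Qed.

(** The discrete form of integrating [u ^ k] against [du], with [u] the logarithm of the scale. The
    factor [rho1], which may be taken close to 1 for large [X], pays for the shifts by one in the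
    denominators. *)
Lemma log_excess_sum X kappa k t (rho1 : R) : (1 < X)%N -> 0 <= kappa -> 0 <= rho1 ->
  (forall j, (X <= j)%N -> rho1 * j.+1%:R <= j%:R - 1) ->
  rho1 * log_excess X kappa (X + t) ^+ k.+1 <=
  k.+1%:R * \sum_(X <= j < (X + t).+1) log_excess X kappa j ^+ k / j.+1%:R.
Proof.
move=> X1 ka0 rho0 rhoP; have X0 : (0 < X)%N by apply: ltnW.
elim: t => [|t IHt].
  rewrite addn0 /log_excess divff ?ln1 ?pnatr_eq0 -?lt0n // sub0r.
  have /max_idPl -> : - kappa <= 0 by rewrite oppr_le0.
  by rewrite expr0n mulr0 big_nat1 mulr_ge0 // divr_ge0 // exprn_ge0 // le_max lexx.
rewrite addnS big_nat_recr ?leqW ?leq_addr //= mulrDr.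
have Xt0 : (0 < X + t)%N by rewrite addn_gt0 X0.
have /andP[u1 u2] := log_excess_step kappa X0 Xt0.
have u0 := log_excess_ge0 X kappa (X + t).
have := @exprB_le (log_excess X kappa (X + t).+1) (log_excess X kappa (X + t)) k.
rewrite u0 u1 => /(_ isT) H.
have := ler_wpM2l rho0 H; rewrite mulrBr lerBlDl => H'.
apply: le_trans H' _; apply: lerD => //.
set v := log_excess _ _ (X + t).+1 in u1 u2 H *.
have v0 : 0 <= v by apply: le_trans u1.
have XtR : 0 < (X + t)%:R :> R by rewrite ltr0n.
have key : rho1 * (v - log_excess X kappa (X + t)) <= (X + t).+2%:R^-1.
  apply: (@le_trans _ _ (rho1 * (X + t)%:R^-1)).
    by rewrite ler_wpM2l // lerBlDl.
  rewrite ler_pdivrMr // ler_pdivlMl // mulrC.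
  by have := rhoP _ (leqW (leq_addr t X)); rewrite -[(X + t).+1%:R in leRHS]natr1 addrK.
rewrite -/v (_ : rho1 * _ = k.+1%:R * (v ^+ k * (rho1 * (v - log_excess X kappa (X + t))))).
  by apply: ler_wpM2l => //; apply: ler_wpM2l => //; exact: exprn_ge0.
by ring.
Qed.


(* D h i stands for the density of primes with a chain of length h at scale i;
   one-step gains of the form m - C m^2 are iterated in the linear regime. *)
Lemma iterated_density (D : nat -> nat -> R) (alpha beta beta0 eta C tau b E delta rho1 : R)
    (X h n : nat) :
  (1 < X)%N -> 0 < alpha -> alpha * E <= 1 -> 0 < beta < beta0 -> beta0 <= 1 ->
  0 < eta <= 1 / 2 -> 0 <= C -> 0 < tau -> 1 <= b -> 1 <= E -> 0 < delta ->
  0 <= rho1 <= 1 ->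
  (forall j, (X <= j)%N -> rho1 * j.+1%:R <= j%:R - 1) ->
  (forall i, (X <= i)%N -> beta * i%:R + 2 <= beta0 * i%:R) ->
  (forall h i, (X <= i)%N -> 0 <= D h i) ->
  (forall i, (X <= i)%N -> forall h j t m,
     alpha * i%:R <= j%:R -> (j + t)%:R <= beta0 * i%:R ->
     0 <= m <= \sum_(j <= k < j + t) D h k / (b * k.+1%:R) ->
     m * (1 - eta) - C * m ^+ 2 - tau <= D h.+1 i) ->
  (forall j, (X <= j)%N -> delta <= D h j) ->
  (forall k, (k <= n)%N -> C * (delta * (ln E) ^+ k) <= eta) ->
  forall k i, (k <= n)%N -> (X <= i)%N -> i%:R <= E * X%:R ->
    delta * ((1 - 2 * eta) * rho1 / b) ^+ k *
      log_excess X (- k%:R * ln beta) i ^+ k / k`!%:R - tau * (E + 1) ^+ k <= D (h + k)%N i.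
Proof.
move=> X1 al0 alE /andP[be0 bebe] be01 /andP[eta0 eta2] C0 tau0 b1 E1 de0 /andP[r0 r1]
  rhoP bet D0 step Dh small.
have e20 : 0 <= 1 - 2 * eta by lra.
have e21 : 1 - 2 * eta <= 1 by lra.
have between (x y z w : R) : x <= y + 1 -> y + 2 <= z -> z <= w -> x <= w by lra.
have descent (P g g' : R) : (1 - 2 * eta) * P <= P -> E * g + tau <= g' -> P - E * g < 0 ->
  (1 - 2 * eta) * P - g' <= 0 by lra.
have ascent (m g g' : R) : E * g + tau <= g' -> (1 - 2 * eta) * (E * g) <= E * g ->
    C * m ^+ 2 <= eta * m ->
  m * (1 - 2 * eta) + (1 - 2 * eta) * (E * g) - g' <= m * (1 - eta) - C * m ^+ 2 - tau by lra.
have XR : 0 < X%:R :> R by rewrite ltr0n (ltnW X1).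
have b0 : 0 < b by lra.
have E0 : 0 < E by lra.
have lnE : 0 <= ln E by exact: ln_ge0.
have lnbe : ln beta <= 0 by apply: ln_le0; lra.
set rho := (1 - 2 * eta) * rho1 / b.
have rho0 : 0 <= rho by rewrite divr_ge0 ?mulr_ge0 //; lra.
have rho1' : rho <= 1.
  rewrite ler_pdivrMr // mul1r; apply: le_trans b1.
  have : (1 - 2 * eta) * rho1 <= 1 * 1 by rewrite ler_pM //; lra.
  by rewrite mulr1.
elim=> [|k IHk] i kn Xi iE.
  rewrite addn0 !expr0 mulr1 fact0 divr1 mulr1; apply: le_trans (Dh i Xi); lra.
have kn' := ltnW kn.
have iR : 0 < i%:R :> R by apply: lt_le_trans XR _; rewrite ler_nat.
have Ek0 : 0 < (E + 1) ^+ k by rewrite exprn_gt0 //; lra.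
(* One step sums the previous error over at most [E * X] blocks with weights at most [1 / X] and
   adds [tau]; hence the growth factor [E + 1]. *)
have errE : E * (tau * (E + 1) ^+ k) + tau <= tau * (E + 1) ^+ k.+1.
  have : 1 <= (E + 1) ^+ k by rewrite exprn_ege1 //; lra.
  move=> /(ler_wpM2l (ltW tau0)); rewrite exprS; lra.
have kappaS : - k.+1%:R * ln beta = - k%:R * ln beta - ln beta by rewrite -natr1; ring.
set e1 := tau * (E + 1) ^+ k.+1 in errE *.
set e := tau * (E + 1) ^+ k in errE IHk.
have e0 : 0 < e by rewrite mulr_gt0.
have e10 : 0 <= e1 by have := mulr_gt0 E0 e0; lra.
(* Where the logarithm is cut off, the claimed lower bound is at most 0. Otherwise [X < beta * i],
   and there is a window from [X] to [beta * i]. *)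
have [uneg|upos] := lerP (ln (i%:R / X%:R) - - k.+1%:R * ln beta) 0.
  have -> : log_excess X (- k.+1%:R * ln beta) i = 0 by apply/max_idPl.
  by rewrite expr0n mulr0 mul0r sub0r (le_trans _ (D0 _ _ Xi)) // oppr_le0.
set u := log_excess X (- k.+1%:R * ln beta) i.
have uE : u = ln (i%:R / X%:R) - - k.+1%:R * ln beta by apply/max_idPr/ltW.
have u0 : 0 < u by rewrite uE.
have uE' : u <= ln E.
  rewrite uE; apply: (@le_trans _ _ (ln (i%:R / X%:R))).
    by rewrite gerBl mulNr oppr_ge0 mulr_ge0_le0.
  by rewrite ler_ln ?posrE ?divr_gt0 // ler_pdivrMr.
have Xbi : X%:R < beta * i%:R.
  have : 0 < ln (i%:R / X%:R * beta).
    rewrite lnM ?posrE ?divr_gt0 //; apply: lt_le_trans upos _.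
    rewrite kappaS; have := mulr_ge0_le0 (ler0n R k) lnbe; lra.
  move=> H; have : 1 < i%:R / X%:R * beta.
    by rewrite ltNge; apply/negP => /ln_le0; lra.
  by rewrite mulrAC ltr_pdivlMr // mul1r mulrC.
(* The window ends just above [beta * i]; the margin between [beta] and [beta0] absorbs the
   rounding. *)
pose t := ((Num.truncn (beta * i%:R)).+1 - X)%N.
have tr := truncn_le (beta * i%:R); have trS := truncnS_gt (beta * i%:R).
have bi0 : 0 <= beta * i%:R by rewrite mulr_ge0 // ltW.
rewrite bi0 in tr.
have XtE : (X + t)%N = (Num.truncn (beta * i%:R)).+1.
  by rewrite /t subnKC // ltnW // -(ltr_nat R) (lt_trans Xbi).
have XtR : (X + t)%:R <= beta * i%:R + 1 :> R by rewrite XtE -natr1 lerD2r.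
have Xtb : beta * i%:R <= (X + t)%:R by rewrite XtE ltW.
have beti := bet _ Xi.
have be0i : beta0 * i%:R <= i%:R by rewrite ler_piMl // ltW.
have ali : alpha * i%:R <= X%:R.
  apply: (@le_trans _ _ (alpha * (E * X%:R))); first by rewrite ler_pM2l.
  by rewrite mulrA ler_piMl // ltW.
have XtS : (X + t.+1)%:R <= beta0 * i%:R by rewrite addnS -natr1; lra.
have kap0 : 0 <= - k%:R * ln beta by rewrite mulNr oppr_ge0 mulr_ge0_le0.
have lsum := log_excess_sum k t X1 kap0 r0 rhoP.
rewrite -addnS in lsum.
(* Passing from scale [i] to the end of the window costs [- ln beta], exactly the difference between
   the cut-offs for [k.+1] and [k]. *)
have uv : u <= log_excess X (- k%:R * ln beta) (X + t).
  rewrite /log_excess le_max; apply/orP; right; rewrite uE kappaS.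
  have : ln (beta * i%:R / X%:R) <= ln ((X + t)%:R / X%:R).
    by rewrite ler_ln ?posrE ?divr_gt0 ?mulr_gt0 ?ler_pM2r ?invr_gt0 // ltr0n addn_gt0 (ltnW X1).
  rewrite -mulrA lnM ?posrE ?divr_gt0 //; lra.
pose P := delta * rho ^+ k * rho1 / b * u ^+ k.+1 / (k.+1)`!%:R.
have f0 : 0 < (k.+1)`!%:R :> R by rewrite ltr0n fact_gt0.
have f1 : 1 <= (k.+1)`!%:R :> R by rewrite ler1n fact_gt0.
have P0 : 0 <= P by rewrite !mulr_ge0 ?invr_ge0 ?exprn_ge0 // ltW.
have TE : delta * rho ^+ k.+1 * u ^+ k.+1 / (k.+1)`!%:R = (1 - 2 * eta) * P.
  by rewrite /P exprSr {2}/rho; ring.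
(* Through this bound the quadratic loss [C * m ^ 2] is at most [eta * m], which makes [2 * eta] in
   all; it is here that [delta] has to be small. *)
have CP : C * P <= eta.
  apply: le_trans (small _ kn); apply: ler_wpM2l => //.
  have q1 : delta * rho ^+ k * rho1 / b / (k.+1)`!%:R <= delta.
    rewrite -!mulrA ler_piMr ?(ltW de0) // !mulrA.
    rewrite ler_pdivrMr // mul1r ler_pdivrMr //.
    have : rho ^+ k * rho1 <= 1 * 1 by rewrite ler_pM ?exprn_ge0 // exprn_ile1.
    have : 1 * 1 <= (k.+1)`!%:R * b by rewrite ler_pM.
    lra.
  rewrite /P mulrAC; apply: ler_pM => //; first by rewrite !mulr_ge0 ?invr_ge0 ?exprn_ge0 // ltW.
    by rewrite exprn_ge0 // ltW.
  by rewrite lerXn2r ?nnegrE // ltW.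
pose S : R := \sum_(X <= j < X + t.+1) D (h + k)%N j / (b * j.+1%:R).
have SP : P - E * e <= S.
  have inner j : (X <= j < X + t.+1)%N ->
     delta * rho ^+ k / k`!%:R / b * (log_excess X (- k%:R * ln beta) j ^+ k / j.+1%:R)
     - e / X%:R <= D (h + k)%N j / (b * j.+1%:R).
    rewrite addnS ltnS => /andP[Xj jXt].
    have ji : j%:R <= i%:R :> R by apply: (@le_trans _ _ (X + t)%:R); [rewrite ler_nat | exact: between XtR beti be0i].
    have bj0 : 0 < b * j.+1%:R by rewrite mulr_gt0.
    have := IHk j kn' Xj (le_trans ji iE).
    rewrite -(@ler_pM2r _ (b * j.+1%:R)^-1) ?invr_gt0 //; apply: le_trans.
    have ej : e / (b * j.+1%:R) <= e / X%:R.
      rewrite ler_pM2l // lef_pV2 ?posrE //; apply: (@le_trans _ _ j.+1%:R).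
        by rewrite ler_nat leqW.
      by rewrite ler_peMl.
    rewrite mulrBl invfM; rewrite invfM in ej.
    set w := log_excess _ _ _ ^+ k; move: ej.
    have -> : delta * rho ^+ k * w / k`!%:R * (b^-1 * j.+1%:R^-1) =
       delta * rho ^+ k / k`!%:R / b * (w / j.+1%:R) by ring.
    by rewrite lerD2l lerN2.
  have := ler_sum_nat inner; apply: le_trans.
  rewrite sumrB -mulr_sumr sumr_const_nat addKn; apply: lerB.
    have c0 : 0 <= delta * rho ^+ k / (k.+1)`!%:R / b.
      by rewrite !mulr_ge0 ?invr_ge0 ?exprn_ge0 // ltW.
    have ulsum : rho1 * u ^+ k.+1 <= rho1 * log_excess X (- k%:R * ln beta) (X + t) ^+ k.+1.
      by rewrite ler_wpM2l // lerXn2r ?nnegrE ?log_excess_ge0 // ltW.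
    have := ler_wpM2l c0 (le_trans ulsum lsum).
    set Sg := \sum_(_ <= _ < _) _; rewrite factS natrM.
    have kS0 : k.+1%:R != 0 :> R by rewrite pnatr_eq0.
    have kf0 : k`!%:R != 0 :> R by rewrite pnatr_eq0 -lt0n fact_gt0.
    have -> : delta * rho ^+ k / (k.+1%:R * k`!%:R) / b * (k.+1%:R * Sg) =
       delta * rho ^+ k / k`!%:R / b * Sg.
      by rewrite invfM; move: kS0; move: (k.+1%:R : R) => y y0; field; rewrite y0 kf0 gt_eqF.
    apply: le_trans; rewrite /P factS natrM le_eqVlt; apply/orP; left; apply/eqP; ring.
  rewrite -[_ *+ _]mulr_natl mulrCA mulrC ler_wpM2r ?(ltW e0) // ler_pdivrMr //.
  apply: le_trans iE; apply: (@le_trans _ _ (X + t.+1)%:R); first by rewrite ler_nat leq_addl.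
  exact: le_trans XtS be0i.
rewrite TE.
have PP : (1 - 2 * eta) * P <= P by rewrite ler_piMl.
have [mneg|mpos] := ltP (P - E * e) 0.
  by apply: le_trans (D0 _ _ Xi); exact: descent errE mneg.
have := step i Xi (h + k)%N X t.+1 (P - E * e) ali XtS.
rewrite mpos SP => /(_ isT); rewrite addnS; apply: le_trans.
set m := P - E * e in mpos *.
have Cm : C * m ^+ 2 <= eta * m.
  rewrite expr2 mulrA ler_wpM2r //; apply: le_trans CP; rewrite ler_wpM2l // /m.
  by rewrite gerBl mulr_ge0 // ltW.
have Ee : (1 - 2 * eta) * (E * e) <= E * e by rewrite ler_piMl // mulr_ge0 // ltW.
have -> : (1 - 2 * eta) * P = m * (1 - 2 * eta) + (1 - 2 * eta) * (E * e).
  by rewrite /m; ring.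
exact: ascent.
Qed.

End Iteration.

Section PositiveDensity.
Context {R : realType}.

(** The ratio of consecutive terms is [y * (1 + 1 / n) ^ n], which tends to y e > 1 because
    [ln (1 + 1 / n) >= 1 / (n + 1)]; so the terms eventually grow geometrically. *)
Lemma factorial_growth (y : R) : 0 < y -> 1 < y * expR 1 ->
  exists2 n, (0 < n)%N & 2 <= (y * n%:R) ^+ n / n`!%:R.
Proof.
move=> y0 ye1; pose L := ln (y * expR 1).
have L0 : 0 < L by exact: ln_gt0.
pose a n : R := (y * n%:R) ^+ n / n`!%:R.
have a0 n : (0 < n)%N -> 0 < a n.
  by move=> n0; rewrite divr_gt0 ?exprn_gt0 ?mulr_gt0 ?ltr0n ?fact_gt0.
pose n0 := (Num.truncn (2 / L)).+1.
have growth n : (n0 <= n)%N -> expR (L / 2) * a n <= a n.+1.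
  move=> nn0; have np : (0 < n)%N by apply: leq_trans nn0.
  have nR : 0 < n%:R :> R by rewrite ltr0n.
  have nS : 0 < n.+1%:R :> R by [].
  have invn : n.+1%:R^-1 <= L / 2.
    rewrite -[leRHS]invrK lef_pV2 ?posrE ?invr_gt0 ?divr_gt0 // invfM invrK.
    rewrite mulrC; apply/ltW/(lt_le_trans (truncnS_gt _)); rewrite ler_nat.
    exact: leq_trans nn0 (leqnSn n).
  have e1 : expR (1 - n.+1%:R^-1) <= (n.+1%:R / n%:R) ^+ n :> R.
    have ratio0 : (n.+1%:R / n%:R : R) \is Num.pos by rewrite posrE divr_gt0.
    rewrite -(lnK ratio0) -expRM_natl ler_expR.
    have -> : n.+1%:R / n%:R = (1 + - n.+1%:R^-1)^-1 :> R.
      by rewrite -natr1; field; rewrite !gt_eqF //= ?addrK ?ltr_wpDl.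
    have pos : 0 < 1 + - n.+1%:R^-1 :> R by rewrite subr_gt0 invf_lt1 // ltr1n ltnS.
    rewrite lnV ?posrE //.
    have := @le_ln1Dx R (- n.+1%:R^-1); rewrite ltrN2 invf_lt1 ?ltr1n ?ltnS // => /(_ np) H.
    have : n%:R * ln (1 + - n.+1%:R^-1) <= n%:R * - n.+1%:R^-1 :> R by rewrite ler_wpM2l // ltW.
    have -> : n%:R * - n.+1%:R^-1 = n.+1%:R^-1 - 1 :> R.
      by rewrite -natr1; field; rewrite gt_eqF // ltr_wpDl.
    by rewrite mulrN -[X in _ -> X <= _]opprB lerN2.
  have -> : a n.+1 = y * (n.+1%:R / n%:R) ^+ n * a n.
    rewrite /a factS natrM !exprMn exprVn [y ^+ n.+1]exprS [n.+1%:R ^+ n.+1]exprS.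
    have f0 : n`!%:R != 0 :> R by rewrite pnatr_eq0 -lt0n fact_gt0.
    have nn : n%:R ^+ n != 0 :> R by rewrite expf_neq0 // gt_eqF.
    move: nS; move: (n.+1%:R : R) => w w0; field; rewrite f0 nn gt_eqF //.
  rewrite ler_wpM2r ?(ltW (a0 _ np)) //; apply: le_trans (ler_wpM2l (ltW y0) e1).
  rewrite -[y in leRHS]lnK ?posrE // -expRD ler_expR.
  have -> : ln y = L - 1 by rewrite /L lnM ?posrE ?expR_gt0 // expRK addrK.
  move: invn; move: (n.+1%:R^-1 : R) => w; lra.
have iter t : expR (L / 2) ^+ t * a n0 <= a (n0 + t)%N.
  elim: t => [|t IHt]; first by rewrite expr0 mul1r addn0.
  rewrite addnS exprS -mulrA; apply: le_trans (growth _ (leq_addr _ _)).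
  by rewrite ler_wpM2l // expR_ge0.
have e1 : 1 < expR (L / 2) by rewrite -expR0 ltr_expR divr_gt0.
have [t _ /(_ t (leqnn _)) /= Ht] := near_expr_ge (2 / a n0) e1.
exists (n0 + t)%N => //; apply: le_trans (iter t).
by rewrite -ler_pdivrMr // a0.
Qed.

Variables (b theta : R).
Hypotheses (b1 : 1 < b) (theta0 : 0 < theta) (theta1 : theta <= 1).
Hypothesis error0 : forall tau, 0 < tau -> \forall i \near \oo, block_error b theta i <= tau.

Lemma near_density_chain1 : \forall i \near \oo, 1 / 2 <= density b (chain_ge 1) i.
Proof.
have [N _ HN] := near_prime_density b1 error0 theta0.
exists N => // i /HN /= /le_trans; apply.
rewrite /density le_eqVlt; apply/orP; left; apply/eqP; congr (_ / _).
apply: eq_big_seq => p /(blockP b1)[pp _ _].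
by rewrite /chain_ge maxchain_gt0.
Qed.

(** Crossing the scale factor e^(n/c) in [n] steps yields at least [2 * delta] before the error, and
    the error is [delta]. So [delta] is recovered and the round can be repeated from the new scale,
    gaining [n] in the chain length each time. *)
Lemma positive_density (beta beta0 c eta rho1 : R) :
  0 < beta < beta0 -> beta0 < theta -> 0 < c -> 0 < eta <= 1 / 2 -> 0 <= rho1 < 1 ->
  1 < (1 - 2 * eta) * rho1 / b * (c^-1 + ln beta) * expR 1 ->
  exists n delta Z, [/\ (0 < n)%N, 0 < delta, 0 < Z & forall k i,
    Z * expR (n%:R / c) ^+ k <= i%:R -> delta <= density b (chain_ge (n * k).+1) i].
Proof.
move=> /andP[be0 bebe] beth c0 /andP[eta0 eta2] /andP[r0 r1] ye1.
set rho := (1 - 2 * eta) * rho1 / b in ye1.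
have b0 : 0 < b by apply: lt_trans b1.
have rho0 : 0 <= rho by rewrite divr_ge0 ?mulr_ge0 ?(ltW b0) //; lra.
set r := c^-1 + ln beta in ye1.
have rr0 : 0 < rho * r by rewrite -(pmulr_lgt0 _ (expR_gt0 1)); lra.
have rpos : 0 < r by rewrite ltNge; apply/negP => /(mulr_ge0_le0 rho0); lra.
have [n n0 ngrow] := factorial_growth rr0 ye1.
have nR : 0 < n%:R :> R by rewrite ltr0n.
pose q := expR (n%:R / c).
have q1 : 1 < q by rewrite /q expR_gt1 divr_gt0.
have q0 : 0 < q by apply: lt_trans q1.
(* The 2 allows for [X] being only the integer part of [i / q]. *)
pose E := 2 * q.
have E1 : 1 <= E by rewrite /E; lra.
have E0 : 0 < E by lra.
have lnE0 : 0 <= ln E by exact: ln_ge0.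
have al0 : 0 < E^-1 by rewrite invr_gt0.
have be00 : 0 < beta0 < theta by rewrite (lt_trans be0).
have [C C0 step] := density_one_step b1 theta1 error0 theta0 al0 be00 eta0.
have den0 : 0 < (C + 1) * (1 + ln E) ^+ n by rewrite mulr_gt0 ?exprn_gt0 //; lra.
(* 1/2 is for the first round, which starts from all primes; the other bound keeps the quadratic
   loss under control in all [n] steps. *)
pose delta := Num.min (1 / 2) (eta / ((C + 1) * (1 + ln E) ^+ n)).
have de0 : 0 < delta by by rewrite lt_min !divr_gt0.
have de1 : delta <= 1 / 2 by rewrite ge_min lexx.
have small k : (k <= n)%N -> C * (delta * (ln E) ^+ k) <= eta.
  move=> kn; have : delta <= eta / ((C + 1) * (1 + ln E) ^+ n) by rewrite ge_min lexx orbT.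
  rewrite ler_pdivlMr // => H; apply: le_trans H.
  rewrite mulrCA mulrC mulrC ler_pM2l //; apply: ler_pM => //; first exact: exprn_ge0.
    lra.
  apply: (@le_trans _ _ ((1 + ln E) ^+ k)).
    by rewrite lerXn2r ?nnegrE //; lra.
  by rewrite ler_weXn2l //; lra.
have En0 : 0 < (E + 1) ^+ n by rewrite exprn_gt0 //; lra.
(* After [n] steps the accumulated error [tau * (E + 1) ^ n] is exactly [delta]. *)
pose tau := delta / (E + 1) ^+ n.
have tau0 : 0 < tau by rewrite divr_gt0.
have [N0 _ HN0] := step tau tau0.
have [N1 _ HN1] := near_density_chain1.
have [N2 _ HN2] := near_expr_ge 2 b1.
have [N3 _ HN3] := nbhs_infty_ger ((1 + rho1) / (1 - rho1)).
have [N4 _ HN4] := nbhs_infty_ger (2 / (beta0 - beta)).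
pose N := maxn (maxn N0 N1) (maxn (maxn N2 N3) (maxn N4 2)).
have NP i : (N <= i)%N -> [/\ (N0 <= i)%N, (N1 <= i)%N, (N2 <= i)%N, (N3 <= i)%N & (N4 <= i)%N].
  by rewrite /N !geq_max => /andP[/andP[-> ->] /andP[/andP[-> ->] /andP[-> _]]].
(* The scale from which [k] rounds are available. Adding 1 before multiplying by [q] makes up for
   the integer part in [X]; solving this recursion brings the constant [q / (q - 1)] into the final
   scale. *)
pose z := fix z k : R := if k is k'.+1 then (z k' + 1) * q else N%:R.
have zN k : N%:R <= z k.
  elim: k => //= k IHk; apply: (le_trans IHk).
  have zk : 0 <= z k + 1 by rewrite addr_ge0 // (le_trans _ IHk).
  by apply: le_trans (ler_peMr zk (ltW q1)); rewrite lerDl.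
have claim k i : z k <= i%:R -> delta <= density b (chain_ge (n * k).+1) i.
  elim: k i => [|k IHk] i /= zi.
    rewrite muln0; apply: le_trans de1 _; apply: HN1 => /=.
    by rewrite ler_nat in zi; have [] := NP _ zi.
  pose X := Num.truncn (i%:R / q).
  have iq0 : 0 <= i%:R / q by rewrite divr_ge0 // ltW.
  have Xle : X%:R <= i%:R / q by rewrite truncn_le.
  have Xgt : i%:R / q < X%:R + 1 by rewrite natr1 truncnS_gt.
  have zX : z k < X%:R.
    by rewrite -(ltrD2r 1); apply: le_lt_trans Xgt; rewrite ler_pdivlMr.
  have NX : (N <= X)%N by rewrite -(ler_nat R) (le_trans (zN k)) // ltW.
  have X2 : (1 < X)%N by apply: leq_trans NX; rewrite /N !leq_max leqnn !orbT.
  have X0 : (0 < X)%N by apply: ltnW.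
  have XR : 0 < X%:R :> R by rewrite ltr0n.
  have Xi : (X <= i)%N.
    rewrite -(ler_nat R); apply: le_trans Xle _; rewrite ler_pdivrMr //.
    by apply: ler_peMr => //; exact: ltW.
  have iEX : i%:R <= E * X%:R.
    have X1 : 1 <= X%:R :> R by rewrite ler1n.
    have := ler_wpM2r (ltW q0) (ltW Xgt); rewrite divfK ?gt_eqF // => H; apply: le_trans H _.
    rewrite /E mulrAC ler_pM2r //; lra.
  have Xj j : (X <= j)%N -> (N <= j)%N by apply: leq_trans.
  have H := @iterated_density R (fun h i => density b (chain_ge h) i) E^-1 beta beta0 eta C tau b
    E delta rho1 X (n * k).+1 n X2 al0.
  have := H _ _ (ltW (lt_le_trans beth theta1)) _ C0 tau0 (ltW b1) E1 de0.
  rewrite mulVf ?gt_eqF // lexx be0 bebe eta0 eta2 r0 (ltW r1).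
  move=> /(_ isT isT isT isT) {}H.
  have {}H := H _ _ _ _ _ small n i (leqnn n) Xi iEX.
  rewrite mulnS addnC -addSn; apply: le_trans (H _ _ _ _ _) => {H}.
  - have iXq : q <= i%:R / X%:R by rewrite ler_pdivlMr // mulrC -ler_pdivlMr.
    have lnr : n%:R * r <= log_excess X (- n%:R * ln beta) i.
      rewrite /log_excess le_max; apply/orP; right.
      have iR0 : 0 < i%:R :> R by apply: (lt_le_trans XR); rewrite ler_nat.
      have : ln q <= ln (i%:R / X%:R) by rewrite ler_ln ?posrE ?divr_gt0.
      rewrite /q expRK /r; lra.
    have P2 : 2 <= rho ^+ n * log_excess X (- n%:R * ln beta) i ^+ n / n`!%:R.
      apply: le_trans ngrow _; rewrite ler_pM2r ?invr_gt0 ?ltr0n ?fact_gt0 //.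
      rewrite -mulrA exprMn ler_wpM2l ?exprn_ge0 //.
      by rewrite lerXn2r ?nnegrE ?log_excess_ge0 ?mulr_ge0 ?(ltW rpos) // mulrC.
    have := ler_wpM2l (ltW de0) P2; rewrite -/rho /tau divfK ?gt_eqF // !mulrA; lra.
  - move=> j /Xj/NP[_ _ _ /HN3 /= + _]; rewrite ler_pdivrMr ?subr_gt0 // -[j.+1%:R]natr1; lra.
  - move=> j /Xj/NP[_ _ _ _ /HN4 /=]; rewrite ler_pdivrMr ?subr_gt0 //; lra.
  - by move=> h j /Xj/NP[_ _ /HN2 /= bj _ _]; exact: density_ge0.
  - by move=> j /Xj/NP[/HN0 /= Hj _ _ _ _]; exact: Hj.
  - by move=> j Xjj; apply: IHk; rewrite (le_trans (ltW zX)) // ler_nat.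
have kap0 : 0 < q / (q - 1) by rewrite divr_gt0 // subr_gt0.
exists n, delta, (N%:R + q / (q - 1)); split => //.
  by rewrite ltr_wpDl.
move=> k i H; apply: claim; apply: le_trans H.
suff -> : z k = (N%:R + q / (q - 1)) * q ^+ k - q / (q - 1) by rewrite gerBl ltW.
elim: k => [|k IHk] /=; first by rewrite expr0 mulr1 addrK.
rewrite IHk exprS; field; rewrite subr_eq0 gt_eqF //.
Qed.

End PositiveDensity.

(** * Chains below almost all primes *)

Section AlmostAll.
Context {R : realType}.

Lemma near_ln_ge (y : R) : \forall i \near \oo, y <= ln i%:R.
Proof.
near=> i.
have H : expR y <= i%:R by near: i; exact: nbhs_infty_ger.
by rewrite -[y]expRK ler_ln ?posrE ?expR_gt0 // (lt_le_trans (expR_gt0 y)).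
Unshelve. all: by end_near. Qed.

Lemma loglog_block_le (b : R) i p : 1 < b -> (0 < i)%N -> p \in block b i ->
  0 < ln p%:R :> R /\ loglog p%:R <= ln i%:R + ln (2 * ln b).
Proof.
move=> b1 i0 /(blockP b1)[pp bp pb].
have lb := ln_gt0 b1; have b0 : 0 < b by apply: lt_trans b1.
have p1 : 1 < p%:R :> R by rewrite ltr1n prime_gt1.
have lp : 0 < ln p%:R :> R by exact: ln_gt0.
have iR : 0 < i%:R :> R by rewrite ltr0n.
split => //; rewrite -lnM ?posrE ?mulr_gt0 // ler_ln ?posrE ?mulr_gt0 //.
apply: (@le_trans _ _ (ln (b ^+ i.+1))).
  by rewrite ler_ln ?posrE ?exprn_gt0 // (lt_trans _ p1).
rewrite lnXn // -[_ *+ _]mulr_natl mulrA ler_pM2r // -natr1 mulrC.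
have : 1 <= i%:R :> R by rewrite ler1n.
lra.
Qed.

Section FixedBase.
Variables (b theta : R).
Hypotheses (b1 : 1 < b) (theta0 : 0 < theta) (theta1 : theta <= 1).
Hypothesis error0 : forall tau, 0 < tau -> \forall i \near \oo, block_error b theta i <= tau.

(** With density [delta] at all scales from [i / A] to [i / B], the primes ending long chains have
    mass about [(delta / b) * ln (A / B)], unbounded in [A] although [delta] is fixed. Turan's
    method then reaches all but a share [eps] of the block. The gap between [c] and [c1] absorbs all
    additive constants. *)
Lemma almost_all_blocks (c c1 delta Z : R) n :
  0 < c < c1 -> (0 < n)%N -> 0 < delta -> 0 < Z ->
  (forall k i, Z * expR (n%:R / c1) ^+ k <= i%:R ->
     delta <= density b (chain_ge (n * k).+1) i) ->
  forall eps, 0 < eps -> \forall i \near \oo,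
    \sum_(p <- block b i) (~~ long_chain c p)%:R <= eps * block_mass b i.
Proof.
move=> /andP[c0 cc1] n0 de0 Z0 dens eps eps0.
have aux1 (u v : R) : u <= v -> 2 <= v -> u + 1 <= 2 * v by lra.
have aux3 (u v w t m nk : R) : c * w + c1 * t + m <= v * (c1 - c) -> c1 * u < nk + m ->
    c1 * (v - t) <= c1 * u -> c * (v + w) < nk + 1 + 1 by lra.
have aux4 (u v : R) : u <= eps / 2 -> v <= eps / 2 -> u + v <= eps by lra.
have aux2 (u v : R) : v - 1 < u -> 2 <= v -> v / 2 <= u by lra.
have lb := ln_gt0 b1; have b0 : 0 < b by apply: lt_trans b1.
have c10 : 0 < c1 by apply: lt_trans cc1.
have nR : 0 < n%:R :> R by rewrite ltr0n.
pose B := (Num.truncn (2 / theta)).+1.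
have Bge : 2 / theta <= B%:R by exact/ltW/truncnS_gt.
have B0 : (0 < B)%N by [].
have BR : 0 < B%:R :> R by rewrite ltr0n.
pose M := 1 + 2 / eps.
have eps2 : 0 < 2 / eps by rewrite divr_gt0.
have M0 : 0 < M by rewrite /M; lra.
have M1 : 1 <= M by rewrite /M; lra.
have M2 : 2 / eps <= M by rewrite /M; lra.
pose A := (Num.truncn (2 * B%:R * expR (b / delta * M))).+1.
have Age : 2 * B%:R * expR (b / delta * M) <= A%:R by exact/ltW/truncnS_gt.
have A0 : (0 < A)%N by [].
have AR : 0 < A%:R :> R by rewrite ltr0n.
have AB : (B <= A)%N.
  rewrite -(ler_nat R); apply: le_trans Age.
  have e1 : 1 <= expR (b / delta * M) by rewrite -expR0 ler_expR mulr_ge0 ?divr_ge0 // ltW.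
  have := ler_wpM2l (ltW BR) e1; lra.
pose K := (2 * A)%N.
have K0 : (0 < K)%N by rewrite muln_gt0.
have [N1 _ HN1] := near_expr_ge 2 b1.
have [N2 _ HN2] := nbhs_infty_ger Z.
have [N3 _ HN3] := near_ln_ge
  ((c * ln (2 * ln b) + c1 * ln (2 * A%:R * Z) + n%:R) / (c1 - c)).
near=> i.
have iN1 : (N1 <= i %/ A)%N by near: i; exact: near_divn.
have iN2 : (N2 <= i %/ A)%N by near: i; exact: near_divn.
have iN3 : (N3 <= i)%N by near: i; exact: nbhs_infty_ge.
have i2A : (2 * A <= i)%N by near: i; exact: nbhs_infty_ge.
have i0 : (0 < i)%N by apply: leq_trans i2A; rewrite muln_gt0.
have iR : 0 < i%:R :> R by rewrite ltr0n.
have bj : 2 <= b ^+ (i %/ A) by exact: HN1.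
have bi : 2 <= b ^+ i by apply: le_trans bj _; rewrite ler_weXn2l ?leq_div // ltW.
set j := (i %/ A)%N in iN1 iN2 bj.
have Zj : Z <= j%:R by exact: HN2.
have jR : 0 < j%:R :> R by apply: lt_le_trans Zj.
(* The largest number of rounds whose density bound is available from scale [j] on. *)
pose k := Num.truncn (c1 / n%:R * ln (j%:R / Z)).
have lnj0 : 0 <= ln (j%:R / Z) by rewrite ln_ge0 // ler_pdivlMr // mul1r.
have kle : k%:R <= c1 / n%:R * ln (j%:R / Z).
  by rewrite truncn_le mulr_ge0 // divr_ge0 // ltW.
have kgt : c1 / n%:R * ln (j%:R / Z) < k%:R + 1 by rewrite natr1 truncnS_gt.
have Zq : Z * expR (n%:R / c1) ^+ k <= j%:R.
  rewrite mulrC -ler_pdivlMr // -expRM_natl -[leRHS]lnK ?posrE ?divr_gt0 // ler_expR.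
  have nc : 0 < n%:R / c1 by rewrite divr_gt0.
  apply: le_trans (ler_wpM2r (ltW nc) kle) _.
  rewrite le_eqVlt; apply/orP; left; apply/eqP.
  by move: (ln _) => v; field; rewrite !gt_eqF.
have iK : (i < K.+1 * j)%N.
  have := ltn_ceil i A0; rewrite -/j => iA'.
  have j0 : (0 < j)%N by rewrite -(ltr_nat R).
  apply: leq_trans iA' _; apply: (@leq_trans (2 * j * A)%N).
    by rewrite leq_mul2r ltn_Pmull ?orbT.
  by rewrite /K [leqRHS]mulSn mulnAC leq_addl.
have iABn : (j <= i %/ B)%N by exact: leq_div2l.
have jn : (j + (i %/ B - j) = i %/ B)%N by rewrite subnKC.
have total : (2 * (j + (i %/ B - j)))%:R <= theta * i.+1%:R.
  rewrite jn natrM; apply: (@le_trans _ _ (2 * (i%:R / B%:R))).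
    by rewrite ler_pM2l // divn_le_real.
  apply: (@le_trans _ _ (theta * i%:R)); last by rewrite ler_pM2l // ler_nat.
  rewrite mulrCA mulrC ler_pM2r // ler_pdivrMr // mulrC -ler_pdivrMr //.
have muge : M <= inv_totient_sum (window b (chain_ge (n * k).+1) j (i %/ B - j)).
  apply: le_trans (inv_totient_window b1 _ _ bj).
  apply: (@le_trans _ _ (\sum_(j <= l < j + (i %/ B - j)) (delta / b) * l.+1%:R^-1)).
    rewrite -mulr_sumr -ler_pdivrMl ?divr_gt0 // invfM invrK.
    apply: le_trans (harmonic_window _ _); rewrite jn [X in X * _ <= _]mulrC.
    rewrite -[leLHS]expRK ler_ln ?posrE ?expR_gt0 ?divr_gt0 //.
    rewrite ler_pdivlMr // -[(i %/ B).+1%:R]natr1 -[j.+1%:R]natr1.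
    have iBgt := divn_gt_real (R := R) i B0.
    have iAle := divn_le_real (R := R) i A0.
    have y2 : 2 <= i%:R / A%:R :> R by rewrite ler_pdivlMr // -natrM ler_nat.
    apply: (@le_trans _ _ (i%:R / B%:R)); last by rewrite -lerBlDr ltW.
    rewrite ler_pdivlMr //.
    apply: (@le_trans _ _ (expR (b / delta * M) * (2 * (i%:R / A%:R)) * B%:R)).
      rewrite ler_pM2r // ler_pM2l ?expR_gt0 //.
      exact: aux1 iAle y2.
    have -> : expR (b / delta * M) * (2 * (i%:R / A%:R)) * B%:R =
        i%:R * (2 * B%:R * expR (b / delta * M) / A%:R) by ring.
    by rewrite ler_piMr ?(ltW iR) // ler_pdivrMr // mul1r.
  apply: ler_sum_nat => l /andP[jl _].
  have dl : delta <= density b (chain_ge (n * k).+1) l.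
    by apply: dens; apply: le_trans Zq _; rewrite ler_nat.
  by rewrite [(b * _)^-1]invfM mulrA ler_wpM2r ?invr_ge0 // ler_wpM2r ?invr_ge0 // ltW.
have mu1 : 1 <= inv_totient_sum (window b (chain_ge (n * k).+1) j (i %/ B - j)) :> R.
  exact: le_trans M1 muge.
apply: (@le_trans _ _ (\sum_(p <- block b i) (~~ chain_ge (n * k).+2 p)%:R)).
  rewrite big_seq [leRHS]big_seq; apply: ler_sum => p pB.
  have [lp0 llp] := loglog_block_le b1 i0 pB.
  rewrite ler_nat; case: (boolP (chain_ge _ p)) => [hp|_]; last exact: leq_b1.
  suff -> : long_chain c p by [].
  rewrite /long_chain; apply: lt_le_trans (_ : (n * k).+2%:R <= _); last by rewrite ler_nat.
  apply: le_lt_trans (ler_wpM2l (ltW c0) llp) _.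
  have H3 := HN3 _ iN3; rewrite /= ler_pdivrMr ?subr_gt0 // in H3.
  have jge : i%:R / (2 * A%:R) <= j%:R :> R.
    have v2 : 2 <= i%:R / A%:R :> R by rewrite ler_pdivlMr // -natrM ler_nat.
    have := aux2 _ _ (divn_gt_real i A0) v2.
    by rewrite [(2 * A%:R)^-1]invfM mulrA mulrAC.
  have lnjZ : ln i%:R - ln (2 * A%:R * Z) <= ln (j%:R / Z).
    rewrite -ln_div ?posrE ?mulr_gt0 // ler_ln ?posrE ?divr_gt0 ?mulr_gt0 //.
    by rewrite invfM mulrA ler_pM2r ?invr_gt0.
  have kn : c1 * ln (j%:R / Z) < n%:R * k%:R + n%:R.
    have := kgt; rewrite -(ltr_pM2l nR) => H.
    have -> : n%:R * k%:R + n%:R = n%:R * (k%:R + 1) :> R by ring.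
    by apply: le_lt_trans H; rewrite mulrA [n%:R * _]mulrC divfK ?gt_eqF.
  have := ler_wpM2l (ltW c10) lnjZ.
  rewrite -[(n * k).+2%:R]natr1 -[(n * k).+1%:R]natr1 natrM.
  exact: aux3 H3 kn.
apply: le_trans (density_turan b1 theta1 bi K0 iK total mu1) _.
rewrite mulrC ler_wpM2r ?(ltW (block_mass_gt0 _ _)) //.
have err : 4 * K%:R ^+ 3 * block_error b theta i <= eps / 2.
  rewrite -ler_pdivlMl ?mulr_gt0 ?exprn_gt0 ?ltr0n //.
  near: i; apply: error0; rewrite mulr_gt0 ?divr_gt0 // invr_gt0 mulr_gt0 ?exprn_gt0 ?ltr0n //.
have mueta : (inv_totient_sum (window b (chain_ge (n * k).+1) j (i %/ B - j)))^-1 <= eps / 2.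
  rewrite -[leRHS]invrK lef_pV2 ?posrE ?invr_gt0 ?divr_gt0 //; last by apply: lt_le_trans mu1.
  by rewrite invfM invrK mulrC; exact: le_trans M2 muge.
exact: aux4.
Unshelve. all: by end_near. Qed.

End FixedBase.
End AlmostAll.

(** * From the estimate to blocks, and from blocks to counts up to x *)

Section FromBlocks.
Context {R : realType}.
Implicit Types (b theta : R).

Lemma block_error_le b theta i (D : R) : 1 < b -> 2 <= b ^+ i ->
  `|discrepancy_sum (fun t => t `^ theta) (b ^+ i.+1)| <= D ->
  block_error b theta i <= 2 * D * i.+1%:R / b ^+ i.
Proof.
move=> b1 bi HD; have W0 := block_mass_gt0 b1 bi.
have b0 : 0 < b by apply: lt_trans b1.
have D0 : 0 <= D by apply: le_trans HD.
rewrite /block_error ler_pdivrMr //.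
apply: (@le_trans _ _ (2 * D)); first by rewrite ler_pM2l // (le_trans (ler_norm _)).
have := block_mass_ge b1 bi; rewrite ler_pdivrMr // => H.
rewrite -!mulrA -[leLHS]mulr1 -mulrA ler_wpM2l // ler_wpM2l //.
rewrite mulrC -mulrA ler_pdivlMl ?exprn_gt0 // mulr1.
exact: H.
Qed.

Lemma block_error_to0 theta (B : R -> R) b : 1 < b ->
  B =o_infty (fun x : R => x / ln x) ->
  discrepancy_estimate (fun x : R => x `^ theta) B ->
  forall tau, 0 < tau -> \forall i \near \oo, block_error b theta i <= tau.
Proof.
move=> b1 /eqoP Bo /eqOP [k0 [_ dO]] tau tau0.
have lb := ln_gt0 b1; have b0 : 0 < b by apply: lt_trans b1.
pose k := Num.max (k0 + 1) 1.
have kk0 : k0 < k by rewrite lt_max ltrDl ltr01.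
have kp : 0 < k by rewrite lt_max ltr01 orbT.
have [x1 [_ H1]] := dO _ kk0.
have e0 : 0 < tau * ln b / (2 * k * b) by rewrite !divr_gt0 ?mulr_gt0.
have [x2 [_ H2]] := Bo _ e0.
have [N1 _ HN1] := near_expr_ge 2 b1.
have [N2 _ HN2] := near_expr_ge (x1 + 1) b1.
have [N3 _ HN3] := near_expr_ge (x2 + 1) b1.
near=> i.
have bi : 2 <= b ^+ i by apply: HN1; near: i; exact: nbhs_infty_ge.
have bi1 : x1 < b ^+ i.+1.
  have : x1 + 1 <= b ^+ i by apply: HN2; near: i; exact: nbhs_infty_ge.
  have : b ^+ i <= b ^+ i.+1 by rewrite ler_weXn2l // ltW.
  lra.
have bi2 : x2 < b ^+ i.+1.
  have : x2 + 1 <= b ^+ i by apply: HN3; near: i; exact: nbhs_infty_ge.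
  have : b ^+ i <= b ^+ i.+1 by rewrite ler_weXn2l // ltW.
  lra.
have G1 := H1 _ bi1; have G2 := H2 _ bi2.
have bX := exprn_gt0 i b0.
have lbi : ln (b ^+ i.+1) = i.+1%:R * ln b by rewrite lnXn // mulr_natl.
have {}G2 : `|B (b ^+ i.+1)| <= tau / (2 * k) * (b ^+ i / i.+1%:R).
  apply: le_trans G2 _; rewrite ger0_norm; last by rewrite divr_ge0 ?lbi ?mulr_ge0 ?exprn_ge0 ?ltW.
  rewrite lbi exprS le_eqVlt; apply/orP; left; apply/eqP.
  have : i.+1%:R != 0 :> R by rewrite pnatr_eq0.
  move: (i.+1%:R : R) (b ^+ i) => u v u0; field.
  by rewrite u0 !gt_eqF.
apply: le_trans (block_error_le b1 bi (le_trans G1 (ler_wpM2l (ltW kp) G2))) _.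
move: bX; move: (b ^+ i) => u u0.
have : 0 < i.+1%:R :> R by [].
move: (i.+1%:R : R) => v v0.
by rewrite le_eqVlt; apply/orP; left; apply/eqP; field; rewrite !gt_eqF.
Unshelve. all: by end_near. Qed.

(** Dividing by the block mass, at least [b ^ i / (i + 1)], loses one power of [i]; hence the
    exponent [1 - A]. *)
Lemma block_error_power theta b (A : R) : 1 < b ->
  discrepancy_estimate (fun x : R => x `^ theta) (fun x => x * ln x `^ (- A)) ->
  exists2 C, 0 < C & \forall i \near \oo,
    block_error b theta i <= C * i.+1%:R `^ (1 - A).
Proof.
move=> b1 /eqOP [k0 [_ dO]].
have lb := ln_gt0 b1; have b0 : 0 < b by apply: lt_trans b1.
pose k := Num.max (k0 + 1) 1.
have kk0 : k0 < k by rewrite lt_max ltrDl ltr01.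
have kp : 0 < k by rewrite lt_max ltr01 orbT.
have [x1 [_ H1]] := dO _ kk0.
exists (2 * k * b * ln b `^ (- A)); first by rewrite !mulr_gt0 // powR_gt0.
near=> i.
have bi : 2 <= b ^+ i by near: i; exact: near_expr_ge.
have bi1 : x1 < b ^+ i.+1.
  have : x1 + 1 <= b ^+ i by near: i; exact: near_expr_ge.
  have : b ^+ i <= b ^+ i.+1 by rewrite ler_weXn2l // ltW.
  lra.
have G1 := H1 _ bi1.
have bX := exprn_gt0 i b0.
have iS : 0 < i.+1%:R :> R by [].
rewrite [X in _ <= _ * X]ger0_norm in G1; last by rewrite mulr_ge0 ?powR_ge0 ?exprn_ge0 // ltW.
apply: le_trans (block_error_le b1 bi G1) _.
rewrite lnXn // -[ln b *+ _]mulr_natl powRM ?(ltW lb) // powRD; last by rewrite pnatr_eq0 implybT.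
rewrite powRr1 // le_eqVlt; apply/orP; left; apply/eqP.
rewrite exprS; move: (i.+1%:R `^ (- A)) (ln b `^ (- A)) (i.+1%:R : R) => u v w.
by move: bX; move: (b ^+ i) => x x0; field; rewrite gt_eqF.
Unshelve. all: by end_near. Qed.

(** The integral is split at the square root of [y]: below it the integrand is at most [1 / ln 2],
    above it at most [2 / ln y]. *)
Lemma li_le (y : R) : 4 <= y -> li y <= li 2 + (2 / ln 2 + 2) * (y / ln y).
Proof.
move=> y4; pose s := Num.sqrt y.
have yE : y = s ^+ 2 by rewrite sqr_sqrtr //; lra.
have s2 : 2 <= s.
  rewrite -(@ler_pXn2r _ 2) ?nnegrE ?sqrtr_ge0 // -yE; lra.
have sy : s <= y by rewrite yE expr2 ler_peMl //; lra.
have /andP[_ H1] := li_diff_bounds (lexx 2) s2.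
have /andP[_ H2] := li_diff_bounds s2 sy.
have l2 := @ln2_gt0 R.
have ls : 0 < ln s by apply: ln_gt0; lra.
have lss : ln s < s by apply: ln_sublinear; lra.
have lyE : ln y = 2 * ln s by rewrite yE lnXn ?mulr_natl //; lra.
have H3 : (s - 2) / ln 2 <= 2 / ln 2 * (y / ln y).
  rewrite mulrAC ler_pM2r ?invr_gt0 //.
  apply: (@le_trans _ _ s); first lra.
  rewrite mulrA ler_pdivlMr lyE ?mulr_gt0 // yE.
  have : s * ln s <= s * s by rewrite ler_pM2l; lra.
  rewrite expr2; lra.
have H4 : (y - s) / ln s <= 2 * (y / ln y).
  have -> : 2 * (y / ln y) = y / ln s by rewrite lyE; field; lra.
  by rewrite ler_pM2r ?invr_gt0 //; lra.
rewrite mulrDl; move: H1 H2 H3 H4.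
move: ((s - 2) / ln 2) ((y - s) / ln s) (2 / ln 2 * (y / ln y)) (2 * (y / ln y)) => u v w t.
lra.
Qed.

Lemma prime_count_blocks b (P : pred nat) I m : 1 < b -> (I <= m)%N ->
  (prime_count P (b ^+ m))%:R = (prime_count P (b ^+ I))%:R +
    \sum_(I <= i < m) \sum_(p <- block b i) (P p)%:R :> R.
Proof.
move=> b1 /subnKC <-; have b0 : 0 < b by apply: lt_trans b1.
have pcE x : (prime_count P x)%:R =
   \sum_(0 <= p < (Num.truncn x).+1 | prime p) (P p)%:R :> R.
  by rewrite /prime_count natr_sum big_mkcondr /=; apply: eq_bigr => p _; case: (P p).
elim: (m - I)%N => [|n IHn]; first by rewrite addn0 big_geq // addr0.
rewrite addnS big_nat_recr ?leq_addr //= addrA -IHn /block primes_between_sum.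
- by rewrite !pcE addrC subrK.
- exact/ltW/exprn_gt0.
- by rewrite ler_weXn2l // ltW.
Qed.

Lemma prime_count_mono (P : pred nat) (x y : R) : x <= y ->
  (prime_count P x <= prime_count P y)%N.
Proof.
move=> xy; rewrite /prime_count (@big_cat_nat _ _ _ (Num.truncn x).+1 0 (Num.truncn y).+1) //=.
  exact: leq_addr.
by rewrite ltnS le_truncn.
Qed.

Lemma block_index b (x : R) : 1 < b -> 1 <= x ->
  exists m, b ^+ m <= x < b ^+ m.+1.
Proof.
move=> b1 x1; have lb := ln_gt0 b1; have b0 : 0 < b by apply: lt_trans b1.
have x0 : 0 < x by apply: lt_le_trans x1.
exists (Num.truncn (ln x / ln b)).
have q0 : 0 <= ln x / ln b by rewrite divr_ge0 ?ln_ge0 // ltW.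
have H1 := truncn_le (ln x / ln b); rewrite q0 in H1.
have H2 := truncnS_gt (ln x / ln b).
rewrite -ler_ln ?posrE ?exprn_gt0 // -ltr_ln ?posrE ?exprn_gt0 // !lnXn //.
rewrite -[_ *+ _.+1]mulr_natl -[X in X <= _]mulr_natl.
by rewrite -ler_pdivlMr // H1 -ltr_pdivrMr.
Qed.

Lemma almost_all_of_blocks b (P : pred nat) : 1 < b ->
  (forall eps, 0 < eps -> \forall i \near \oo,
    \sum_(p <- block b i) (~~ P p)%:R <= eps * block_mass b i) ->
  almost_all_primes (R := R) P.
Proof.
move=> b1 bad; have b0 : 0 < b by apply: lt_trans b1.
apply/eqoP => eps eps0.
have l2 := @ln2_gt0 R.
pose C : R := 2 / ln 2 + 2.
have C0 : 0 < C by rewrite addr_gt0 // divr_gt0.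
have e0 : 0 < eps / (2 * C * b) by rewrite divr_gt0 ?mulr_gt0.
have [N1 _ HN1] := bad _ e0.
have [N2 _ HN2] := near_expr_ge 4 b1.
pose I := maxn N1 N2.
have bI : 4 <= b ^+ I by apply: HN2; exact: leq_maxr.
(* Collects what does not grow with [x]: the primes up to [b ^ I], about which nothing is known, and
   the share of [li 2]. *)
pose D : R := (prime_count (fun p => ~~ P p) (b ^+ I))%:R + eps / (2 * C * b) * li 2.
have D0 : 0 <= D by apply: addr_ge0 => //; apply: mulr_ge0; [exact: ltW|exact: li_ge0].
(* [x / ln x] is at least half the square root of [x], so beyond [(4 * D / eps) ^ 2] the constant
   [D] takes at most half of the allowed amount. *)
exists (b ^+ I + (4 * D / eps) ^+ 2 + 4); split; first exact: num_real.
move=> x xbig.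
have bI0 := exprn_gt0 I b0.
have sq0 : 0 <= (4 * D / eps) ^+ 2 by exact: sqr_ge0.
have x4 : 4 < x by lra.
have xI : b ^+ I <= x by lra.
have [m /andP[mx xm]] := block_index b1 (ltac:(lra) : 1 <= x).
have Im : (I <= m.+1)%N.
  rewrite leqNgt; apply/negP => mI; move: xm; rewrite ltNge => /negP; apply.
  by apply: le_trans xI; rewrite ler_weXn2l ?(ltW b1) // ltnW.
have bm4 : 4 <= b ^+ m.+1 by lra.
have lx : 0 < ln x by apply: ln_gt0; lra.
have g0 : 0 < x / ln x by rewrite divr_gt0 //; lra.
rewrite ger0_norm // ger0_norm ?(ltW g0) //.
apply: (@le_trans _ _ (prime_count (fun p => ~~ P p) (b ^+ m.+1))%:R).
  by rewrite ler_nat prime_count_mono // ltW.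
rewrite (prime_count_blocks _ b1 Im).
apply: (@le_trans _ _ (D + eps / (2 * C * b) * (C * (b ^+ m.+1 / ln (b ^+ m.+1))))).
  rewrite /D -addrA lerD2l.
  apply: (@le_trans _ _ (\sum_(I <= i < m.+1) eps / (2 * C * b) * block_mass b i)).
    by apply: ler_sum_nat => i /andP[Ii _]; apply: HN1; apply: leq_trans Ii; exact: leq_maxl.
  rewrite -mulr_sumr -mulrDr ler_pM2l //.
  rewrite telescope_sumr //; apply: le_trans (li_le bm4).
  by rewrite gerBl li_ge0.
have half1 : eps / (2 * C * b) * (C * (b ^+ m.+1 / ln (b ^+ m.+1))) <= eps / 2 * (x / ln x).
  have yb : b ^+ m.+1 / ln (b ^+ m.+1) <= b * (x / ln x).
    rewrite mulrA; apply: ler_pM.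
    - exact/ltW/exprn_gt0.
    - by rewrite invr_ge0 ln_ge0 //; lra.
    - by rewrite exprS ler_pM2l.
    - rewrite lef_pV2 ?posrE ?ln_gt0 //; try lra.
      by rewrite ler_ln ?posrE; lra.
  have := ler_wpM2l (ltW e0) (ler_wpM2l (ltW C0) yb).
  have -> // : eps / (2 * C * b) * (C * (b * (x / ln x))) = eps / 2 * (x / ln x).
  by field; rewrite !gt_eqF.
have half2 : D <= eps / 2 * (x / ln x).
  pose s := Num.sqrt x.
  have xE : x = s ^+ 2 by rewrite sqr_sqrtr //; lra.
  have s0 : 0 < s by rewrite sqrtr_gt0; lra.
  have lss : ln s < s by apply: ln_sublinear.
  have lxE : ln x = 2 * ln s by rewrite xE lnXn ?mulr_natl.
  have ls0 : 0 < ln s by lra.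
  have sD : 4 * D / eps <= s.
    rewrite -(@ler_pXn2r _ 2) ?nnegrE ?(ltW s0) ?divr_ge0 ?mulr_ge0 ?(ltW eps0) //.
    rewrite -xE; lra.
  have : s / 2 <= x / ln x.
    rewrite ler_pdivlMr // lxE xE expr2.
    have : s * ln s <= s * s by rewrite ler_pM2l // ltW.
    lra.
  move=> H; apply: le_trans (ler_wpM2l _ H); last by rewrite divr_ge0 // ltW.
  move: sD; rewrite ler_pdivrMr //; lra.
apply: le_trans (lerD half2 half1) _.
lra.
Qed.

End FromBlocks.

(** * Many primes with long chains *)

Section ManyPrimes.
Context {R : realType}.
Variables (b theta lambda : R).
Hypotheses (b1 : 1 < b) (theta1 : theta <= 1) (lambda1 : 1 < lambda).
Hypothesis (lambda_theta : lambda^-1 < theta).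
Hypothesis error_power : forall A, 1 < A -> exists2 C, 0 < C &
  \forall i \near \oo, block_error b theta i <= C * i.+1%:R `^ (1 - A).

Let theta0 : 0 < theta.
Proof. by apply: lt_trans lambda_theta; rewrite invr_gt0 (lt_trans _ lambda1). Qed.

Let error0 tau : 0 < tau -> \forall i \near \oo, block_error b theta i <= tau.
Proof.
move=> tau0; have [C C0 [N _ HN]] := error_power (ltr1n R 2).
near=> i; have /HN /= : (N <= i)%N by near: i; exact: nbhs_infty_ge.
move=> /le_trans; apply; have -> : 1 - 2 = -1 :> R by ring.
rewrite powRN powRr1 // ler_pdivrMr //.
have : C / tau <= i%:R by near: i; exact: nbhs_infty_ger.
rewrite ler_pdivrMr // mulrC => /le_trans; apply.
by rewrite ler_pM2l // ler_nat.
Unshelve. all: by end_near. Qed.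

(** The window from [i / lambda] to [theta * i] has at least [2 * kap * i] blocks, each contributing
    at least [gamma ^ h / (2 * b * i)]; dividing by [K] leaves [2 * gamma ^ (h + 1)], of which
    [gamma ^ (h + 1) / 2] may go to the error. *)
Lemma power_density : exists gamma X0, [/\ 0 < gamma < 1, 1 <= X0 &
  forall h i, X0 * lambda ^+ h <= i%:R -> gamma ^+ h / 2 <= density b (chain_ge h.+1) i].
Proof.
have b0 : 0 < b by apply: lt_trans b1.
have aux (g : R) : 0 < g -> g / 2 <= 2 * g - g / 2 by lra.
have l0 : 0 < lambda by apply: lt_trans lambda1.
have ll := ln_gt0 lambda1.
pose K := (Num.truncn lambda).+1.
have KR : 0 < K%:R :> R by rewrite ltr0n.
have K1 : 1 <= K%:R :> R by rewrite ler1n.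
have lK : lambda < K%:R by exact: truncnS_gt.
have il0 : 0 < lambda^-1 by rewrite invr_gt0.
have d0 : 0 < theta - lambda^-1 by rewrite subr_gt0.
pose kap := (theta - lambda^-1) / 4.
have kap0 : 0 < kap by rewrite /kap; lra.
have kap1 : kap < 1 by rewrite /kap; move: theta1; lra.
have bK0 : 0 < 2 * b * K%:R by rewrite !mulr_gt0.
have bK1 : 1 <= 2 * b * K%:R.
  have : 1 * 1 <= b * K%:R by rewrite ler_pM // ltW.
  lra.
pose gamma := kap / (2 * b * K%:R).
have ga0 : 0 < gamma by rewrite divr_gt0.
have ga1 : gamma < 1 by rewrite ltr_pdivrMr // mul1r (lt_le_trans kap1).
have lga : ln gamma < 0 by apply: ln_lt0; rewrite ga0.
(* At scales [i >= X0 * lambda ^ h] this exponent gives [i ^ (- a) <= gamma ^ h / X0], so the error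
   keeps pace with the main term. The summand 1 supplies the factor [1 / X0], which beats the
   constants. *)
pose a := 1 - ln gamma / ln lambda.
have a1 : 1 <= a by rewrite /a lerBrDr gerDl ler_pdivrMr // mul0r ltW.
have al : - ln gamma <= a * ln lambda.
  by rewrite /a mulrBl mul1r divfK ?gt_eqF // lerDr ltW.
have A1 : 1 < 1 + a by rewrite ltrDl (lt_le_trans ltr01).
have [C C0 [N1 _ HN1]] := error_power A1.
have [N2 _ HN2] := near_density_chain1 b1 theta0 error0.
have [N3 _ HN3] := near_expr_ge 2 b1.
have [N4 _ HN4] := nbhs_infty_ger (4 / (theta - lambda^-1)).
pose N := maxn (maxn N1 N2) (maxn N3 N4).
(* The summands serve in turn for [1 <= X0], the constant of the error term, the thresholds at [i],
   and the threshold [N3] at the start [i / lambda] of the window. *)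
pose X0 : R := 1 + 2 * K%:R ^+ 2 * C + N%:R + lambda * N3%:R.
have XN : N%:R <= X0.
  have : 0 <= 2 * K%:R ^+ 2 * C by rewrite !mulr_ge0 ?exprn_ge0 // ltW.
  have : 0 <= lambda * N3%:R by rewrite mulr_ge0 // ltW.
  rewrite /X0; lra.
have X1 : 1 <= X0.
  have : 0 <= 2 * K%:R ^+ 2 * C by rewrite !mulr_ge0 ?exprn_ge0 // ltW.
  have : 0 <= lambda * N3%:R by rewrite mulr_ge0 // ltW.
  have : 0 <= N%:R :> R by [].
  rewrite /X0; lra.
have XC : 2 * K%:R ^+ 2 * C <= X0.
  have : 0 <= lambda * N3%:R by rewrite mulr_ge0 // ltW.
  have : 0 <= N%:R :> R by [].
  rewrite /X0; lra.
have X3 : lambda * N3%:R <= X0.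
  have : 0 <= 2 * K%:R ^+ 2 * C by rewrite !mulr_ge0 ?exprn_ge0 // ltW.
  have : 0 <= N%:R :> R by [].
  rewrite /X0; lra.
have X00 : 0 < X0 by apply: lt_le_trans X1.
have large i : X0 <= i%:R -> [/\ (N1 <= i)%N, (N2 <= i)%N, (N3 <= i)%N & (N4 <= i)%N].
  move=> /(le_trans XN); rewrite ler_nat => Ni.
  by move: Ni; rewrite /N !geq_max => /andP[/andP[-> ->] /andP[-> ->]].
clearbody X0; exists gamma, X0; split; rewrite ?ga0 //.
elim=> [|h IHh] i iX.
  rewrite expr0; apply: HN2; rewrite expr0 mulr1 in iX.
  by have [] := large _ iX.
have lh1 : 1 <= lambda ^+ h.+1 by rewrite exprn_ege1 // ltW.
have iX0 : X0 <= i%:R by apply: le_trans iX; rewrite ler_peMr // ltW.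
have [iN1 iN2 iN3 iN4] := large _ iX0.
have iR : 0 < i%:R :> R by apply: lt_le_trans iX0.
have bi : 2 <= b ^+ i by exact: HN3.
pose j := (Num.truncn (i%:R / lambda)).+1.
pose J := Num.truncn (theta * i%:R).
have jgt : i%:R / lambda < j%:R by exact: truncnS_gt.
have jle : j%:R <= i%:R / lambda + 1.
  by rewrite /j -natr1 lerD2r truncn_le divr_ge0 // ltW.
have Jle : J%:R <= theta * i%:R by rewrite truncn_le mulr_ge0 // ltW.
have Jgt : theta * i%:R - 1 < J%:R by rewrite ltrBlDr natr1 truncnS_gt.
have gap : 2 * kap * i%:R <= J%:R - j%:R.
  have := HN4 _ iN4; rewrite /= ler_pdivrMr // mulrBr => H.
  have H' : (theta - lambda^-1) * i%:R / 2 <= theta * i%:R - i%:R / lambda - 2.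
    rewrite mulrBl [lambda^-1 * _]mulrC; rewrite [i%:R * theta]mulrC in H.
    by move: H; move: (theta * i%:R) (i%:R / lambda) => u v; lra.
  have -> : 2 * kap * i%:R = (theta - lambda^-1) * i%:R / 2 by rewrite /kap; field; rewrite gt_eqF.
  apply: le_trans H' _; rewrite (_ : _ - 2 = theta * i%:R - 1 - (i%:R / lambda + 1)); last by ring.
  by apply: lerB => //; exact: ltW.
have jJ : (j <= J)%N.
  by rewrite -(ler_nat R) -subr_ge0 (le_trans _ gap) // !mulr_ge0 ?ltW.
have jn : (j + (J - j) = J)%N by rewrite subnKC.
have iK : (i < K.+1 * j)%N.
  rewrite -(ltr_nat R) natrM; move: jgt; rewrite ltr_pdivrMr // => /lt_le_trans; apply.
  by rewrite mulrC ler_wpM2r // (le_trans (ltW lK)) // ler_nat.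
have jX : X0 * lambda ^+ h <= j%:R.
  apply: le_trans (ltW jgt); rewrite ler_pdivlMr //; apply: le_trans iX.
  by rewrite exprSr mulrA.
have bj : 2 <= b ^+ j.
  apply: HN3 => /=; rewrite -(ler_nat R); apply: le_trans (ltW jgt).
  by rewrite ler_pdivlMr // mulrC (le_trans X3).
have total : (j + (J - j))%:R <= theta * i.+1%:R.
  by rewrite jn (le_trans Jle) // ler_pM2l // ler_nat.
apply: le_trans (density_first_moment b1 theta1 h.+1 bi (isT : (0 < K)%N) iK total).
have sumge : kap * gamma ^+ h / b <= inv_totient_sum (window b (chain_ge h.+1) j (J - j)).
  apply: le_trans (inv_totient_window b1 _ _ bj).
  apply: (@le_trans _ _ (\sum_(j <= k < j + (J - j)) gamma ^+ h / 2 / (b * i%:R))).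
    rewrite sumr_const_nat addKn -[leRHS]mulr_natl natrB //.
    have c0 : 0 <= gamma ^+ h / 2 / (b * i%:R) by apply: divr_ge0; [apply: divr_ge0 => //; exact/exprn_ge0/ltW | apply: mulr_ge0; exact: ltW].
    apply: le_trans (ler_wpM2r c0 gap).
    rewrite le_eqVlt; apply/orP; left; apply/eqP.
    by move: (gamma ^+ h) => g; field; rewrite !gt_eqF.
  apply: ler_sum_nat => k /andP[jk]; rewrite jn => kJ.
  have kX : X0 * lambda ^+ h <= k%:R by apply: le_trans jX _; rewrite ler_nat.
  apply: ler_pM; rewrite ?invr_ge0 ?mulr_ge0 ?(ltW b0) //.
  - exact/exprn_ge0/ltW.
  - exact: IHh.
  rewrite lef_pV2 ?posrE ?mulr_gt0 // ler_pM2l //.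
  apply: (@le_trans _ _ J%:R); first by rewrite ler_nat.
  by apply: le_trans Jle _; rewrite ler_piMl // ltW.
have err : K%:R ^+ 2 * block_error b theta i <= gamma ^+ h.+1 / 2.
  have e1 : i.+1%:R `^ (1 - (1 + a)) <= gamma ^+ h.+1 / X0.
    have -> : 1 - (1 + a) = - a by ring.
    rewrite /powR pnatr_eq0 /=.
    have -> : gamma ^+ h.+1 / X0 = expR (h.+1%:R * ln gamma - ln X0).
      by rewrite expRD expRN expRM_natl !lnK ?posrE.
    rewrite ler_expR.
    have li : ln X0 + h.+1%:R * ln lambda <= ln i.+1%:R.
      rewrite mulr_natl -lnXn // -lnM ?posrE ?exprn_gt0 // ler_ln ?posrE ?mulr_gt0 ?exprn_gt0 //.
      by apply: le_trans iX _; rewrite ler_nat.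
    have lX : 0 <= ln X0 by exact: ln_ge0.
    have a0 : 0 <= a by apply: le_trans a1.
    have H1 := ler_wpM2l a0 li.
    have H2 : ln X0 <= a * ln X0 by rewrite ler_peMl.
    have H3 := ler_wpM2l (ler0n R h.+1) al.
    move: H1 H2 H3; rewrite mulrDr mulrN mulNr mulrCA.
    by move: (h.+1%:R * ln gamma) (a * ln X0) (ln X0) (h.+1%:R * (a * ln lambda)) (a * ln i.+1%:R) => u v w x y; lra.
  have K2 : 0 <= K%:R ^+ 2 :> R by exact: sqr_ge0.
  apply: le_trans (ler_wpM2l K2 (le_trans (HN1 _ iN1) (ler_wpM2l (ltW C0) e1))) _.
  rewrite ler_pdivlMr //.
  have -> : K%:R ^+ 2 * (C * (gamma ^+ h.+1 / X0)) * 2 = gamma ^+ h.+1 * (2 * K%:R ^+ 2 * C / X0) by ring.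
  by rewrite ler_piMr ?exprn_ge0 ?(ltW ga0) // ler_pdivrMr // mul1r.
have main : 2 * gamma ^+ h.+1 <= inv_totient_sum (window b (chain_ge h.+1) j (J - j)) / K%:R.
  rewrite ler_pdivlMr //; apply: le_trans sumge.
  rewrite exprS {1}/gamma le_eqVlt; apply/orP; left; apply/eqP.
  by move: (gamma ^+ h) => g; field; rewrite !gt_eqF.
have g0 : 0 < gamma ^+ h.+1 by exact: exprn_gt0.
apply: (@le_trans _ _ (2 * gamma ^+ h.+1 - gamma ^+ h.+1 / 2)); last exact: lerB.
exact: aux g0.
Qed.

(** With [h] the integer part of [ln (i / X0) / ln lambda], the largest value the density bound
    allows, [gamma ^ h] is at least [i ^ (- K)] for [K = - ln gamma / ln lambda]. As
    [c < 1 / ln lambda], the constants in [h] and in [loglog p] are eventually absorbed. *)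
Lemma long_chain_block c : c < (ln lambda)^-1 ->
  exists2 K, 0 <= K & \forall i \near \oo,
    block_mass b i * i%:R `^ (- K) / 2 <= \sum_(p <- block b i) (long_chain c p)%:R.
Proof.
move=> cl; have ll := ln_gt0 lambda1.
have b0 : 0 < b by apply: lt_trans b1.
have [gamma [X0 [/andP[ga0 ga1] X1 dens]]] := power_density.
have X00 : 0 < X0 by apply: lt_le_trans X1.
have lga : ln gamma < 0 by apply: ln_lt0; rewrite ga0.
(* [c] may be negative, and a positive constant is wanted to multiply the upper bound for
   [loglog p]. *)
pose c' := Num.max c ((ln lambda)^-1 / 2).
have il0 : 0 < (ln lambda)^-1 by rewrite invr_gt0.
have c'0 : 0 < c' by rewrite lt_max divr_gt0 ?orbT.
have c'l : c' < (ln lambda)^-1 by rewrite gt_max cl /=; lra.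
have cc' : c <= c' by rewrite le_max lexx.
clearbody c'.
have K0 : 0 <= - ln gamma / ln lambda by rewrite divr_ge0 ?oppr_ge0 // ltW.
have aux (u v w n : R) : c' * w + (ln lambda)^-1 * v <= u * ((ln lambda)^-1 - c') ->
  (u - v) / ln lambda < n -> c' * (u + w) < n by rewrite mulrBl; lra.
exists (- ln gamma / ln lambda) => //.
have [N1 _ HN1] := near_ln_ge ((c' * ln (2 * ln b) + (ln lambda)^-1 * ln X0)
  / ((ln lambda)^-1 - c')).
near=> i.
have iN1 : (N1 <= i)%N by near: i; exact: nbhs_infty_ge.
have iX : X0 <= i%:R by near: i; exact: nbhs_infty_ger.
have bi : 2 <= b ^+ i by near: i; exact: near_expr_ge.
have bie : expR 1 <= b ^+ i by near: i; exact: near_expr_ge.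
have iR : 0 < i%:R :> R by apply: lt_le_trans iX.
have i0 : (0 < i)%N by rewrite -(ltr_nat R).
have H1 := HN1 _ iN1; rewrite /= ler_pdivrMr ?subr_gt0 // in H1.
pose h := Num.truncn (ln (i%:R / X0) / ln lambda).
have lnq0 : 0 <= ln (i%:R / X0) by rewrite ln_ge0 // ler_pdivlMr // mul1r.
have lnqE : ln (i%:R / X0) = ln i%:R - ln X0 by rewrite ln_div ?posrE.
have hle : h%:R <= ln (i%:R / X0) / ln lambda by rewrite truncn_le divr_ge0 // ltW.
have hgt : ln (i%:R / X0) / ln lambda < h.+1%:R by exact: truncnS_gt.
clearbody h.
have W0 := block_mass_gt0 b1 bi.
have iXh : X0 * lambda ^+ h <= i%:R.
  have l0 : 0 < lambda by apply: lt_trans lambda1.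
  rewrite mulrC -ler_pdivlMr // -ler_ln ?posrE ?exprn_gt0 ?divr_gt0 // lnXn //.
  by rewrite -[_ *+ _]mulr_natl -ler_pdivlMr.
have D := dens _ _ iXh.
have gh : i%:R `^ (- (- ln gamma / ln lambda)) <= gamma ^+ h.
  have -> : gamma ^+ h = expR (h%:R * ln gamma) by rewrite expRM_natl lnK ?posrE.
  rewrite /powR gt_eqF // ler_expR.
  have lX : 0 <= ln X0 by exact: ln_ge0.
  have hle2 : h%:R <= ln i%:R / ln lambda.
    by apply: le_trans hle _; rewrite ler_pM2r // lnqE gerBl.
  have -> : - (- ln gamma / ln lambda) * ln i%:R = ln i%:R / ln lambda * ln gamma by ring.
  by apply: ler_wnM2r => //; exact: ltW.
apply: (@le_trans _ _ (\sum_(p <- block b i) (chain_ge h.+1 p)%:R)).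
  move: D; rewrite /density ler_pdivlMr //; apply: le_trans.
  by rewrite [leRHS]mulrC -mulrA ler_pM2l // ler_pM2r // invr_gt0.
rewrite big_seq [leRHS]big_seq; apply: ler_sum => p pB.
rewrite ler_nat; case: (boolP (chain_ge _ p)) => // hp.
suff -> : long_chain c p by [].
have [lp0 llp] := loglog_block_le b1 i0 pB.
have ll0 : 0 <= loglog p%:R :> R.
  apply: ln_ge0; rewrite -[leLHS]expRK ler_ln ?posrE ?expR_gt0 //; move/(blockP b1): pB => [pp bp _].
    by rewrite (le_trans bie) // ltW.
  by rewrite ltr0n prime_gt0.
rewrite /long_chain; apply: (@lt_le_trans _ _ h.+1%:R); last by rewrite ler_nat.
apply: le_lt_trans (ler_wpM2r ll0 cc') _.
apply: le_lt_trans (ler_wpM2l (ltW c'0) llp) _.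
by apply: aux H1 _; rewrite -lnqE.
Unshelve. all: by end_near. Qed.

(** A single block just below [x] already contains enough primes; one more power of the logarithm
    than in the block bound pays for [block_mass]. *)
Lemma many_long_chains c : c < (ln lambda)^-1 ->
  exists K : R, (fun x : R => x / ln x `^ K) =O_infty
    (fun x : R => (prime_count (long_chain c) x)%:R : R).
Proof.
move=> cl; have [K K0 [N _ HN]] := long_chain_block cl.
have b0 : 0 < b by apply: lt_trans b1.
have lb := ln_gt0 b1.
exists (K + 1); apply/eqOP.
pose M : R := 2 * b ^+ 2 * ln b `^ (- (K + 1)).
exists M; split; first exact: num_real.
move=> k Mk; have [N2 _ HN2] := near_expr_ge 2 b1.
exists (b ^+ (maxn N N2).+2); split; first exact: num_real.
move=> x xbig.
have x1 : 1 < x by apply: (le_lt_trans _ xbig); rewrite exprn_ege1 // ltW.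
have [m /andP[mx xm]] := block_index b1 (ltW x1).
have Nm : ((maxn N N2).+1 < m)%N.
  rewrite ltnNge; apply/negP => mN; move: (lt_trans xbig xm).
  by rewrite ltNge ler_weXn2l // ltW.
case: m mx xm Nm => // i mx xm; rewrite !ltnS => Ni0; have i0 : (0 < i)%N by apply: leq_trans Ni0.
move: (ltnW Ni0); rewrite geq_max => /andP[Ni N2i].
have bi : 2 <= b ^+ i by exact: HN2.
have W0 := block_mass_gt0 b1 bi.
have x0 : 0 < x by apply: lt_trans x1.
have lx : 0 < ln x by exact: ln_gt0.
rewrite ger0_norm; last by rewrite divr_ge0 ?powR_ge0 ?(ltW x0).
rewrite ger0_norm //.
have iR : 0 < i%:R :> R by rewrite ltr0n.
have iS : 0 < i.+1%:R :> R by [].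
have K1 : 0 <= K + 1 by rewrite addr_ge0.
have antitone (u v a : R) : 0 <= a -> 0 < u -> u <= v -> v `^ (- a) <= u `^ (- a).
  move=> a0 u0 uv; have v0 : 0 < v by apply: lt_le_trans uv.
  by rewrite !powRN lef_pV2 ?posrE ?powR_gt0 // ge0_ler_powR ?nnegrE // ltW.
have lnx : i.+1%:R * ln b <= ln x.
  by rewrite mulr_natl -lnXn // ler_ln ?posrE ?exprn_gt0.
have upper : x / ln x `^ (K + 1) <= b ^+ 2 * b ^+ i * (i.+1%:R `^ (- (K + 1)) * ln b `^ (- (K + 1))).
  rewrite -powRN; apply: ler_pM; rewrite ?powR_ge0 ?(ltW x0) //.
    by apply/ltW; rewrite -exprD add2n.
  rewrite -powRM ?(ltW lb) //; apply: antitone => //; exact: mulr_gt0.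
have lower : b ^+ i * i.+1%:R `^ (- (K + 1)) <= block_mass b i * i%:R `^ (- K).
  have -> : i.+1%:R `^ (- (K + 1)) = i.+1%:R^-1 * i.+1%:R `^ (- K) :> R.
    rewrite opprD powRD; last by rewrite pnatr_eq0 implybT.
    by rewrite mulrC powRN powRr1.
  rewrite mulrA; apply: ler_pM; rewrite ?powR_ge0 ?divr_ge0 ?exprn_ge0 ?(ltW b0) //.
    exact: block_mass_ge.
  by apply: antitone; rewrite // ler_nat.
have cnt : block_mass b i * i%:R `^ (- K) / 2 <= (prime_count (long_chain c) x)%:R.
  apply: le_trans (HN _ Ni) _.
  apply: (@le_trans _ _ (prime_count (long_chain c) (b ^+ i.+1))%:R); last first.
    by rewrite ler_nat prime_count_mono.
  by rewrite (prime_count_blocks _ b1 (leqnSn i)) big_nat1 lerDr.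
apply: (@le_trans _ _ (M * (prime_count (long_chain c) x)%:R)); last by rewrite ler_wpM2r // ltW.
have M0 : 0 <= M by rewrite !mulr_ge0 ?powR_ge0 ?exprn_ge0 // ltW.
apply: le_trans (ler_wpM2l M0 cnt).
apply: le_trans upper _.
have c0 : 0 <= b ^+ 2 * ln b `^ (- (K + 1)) by rewrite mulr_ge0 ?powR_ge0 ?exprn_ge0 // ltW.
have := ler_wpM2l c0 lower.
rewrite /M; move: (b ^+ 2) (ln b `^ (- (K + 1))) (i.+1%:R `^ (- (K + 1))) (i%:R `^ (- K)) (b ^+ i) (block_mass b i) => u v w y z t H.
rewrite (_ : u * z * (w * v) = u * v * (z * w)); last by ring.
rewrite (_ : 2 * u * v * (t * y / 2) = u * v * (t * y)) //; by field.
Qed.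

Lemma Lambda_ge : ((ln lambda)^-1%:E <= Lambda R)%E.
Proof.
have b0 : 0 < b by apply: lt_trans b1.
(* The upper limit is an infimum over sets [V] containing all large primes. Each late block has a
   positive lower bound for its number of long chains, hence supplies such a prime in [V]. *)
apply: le_ereal_inf_tmp => y [V /= [N _ NV] <-].
apply/lee_subgt0Pr => e e0; rewrite -EFinB.
have cl : (ln lambda)^-1 - e < (ln lambda)^-1 by rewrite gtrBl.
have [K K0 [N1 _ HN1]] := long_chain_block cl.
have [N2 _ HN2] := near_expr_ge (N%:R + expR 1 + 2) b1.
set i := maxn (maxn N1 N2) 1%N.
have bi : N%:R + expR 1 + 2 <= b ^+ i by apply: HN2; rewrite /= /i !leq_max leqnn !orbT.
have e1 := expR_gt0 (1 : R).
have NR : 0 <= N%:R :> R by [].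
have b2 : 2 <= b ^+ i by lra.
have := HN1 i; rewrite /= /i !leq_max leqnn /= -/i => /(_ isT) H.
have i0 : (0 < i)%N by rewrite /i leq_max orbT.
have pos : 0 < block_mass b i * i%:R `^ (- K) / 2.
  by rewrite divr_gt0 ?mulr_gt0 ?powR_gt0 ?ltr0n // block_mass_gt0.
have [p pB cp] : exists2 p, p \in block b i & long_chain ((ln lambda)^-1 - e) p.
  apply/hasP; apply: contraT => /hasPn none; move: (lt_le_trans pos H).
  by rewrite big_seq big1 ?ltxx // => p /none /negbTE ->.
have /(blockP b1)[pp bp _] := pB.
have lpe : 1 < ln p%:R :> R.
  rewrite -[ltLHS]expRK ltr_ln ?posrE ?expR_gt0 ?ltr0n ?prime_gt0 //.
  by apply: le_lt_trans bp; lra.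
have ll0 : 0 < loglog p%:R :> R by exact: ln_gt0.
apply: le_ereal_sup_tmp; exists ((maxchain p)%:R / loglog p%:R)%:E.
  exists p => //; apply: NV => //=.
  by rewrite -(ler_nat R); apply: le_trans (ltW bp); lra.
by rewrite lee_fin ler_pdivlMr // ltW.
Qed.


End ManyPrimes.

(** * Choice of the constants *)

Section Conclusion.
Context {R : realType}.

(** Lowering the constant weakens the condition where [loglog p >= 0]; hence the restriction to late
    blocks. *)
Lemma long_chain_mono (b c c' : R) : 1 < b -> c <= c' -> \forall i \near \oo,
  forall p, p \in block b i -> long_chain c' p -> long_chain c p.
Proof.
move=> b1 cc'; near=> i => p /(blockP b1)[pp bp _].
have bie : expR 1 <= b ^+ i by near: i; exact: near_expr_ge.
rewrite /long_chain; apply: le_lt_trans; apply: ler_wpM2r => //.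
apply: ln_ge0; rewrite -[leLHS]expRK ler_ln ?posrE ?expR_gt0 ?ltr0n ?prime_gt0 //.
by rewrite (le_trans bie) // ltW.
Unshelve. all: by end_near. Qed.

(** The condition on the constant becomes [1 < Y]. All losses are tied to one small [sg]: base
    [b = 1 / (1 - sg)], rounding factor [1 - sg], [eta = sg / 2] and [beta] equal to [theta] times
    e^(-sg). Together they leave [(1 - sg) ^ 3 * (Y - sg * e)], still above 1. *)
Lemma almost_all_long_chain (theta : R) (B : R -> R) c :
  0 < theta -> theta < 1 ->
  B =o_infty (fun x : R => x / ln x) ->
  discrepancy_estimate (fun x : R => x `^ theta) B ->
  c < ((expR 1)^-1 - ln theta)^-1 -> almost_all_primes (R := R) (long_chain c).
Proof.
move=> th0 th1 Bo dB cL.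
set L := (_ - _)^-1 in cL.
have e0 := expR_gt0 (1 : R).
have lth : ln theta < 0 by apply: ln_lt0; rewrite th0.
have Li0 : 0 < (expR 1)^-1 - ln theta.
  by rewrite subr_gt0 (lt_trans lth) // invr_gt0.
have L0 : 0 < L by rewrite invr_gt0.
pose c0 := Num.max c (L / 2).
have c00 : 0 < c0 by rewrite lt_max divr_gt0 ?orbT.
have c0L : c0 < L by rewrite gt_max cL /=; lra.
have cc0 : c <= c0 by rewrite le_max lexx.
clearbody c0.
pose c1 := (c0 + L) / 2.
have c01 : c0 < c1 by rewrite /c1; lra.
have c1L : c1 < L by rewrite /c1; lra.
have c10 : 0 < c1 by apply: lt_trans c01.
clearbody c1.
pose Y := (c1^-1 + ln theta) * expR 1.
have Y1 : 1 < Y.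
  have : L^-1 < c1^-1 by rewrite ltf_pV2 ?posrE.
  rewrite /L invrK => H.
  by rewrite /Y -ltr_pdivrMr // div1r; lra.
have den0 : 0 < 2 * (expR 1 + 3 * Y) by rewrite mulr_gt0 // addr_gt0 // mulr_gt0 //; lra.
(* Chosen so that the first-order lower bound [Y - sg * (e + 3 * Y)] for that product becomes
   [(Y + 1) / 2]. *)
pose sg := (Y - 1) / (2 * (expR 1 + 3 * Y)).
have sg0 : 0 < sg by rewrite divr_gt0 //; lra.
have sgE : sg * (expR 1 + 3 * Y) = (Y - 1) / 2.
  by rewrite /sg; field; rewrite gt_eqF //; lra.
have sg6 : sg < 1 / 6.
  by rewrite /sg ltr_pdivrMr //; move: e0; move: (expR 1) => e e0; lra.
clearbody sg.
pose b := (1 - sg)^-1.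
have b1 : 1 < b by rewrite /b invf_gt1; lra.
have err0 := block_error_to0 b1 Bo dB.
pose beta := theta * expR (- sg).
pose beta0 := theta * expR (- (sg / 2)).
have be : 0 < beta < beta0.
  by rewrite mulr_gt0 ?expR_gt0 //= ltr_pM2l // ltr_expR; lra.
have be0 : beta0 < theta by rewrite gtr_pMr // expR_lt1; lra.
have eta : 0 < sg / 2 <= 1 / 2 by apply/andP; split; lra.
have rho1 : 0 <= 1 - sg < 1 by apply/andP; split; lra.
have key : 1 < (1 - 2 * (sg / 2)) * (1 - sg) / b * (c1^-1 + ln beta) * expR 1.
  have -> : (1 - 2 * (sg / 2)) * (1 - sg) / b * (c1^-1 + ln beta) * expR 1 =
     (1 - sg) ^+ 3 * (Y - sg * expR 1).
    rewrite /beta lnM ?posrE ?expR_gt0 // expRK /Y /b invrK.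
    by move: (ln theta) (c1^-1) (expR 1) => u v w; field.
  have se : sg * expR 1 <= (Y - 1) / 2.
    rewrite -sgE ler_pM2l //; lra.
  have H1 : 1 - 3 * sg <= (1 - sg) ^+ 3.
    rewrite !exprS expr0 mulr1 -subr_ge0.
    have -> : (1 - sg) * ((1 - sg) * (1 - sg)) - (1 - 3 * sg) = sg * sg * (3 - sg) by ring.
    by rewrite !mulr_ge0 //; lra.
  have H2 : 0 <= Y - sg * expR 1 by lra.
  apply: lt_le_trans (ler_wpM2r H2 H1).
  have -> : (1 - 3 * sg) * (Y - sg * expR 1) =
     Y - sg * (expR 1 + 3 * Y) + 3 * sg * (sg * expR 1) by ring.
  rewrite sgE.
  have : 0 <= 3 * sg * (sg * expR 1) by rewrite !mulr_ge0 //; lra.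
  lra.
have [n [delta [Z [n0 de0 Z0 dens]]]] :=
  positive_density b1 th0 (ltW th1) err0 be be0 c10 eta rho1 key.
have c001 : 0 < c0 < c1 by rewrite c00.
have blocks := almost_all_blocks b1 th0 (ltW th1) err0 c001 n0 de0 Z0 dens.
apply: (almost_all_of_blocks b1) => eps eps0.
have [N1 _ HN1] := blocks _ eps0.
have [N2 _ HN2] := long_chain_mono b1 cc0.
near=> i.
have iN1 : (N1 <= i)%N by near: i; exact: nbhs_infty_ge.
have iN2 : (N2 <= i)%N by near: i; exact: nbhs_infty_ge.
apply: le_trans (HN1 _ iN1); rewrite big_seq [leRHS]big_seq.
apply: ler_sum => p pB; rewrite ler_nat; have := HN2 _ iN2 p pB.
by case: (long_chain c0 p) => [->|_] //; exact: leq_b1.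
Unshelve. all: by end_near. Qed.

Lemma exists_scale_ratio (theta c : R) : 0 < theta -> theta < 1 ->
  c < (- ln theta)^-1 ->
  exists lambda, [/\ 1 < lambda, lambda^-1 < theta & c < (ln lambda)^-1].
Proof.
move=> th0 th1 cL; have lth : ln theta < 0 by apply: ln_lt0; rewrite th0.
have L0 : 0 < (- ln theta)^-1 by rewrite invr_gt0 oppr_gt0.
(* This midpoint is positive even when [c] is negative; taking [lambda] as the exponential of
   [1 / u] turns the bounds on [u] into those on [lambda]. *)
pose u := (Num.max c 0 + (- ln theta)^-1) / 2.
have m0 : 0 <= Num.max c 0 by rewrite le_max lexx orbT.
have mL : Num.max c 0 < (- ln theta)^-1 by rewrite gt_max cL.
have cm : c <= Num.max c 0 by rewrite le_max lexx.
have u0 : 0 < u by rewrite /u; lra.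
have uL : u < (- ln theta)^-1 by rewrite /u; lra.
have cu : c < u by rewrite /u; lra.
exists (expR u^-1); split.
- by rewrite expR_gt1 invr_gt0.
- rewrite -expRN -[ltRHS]lnK ?posrE // ltr_expR ltrNl.
  by rewrite -[ltLHS]invrK ltf_pV2 ?posrE.
- by rewrite expRK invrK.
Qed.

End Conclusion.

Theorem theorem3 (R : realType) (theta : R)
    (theta_gt0 : 0 < theta) (theta_lt1 : theta < 1) :
  ((exists B : R -> R,
      B =o_infty (fun x : R => x / ln x) /\
      discrepancy_estimate (fun x : R => x `^ theta) B) ->
   forall c : R, c < ((expR 1)^-1 - ln theta)^-1 ->
     almost_all_primes (R := R) (long_chain c))
  /\
  ((forall A : R, 1 < A ->
      discrepancy_estimate (fun x : R => x `^ theta)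
        (fun x : R => x * ln x `^ (- A))) ->
   (forall c : R, c < (- ln theta)^-1 ->
      exists K : R,
        (fun x : R => x / ln x `^ K) =O_infty
        (fun x : R => (prime_count (long_chain c) x)%:R : R))
   /\ (((- ln theta)^-1)%:E <= Lambda R)%E).

Proof.
split=> [[B [Bo dB]] c cL | estimate].
  exact: almost_all_long_chain Bo dB cL.
(* Any base serves in part (b): it affects [gamma], hence [K], but not the bound on [c]. *)
have b1 : 1 < 2 :> R by rewrite ltr1n.
have power A (A1 : 1 < A) := block_error_power b1 (estimate A A1).
split=> [c cL|].
  have [lambda [l1 lth cl]] := exists_scale_ratio theta_gt0 theta_lt1 cL.
  have [K HK] := many_long_chains b1 (ltW theta_lt1) l1 lth power cl.
  by exists K.
(* Every admissible [lambda] has [lambda^-1 < theta] strictly, so the bound for [Lambda] is obtained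
   as a limit. *)
apply/lee_subgt0Pr => e e0; rewrite -EFinB.
have cL : (- ln theta)^-1 - e < (- ln theta)^-1 by rewrite gtrBl.
have [lambda [l1 lth cl]] := exists_scale_ratio theta_gt0 theta_lt1 cL.
apply: le_trans (Lambda_ge b1 (ltW theta_lt1) l1 lth power).
by rewrite lee_fin ltW.
Qed.
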